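(* Let $\rho,\sigma>0$ and let $H^{(0)}$ be a Hamiltonian that is analytic in the domain $\mathcal{D}_{\rho,\sigma}$ and is expanded as $$H^{(0)}(\hat p,\hat q)=\omega p_1+f_4^{(0,0)}(\hat p)+\sum_{l>2}f_{2l}^{(0,0)}(\hat p)+\sum_{s\ge1}f_0^{(0,s)}(\hat q)+\sum_{s\ge1}f_2^{(0,s)}(\hat p,\hat q)+\sum_{s>0}\sum_{l>1}f_{2l}^{(0,s)}(\hat p,\hat q),$$ where $f_{2l}^{(0,s)}\in\mathcal{P}_{2l}$ is a function of order $O(\varepsilon^s)$. Assume that (a) there exists a positive constant $m$ such that for every $v\in\mathbb{R}^n$ $$m\sum_{i=1}^n|v_i|\le\sum_{i=1}^n\Bigl|\sum_{j=1}^nC_{ij}v_j\Bigr|,\qquad C_{ij}=\frac{\partial^2f_4^{(0,0)}}{\partial\hat p_i\,\partial\hat p_j};$$ (b) there is $E>0$ such that all terms appearing in the expansion of $H^{(0)}$ satisfy $\|f_l^{(0,s)}\|_1\le\frac{E}{2^l}\varepsilon^s$. Let $q^*$ be a fixed but arbitrary value of the angles $q$. Then for every positive integer $r$ there is a positive $\varepsilon_r^*$ such that for $0\le\varepsilon<\varepsilon_r^*$ there exists an analytic canonical transformation $\Phi^{(r)}$ satisfying $$\mathcal{D}_{\frac14(\rho,\sigma)}\subset\Phi^{(r)}\bigl(\mathcal{D}_{\frac12(\rho,\sigma)}\bigr)\subset\mathcal{D}_{\frac34(\rho,\sigma)}$$ such that the Hamiltonian $H^{(r)}=H^{(0)}\circ\Phi^{(r)}$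 is in normal form up to order $r$, namely $$\begin{aligned}H^{(r)}(p_1,p,q_1,q;q^* )&=\omega p_1+f_4^{(r,0)}(p_1,p)+\sum_{l>2}f_{2l}^{(r,0)}(p_1,p)\\&\quad+\sum_{s=1}^rf_0^{(r,s)}(q;q^* )+\sum_{s=1}^rf_2^{(r,s)}(p_1,p,q;q^* )\\&\quad+\sum_{s>r}f_0^{(r,s)}(q_1,q;q^* )+\sum_{s>r}f_2^{(r,s)}(p_1,p,q_1,q;q^* )\\&\quad+\sum_{s>0}\sum_{l>1}f_{2l}^{(r,s)}(p_1,p,q_1,q;q^* ),\end{aligned}$$ where $f_{2l}^{(r,s)}\in\mathcal{P}_{2l}$ is a function of order $O(\varepsilon^s)$ (so the terms $f_0^{(r,s)},f_2^{(r,s)}$ with $1\le s\le r$ do not depend on $q_1$). Moreover, for $q=q^*$ one has $$\sum_{s=1}^rf_2^{(r,s)}(p_1,p,q^*;q^* )=0.$$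
   Context: $n$ is the number of degrees of freedom. The canonical coordinates are actions $\hat p=(p_1,p)$ with $p_1=\hat p_1$, $p=(\hat p_2,\dots,\hat p_n)$, and conjugate angles $\hat q=(q_1,q)\in\mathbb{T}^n$ with $q_1=\hat q_1$, $q=(\hat q_2,\dots,\hat q_n)$. $\varepsilon$ is a small real parameter and $\omega\neq0$ is a fixed real number (the frequency of the unperturbed periodic orbits $\hat p=0$, $q_1=q_1(0)+\omega t$, $q=q^*$, lying on a completely resonant torus). Domains: $\mathcal{D}_{\rho,\sigma}=\mathcal{G}_\rho\times\mathbb{T}^n_\sigma$ with $\mathcal{G}_\rho=\{\hat p\in\mathbb{C}^n:\max_j|\hat p_j|<\rho\}$ and $\mathbb{T}^n_\sigma=\{\hat q\in\mathbb{C}^n:\mathrm{Re}\,\hat q_j\in\mathbb{T},\ \max_j|\mathrm{Im}\,\hat q_j|<\sigma\}$; $\mathcal{D}_{\alpha(\rho,\sigma)}=\mathcal{D}_{\alpha\rho,\alpha\sigma}$. $\mathcal{P}_{2l}$ (integer $l\ge0$) is the class of functions with a Fourier–Taylor expansion $g(\hat p,\hat q)=\sum_{i\in\mathbb{N}^n,|i|=l}\sum_{k\in\mathbb{Z}^n}g_{i,k}\,\hat p^i e^{\mathbf{i}\langle k,\hat q\rangle}$, $g_{i,k}\in\mathbb{C}$, i.e. homogeneous polynomials of degree $l$ in $\hat p$ (the lower index $2l$ corresponds to degree $l$ in the actions). The weighted Fourier norm of $g\in\mathcal{P}_{2l}$ is $\|g\|_{\rho,\sigma}=\sum_{|i|=l}\sum_k|g_{i,k}|\rho^le^{|k|\sigma}$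 with $|k|=\sum_j|k_j|$, and $\|\cdot\|_\alpha$ is shorthand for $\|\cdot\|_{\alpha\rho,\alpha\sigma}$. *)

(* Defs.v *)
From HB Require Import structures.
From mathcomp Require Import all_boot all_order all_algebra.
From mathcomp Require Import finmap complex.
From mathcomp Require Import all_classical all_reals all_analysis.
From mathcomp Require Import summability.

Set Implicit Arguments.
Unset Strict Implicit.
Unset Printing Implicit Defensive.

Import Order.TTheory GRing.Theory Num.Theory.
Import numFieldNormedType.Exports.

Local Open Scope classical_set_scope.
Local Open Scope ring_scope.
Local Open Scope complex_scope.

(* Gives R[i] the topology of its modulus, as a normed space over itself, so
   that [differentiable] and ['D_v] below mean complex differentiation. *)
HB.instance Definition _ (R : realType) := NormedModule.copy R[i] R[i]^o.

(* Unconditional (equivalently, absolute) convergence of a family of complex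
   numbers. *)
Definition has_sum (R : realType) (I : choiceType) (x : I -> R[i]) (s : R[i]) :=
  partial_sum x @ totally --> s.

Definition cexp (R : realType) (z : R[i]) : R[i] :=
  (expR (complex.Re z))%:C * (cos (complex.Im z) +i* sin (complex.Im z)).

Section PhaseSpace.
Context {R : realType} {n : nat}.

(* A point (p, q) of the complexified phase space with n degrees of freedom is
   the row vector [row_mx p q]. Angles are represented by their lifts to C^n. *)
Definition act (z : 'rV[R[i]]_(n + n)) (j : 'I_n) : R[i] := lsubmx z 0 j.
Definition ang (z : 'rV[R[i]]_(n + n)) (j : 'I_n) : R[i] := rsubmx z 0 j.

Definition dom (rho sigma : R) : set 'rV[R[i]]_(n + n) :=
  [set z | (forall j, `|act z j| < rho%:C) /\
           (forall j, `|complex.Im (ang z j)| < sigma)].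

(* Two lifts represent the same point of C^n x (C / 2 pi Z)^n. *)
Definition same_point (z z' : 'rV[R[i]]_(n + n)) : Prop :=
  (forall j, act z' j = act z j) /\
  exists k : 'I_n -> int,
    forall j, ang z' j = ang z j + (pi *+ 2 * (k j)%:~R)%:C.

Definition real_point (z : 'rV[R[i]]_(n + n)) : Prop :=
  forall j, complex.Im (act z j) = 0 /\ complex.Im (ang z j) = 0.

Definition analytic_on (V : normedModType R[i]) (A : set 'rV[R[i]]_(n + n))
    (F : 'rV[R[i]]_(n + n) -> V) : Prop :=
  forall z, A z -> differentiable F z.

Definition symplectic_mx : 'M[R[i]]_(n + n) := block_mx 0 1%:M (- 1%:M) 0.

(* A map induced on the torus quotient that is injective there, analytic, and
   preserves sum_j dp_j /\ dq_j. The library's Jacobian acts on row vectors,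
   ['D_v F z = v *m 'J F z], hence the side on which the transpose stands. *)
Definition canonical_transformation (A : set 'rV[R[i]]_(n + n))
    (Phi : 'rV[R[i]]_(n + n) -> 'rV[R[i]]_(n + n)) : Prop :=
  [/\ analytic_on A Phi,
      forall z z', A z -> A z' ->
        (same_point (Phi z) (Phi z') <-> same_point z z')
    & forall z, A z ->
        'J Phi z *m symplectic_mx *m ('J Phi z)^T = symplectic_mx].

(* Inclusion [B `<=` Phi @` A], read in the torus quotient. *)
Definition covers (A B : set 'rV[R[i]]_(n + n))
    (Phi : 'rV[R[i]]_(n + n) -> 'rV[R[i]]_(n + n)) : Prop :=
  forall y, B y -> exists2 z, A z & same_point (Phi z) y.

(* The Fourier-Taylor coefficients g_{i,k}, i in N^n and k in Z^n. *)
Definition ft_coef := {ffun 'I_n -> nat} -> {ffun 'I_n -> int} -> R[i].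

Definition ft_eval (g : ft_coef) (z : 'rV[R[i]]_(n + n)) : R[i] :=
  sum (fun ik : {ffun 'I_n -> nat} * {ffun 'I_n -> int} =>
    g ik.1 ik.2 * (\prod_j act z j ^+ ik.1 j)
      * cexp ('i * \sum_j (ik.2 j)%:~R * ang z j)).

Definition mlen (i : {ffun 'I_n -> nat}) : nat := (\sum_j i j)%N.
Definition klen (k : {ffun 'I_n -> int}) : nat := (\sum_j `|k j|)%N.

(* The class P_{2l}. *)
Definition homog (l : nat) (g : ft_coef) : Prop :=
  forall i k, mlen i != l -> g i k = 0.

(* The weighted Fourier norm on P_{2l}; +oo if the series diverges. *)
Definition ft_norm (l : nat) (rho sigma : R) (g : ft_coef) : \bar R :=
  (\esum_(ik in [set ik : {ffun 'I_n -> nat} * {ffun 'I_n -> int} |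
                 mlen ik.1 = l])
     (complex.Re `|g ik.1 ik.2| * rho ^+ l
        * expR ((klen ik.2)%:R * sigma))%:E)%E.

Definition angle_free (g : ft_coef) : Prop :=
  forall i (k : {ffun 'I_n -> int}), k != 0 -> g i k = 0.

Definition indep_angle (j : 'I_n) (g : ft_coef) : Prop :=
  forall i (k : {ffun 'I_n -> int}), k j != 0 -> g i k = 0.

(* The function with coefficients g is real on real points. *)
Definition real_coef (g : ft_coef) : Prop :=
  forall i (k : {ffun 'I_n -> int}), g i (- k) = (g i k)^*.

(* d^2 F / dp_i dp_j for F of degree two in the actions and independent of the
   angles, so that the base point does not matter. *)
Definition action_hessian (g : ft_coef) (i j : 'I_n) : R[i] :=
  'D_(delta_mx 0 (lshift n i))
    (fun z => 'D_(delta_mx 0 (lshift n j)) (ft_eval g) z) 0.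

End PhaseSpace.

Arguments ft_coef : clear implicits.

(* In a family f of coefficients, [f l s] stands for f_{2l}^{(.,s)}. *)

(* The pairs (l, s) for which f_{2l}^{(.,s)} occurs in the expansions: the
   angle-independent part s = 0 starts at l = 2, the linear term omega p_1 being
   written apart. *)
Definition present (l s : nat) : bool := (0 < s)%N || (1 < l)%N.

Definition has_expansion (R : realType) (n : nat) (omega : R)
    (f : nat -> nat -> ft_coef R n.+1) (A : set 'rV[R[i]]_(n.+1 + n.+1))
    (H : 'rV[R[i]]_(n.+1 + n.+1) -> R[i]) : Prop :=
  forall z, A z ->
    has_sum (fun ls : nat * nat =>
               if present ls.1 ls.2 then ft_eval (f ls.1 ls.2) z else 0)
            (H z - omega%:C * act z ord0).

Definition expansion_terms (R : realType) (n : nat)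
    (f : nat -> nat -> ft_coef R n.+1) : Prop :=
  (forall l s, present l s -> homog l (f l s)) /\
  (forall l, (1 < l)%N -> angle_free (f l 0%N)).

Definition real_terms (R : realType) (n : nat)
    (f : nat -> nat -> ft_coef R n.+1) : Prop :=
  forall l s, present l s -> real_coef (f l s).

(* The terms of order at most r of degree 0 and 1 in the actions do not depend
   on q_1, and those of degree 1 cancel on q = qstar. *)
Definition normal_form (R : realType) (n r : nat)
    (A : set 'rV[R[i]]_(n.+1 + n.+1)) (qstar : 'rV[R]_n)
    (f : nat -> nat -> ft_coef R n.+1) : Prop :=
  (forall s, (1 <= s <= r)%N ->
     indep_angle ord0 (f 0%N s) /\ indep_angle ord0 (f 1%N s)) /\
  (forall z, A z -> (forall j, ang z (lift ord0 j) = (qstar 0 j)%:C) ->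
     \sum_(1 <= s < r.+1) ft_eval (f 1%N s) z = 0).

(* Main.v *)
(* The Hamiltonian is normalised one power of eps at a time inside the algebra
   of absolutely convergent weighted Fourier-Taylor series. At a given stage
   H = omega p_1 + h(p) + A + B, where h collects the angle-free terms of degree
   at least two, A = O(eps) is in normal form and B = O(kappa), kappa = eps^s.
   The shear p |-> p + c(q), c = grad S + zeta, removes the q_1-dependent part
   of B of degree zero (a choice of omega d_1 S) and, since the Hessian C of f_4
   is invertible, the value at q = q* of the q_1-average of its part of degree
   one (a choice of C zeta). The point transformation q |-> q + u(q),
   p |-> p (1 + Du)^-1 then removes the q_1-dependent part of degree one. The
   increment of h under these maps is only O(kappa), but its part of degree at
   most one is O(kappa^2) because h vanishes to second order in the actions;
   this is read off from majorants of the norm at all action radii, evaluated at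
   a small radius. So everything new is either normal and O(eps), or
   O(kappa eps). Each stage costs a fixed fraction of the domain, and r stages
   lead from 3/4 to 1/2. *)

Require Import Defs.
From HB Require Import structures.
From mathcomp Require Import all_boot all_order all_algebra.
From mathcomp Require Import finmap complex.
From mathcomp Require Import all_classical all_reals all_analysis.
From mathcomp Require Import summability.
From mathcomp Require Import zify ring lra.

Set Implicit Arguments.
Unset Strict Implicit.
Unset Printing Implicit Defensive.

Import Order.TTheory GRing.Theory Num.Theory.
Import numFieldNormedType.Exports.

Local Open Scope classical_set_scope.
Local Open Scope ring_scope.
Local Open Scope complex_scope.

(** * Unconditional sums of complex numbers *)

(** Both canonical maps are in closed form, so canonicity is a block-matrix identity, and the
    inclusions of domains follow from displacement bounds and a contraction. The divisors are omega
    k_1 with k_1 a nonzero integer, hence bounded below by |omega|; what a step costs is the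
    derivatives of its generators, paid for in domain width. The obstacle is that [h] is not small,
    so its increment carries no spare factor eps. Under the shear the quadratic part of [h] even
    produces the term p C c, of degree one and merely linear in kappa; it is expanded exactly and
    shared out between the equation for zeta and the term left to the point transformation. Only the
    part of [h] of degree at least three is treated by majorants there. Being O(eps^s) is a norm
    bound for each eps, and the coefficients may depend on eps in any way. Two series, A and B,
    therefore carry the whole perturbation through all stages, while [h] itself never changes; at
    the end A is filed under order 1 and B under order r + 1. Composed functions are represented by
    coefficients known only to exist, so reality is restored after each stage by averaging with the
    complex conjugate. *)

Section Modulus.
Context {R : realType}.
Implicit Types x y z : R[i].

(** The norm of [R[i]] has its values in [R[i]]; a modulus in [R] moves all estimates to a totally
    ordered field. *)
Definition cabs x : R := complex.Re `|x|.

Lemma cabsE x : `|x| = (cabs x)%:C.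
Proof. by rewrite /cabs normc_def. Qed.

Lemma cabs_ge0 x : 0 <= cabs x.
Proof. by rewrite -ler0c -cabsE normr_ge0. Qed.

Lemma cabsM x y : cabs (x * y) = cabs x * cabs y.
Proof. by apply: complexI; rewrite rmorphM -!cabsE normrM. Qed.

Lemma cabsD x y : cabs (x + y) <= cabs x + cabs y.
Proof. by rewrite -lecR rmorphD -!cabsE ler_normD. Qed.

Lemma cabs0 : cabs 0 = 0.
Proof. by apply: complexI; rewrite -cabsE normr0. Qed.

Lemma cabs1 : cabs 1 = 1.
Proof. by apply: complexI; rewrite -cabsE normr1. Qed.

Lemma cabsN x : cabs (- x) = cabs x.
Proof. by rewrite /cabs normrN. Qed.

Lemma cabsC x y : cabs (x - y) = cabs (y - x).
Proof. by rewrite -cabsN opprB. Qed.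

Lemma cabsB x y : cabs (x - y) <= cabs x + cabs y.
Proof. by rewrite -(cabsN y); exact: cabsD. Qed.

Lemma cabs_eq0 x : cabs x = 0 -> x = 0.
Proof. by move=> x0; apply/normr0_eq0; rewrite cabsE x0. Qed.

Lemma cabs_sum (J : Type) (s : seq J) (P : pred J) (F : J -> R[i]) :
  cabs (\sum_(j <- s | P j) F j) <= \sum_(j <- s | P j) cabs (F j).
Proof.
elim/big_ind2: _ => [|x1 x2 y1 y2 h1 h2|//]; first by rewrite cabs0.
exact: le_trans (cabsD _ _) (lerD h1 h2).
Qed.

Lemma cabsX x n : cabs (x ^+ n) = cabs x ^+ n.
Proof. by elim: n => [|n IH]; rewrite ?expr0 ?cabs1// !exprS cabsM IH. Qed.

Lemma cabs_prod (J : Type) (s : seq J) (P : pred J) (F : J -> R[i]) :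
  cabs (\prod_(j <- s | P j) F j) = \prod_(j <- s | P j) cabs (F j).
Proof. by apply: big_morph; [exact: cabsM | exact: cabs1]. Qed.

Lemma cabs_real (r : R) : cabs r%:C = `|r|.
Proof. by rewrite /cabs normc_def /= expr0n /= addr0 sqrtr_sqr. Qed.

Lemma cabs_nneg (r : R) : 0 <= r -> cabs r%:C = r.
Proof. by move=> r0; rewrite cabs_real ger0_norm. Qed.

Lemma cabs_nat n : cabs n%:R = n%:R.
Proof. by rewrite -(rmorph_nat (real_complex R)) cabs_nneg. Qed.

Lemma cabs_int (k : int) : cabs k%:~R = (`|k|%N)%:R.
Proof.
rewrite -(rmorph_int (real_complex R)) cabs_real.
by rewrite -intr_norm -natr_absz.
Qed.

Lemma cabs_i : cabs 'i = 1.
Proof. by rewrite /cabs normc_def /= expr0n expr1n add0r sqrtr1. Qed.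

Lemma cabsV x : cabs x^-1 = (cabs x)^-1.
Proof. by apply: complexI; rewrite fmorphV /= -!cabsE normfV. Qed.

Lemma cabs_conj x : cabs x^* = cabs x.
Proof. by rewrite /cabs normcJ. Qed.

Lemma cabs_Re x : `|complex.Re x| <= cabs x.
Proof. by rewrite -lecR -cabsE normc_ge_Re. Qed.

Lemma cabs_Im x : `|complex.Im x| <= cabs x.
Proof.
suff -> : complex.Im x = - complex.Re ('i * x).
  by rewrite normrN; apply: le_trans (cabs_Re _) _; rewrite cabsM cabs_i mul1r.
by case: x => a b /=; ring.
Qed.

Lemma cabs_ReIm x : cabs x <= `|complex.Re x| + `|complex.Im x|.
Proof.
rewrite {1}(complexE x) (le_trans (cabsD _ _))// cabsM cabs_i mul1r.
by rewrite !cabs_real.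
Qed.

Lemma cvg_cabsP (T : Type) (F : set_system T) {FF : Filter F} (u : T -> R[i])
    (l : R[i]) :
  u x @[x --> F] --> l <->
  forall e : R, 0 < e -> \forall x \near F, cabs (l - u x) <= e.
Proof.
split=> [/cvgrPdist_le ul e e0|ul].
  have := ul e%:C; rewrite ltcR => /(_ e0).
  by apply: filterS => x; rewrite cabsE lecR.
apply/cvgrPdist_le => e e0.
(* A positive element of [R[i]] is real, so complex tolerances reduce to real ones. *)
have eE : e = (complex.Re e)%:C by rewrite RRe_real// gtr0_real.
rewrite eE ltcR in e0; apply: filterS (ul _ e0) => x h.
by rewrite eE cabsE lecR.
Qed.

End Modulus.

#[local] Existing Instance totally_filter.

Section UnconditionalSums.
Context {R : realType}.
Implicit Types I J : choiceType.

(** For nonnegative terms a bound on all finite sums encodes summability and a bound on the total at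
    once, before any limit is known to exist. *)
Definition rbound I (x : I -> R) (B : R) :=
  forall J : {fset I}, \sum_(i <- J) x i <= B.

Definition absum I (x : I -> R[i]) (B : R) := rbound (fun i => cabs (x i)) B.

Lemma partial_sumE I (V : zmodType) (x : I -> V) (J : {fset I}) :
  partial_sum x J = \sum_(i <- J) x i.
Proof. by rewrite /partial_sum big_seq_fsetE. Qed.

Lemma has_sumP I (x : I -> R[i]) (s : R[i]) :
  has_sum x s <->
  forall e : R, 0 < e -> exists J0 : {fset I}, forall J : {fset I},
    (J0 `<=` J)%fset -> cabs (s - \sum_(i <- J) x i) <= e.
Proof.
split=> [h e e0|h].
  have [J0 _ hJ] := (cvg_cabsP (partial_sum x) s).1 h e e0.
  by exists J0 => J /hJ /=; rewrite partial_sumE.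
apply: (cvg_cabsP (partial_sum x) s).2 => e /h [J0 hJ].
by exists J0 => // J /hJ /=; rewrite partial_sumE.
Qed.

Lemma has_sum_sum I (x : I -> R[i]) s : has_sum x s -> sum x = s.
Proof. by move=> h; apply: cvg_lim h; exact: norm_hausdorff. Qed.

Lemma has_sum_unique I (x : I -> R[i]) s t : has_sum x s -> has_sum x t -> s = t.
Proof. by move=> /has_sum_sum <- /has_sum_sum <-. Qed.

Lemma eq_has_sum I (x y : I -> R[i]) s : x =1 y -> has_sum x s -> has_sum y s.
Proof. by move=> /funext ->. Qed.

Lemma eq_sum I (x y : I -> R[i]) : x =1 y -> sum x = sum y.
Proof. by move=> /funext ->. Qed.

Lemma rbound_ge0 I (x : I -> R) B : rbound x B -> 0 <= B.
Proof. by move/(_ fset0); rewrite big_seq_fset0. Qed.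

Lemma rbound_le I (x y : I -> R) B B' :
  (forall i, x i <= y i) -> B <= B' -> rbound y B -> rbound x B'.
Proof.
move=> xy BB h J; apply: le_trans BB; apply: le_trans (h J).
by apply: ler_sum.
Qed.

Lemma rboundZ I (x : I -> R) B c : 0 <= c ->
  rbound x B -> rbound (fun i => c * x i) (c * B).
Proof. by move=> c0 h J; rewrite -mulr_sumr ler_wpM2l. Qed.

Lemma rboundD I (x y : I -> R) B B' :
  rbound x B -> rbound y B' -> rbound (fun i => x i + y i) (B + B').
Proof. by move=> hx hy J; rewrite big_split /= lerD. Qed.

Lemma rbound_sum I (J : Type) (s : seq J) (x : J -> I -> R) (B : J -> R) :
  (forall j, rbound (x j) (B j)) ->
  rbound (fun i => \sum_(j <- s) x j i) (\sum_(j <- s) B j).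
Proof.
move=> h; elim: s => [|j s IH].
  by move=> L; rewrite big_nil big1// => i _; rewrite big_nil.
rewrite big_cons; apply: rbound_le (rboundD (h j) IH) => // i.
by rewrite big_cons.
Qed.

Lemma rbound0 I (x : I -> R) : (forall i, x i <= 0) -> rbound x 0.
Proof. by move=> h J; apply: sumr_le0. Qed.

Lemma sum_fsetD I (V : zmodType) (x : I -> V) (A B : {fset I}) : (A `<=` B)%fset ->
  \sum_(i <- B) x i = \sum_(i <- A) x i + \sum_(i <- (B `\` A)%fset) x i.
Proof.
move=> /fsubsetP AB; rewrite (big_fsetID _ (mem A)) /=; congr (_ + _).
  congr (\sum_(i <- enum_fset _) _); apply/fsetP => i; rewrite !inE/=.
  by apply/andP/idP => [[]//|iA]; split=> //; exact: AB.
congr (\sum_(i <- enum_fset _) _); apply/fsetP => i; rewrite !inE/=.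
by rewrite andbC.
Qed.

Lemma sum_fset_sub I (x : I -> R) (A B : {fset I}) : (forall i, 0 <= x i) ->
  (A `<=` B)%fset -> \sum_(i <- A) x i <= \sum_(i <- B) x i.
Proof. by move=> x0 AB; rewrite (sum_fsetD _ AB) lerDl sumr_ge0. Qed.

Lemma rbound_uniq I (x : I -> R) B (s : seq I) : rbound x B -> uniq s ->
  \sum_(i <- s) x i <= B.
Proof.
move=> h us; pose A : {fset I} := [fset i in s]%fset.
apply: le_trans (h A); rewrite le_eqVlt (perm_big A) ?eqxx//.
by apply: uniq_perm => // i; rewrite /A !inE.
Qed.

Lemma rbound_inj I J (x : J -> R) B (f : I -> J) : injective f -> rbound x B ->
  rbound (fun i => x (f i)) B.
Proof.
move=> fi h A; have -> : \sum_(i <- A) x (f i) = \sum_(j <- map f A) x j.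
  by rewrite big_map.
by apply: rbound_uniq h _; rewrite map_inj_uniq// fset_uniq.
Qed.

Lemma rbound1 I (x : I -> R) B i : rbound x B -> x i <= B.
Proof. by move/(_ [fset i]%fset); rewrite big_seq_fset1. Qed.

Lemma real_has_sum I (x : I -> R) B : (forall i, 0 <= x i) -> rbound x B ->
  exists s : R, forall e, 0 < e -> exists J0 : {fset I}, forall J : {fset I},
    (J0 `<=` J)%fset -> `|s - \sum_(i <- J) x i| <= e.
Proof.
move=> x0 h; pose S := [set \sum_(i <- J) x i | J in [set: {fset I}]].
have hS : has_sup S.
  by split; [exists (\sum_(i <- fset0) x i), fset0|exists B => _ [J _ <-]].
exists (sup S) => e e0; have [_ [J0 _ <-] hJ0] := sup_adherent e0 hS.
exists J0 => J J0J.
have : \sum_(i <- J) x i <= sup S by apply: ub_le_sup; [exact: hS.2|exists J].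
have := sum_fset_sub x0 J0J.
by move=> h1 h2; rewrite ger0_norm; lra.
Qed.

(** x = (|x| + x) - |x| is a difference of summable nonnegative families, and such a family
    converges to the supremum of its finite sums. *)
Lemma real_abs_has_sum I (x : I -> R) B : rbound (fun i => `|x i|) B ->
  exists s : R, forall e, 0 < e -> exists J0 : {fset I}, forall J : {fset I},
    (J0 `<=` J)%fset -> `|s - \sum_(i <- J) x i| <= e.
Proof.
move=> h.
have p0 i : 0 <= `|x i| + x i by have := ler_norm (- x i); rewrite normrN; lra.
have q0 i : 0 <= `|x i| by [].
have pB : rbound (fun i => `|x i| + x i) (B + B).
  apply: rbound_le (rboundD h h) => // i.
  by rewrite lerD2l ler_norm.
have [s hs] := real_has_sum p0 pB; have [t ht] := real_has_sum q0 h.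
exists (s - t) => e e0; have e2 : 0 < e / 2 by lra.
have [A hA] := hs _ e2; have [A' hA'] := ht _ e2.
exists (A `|` A')%fset => J; rewrite fsubUset => /andP[/hA + /hA'].
rewrite big_split/=; set a := \sum_(i <- J) `|x i|; set b := \sum_(i <- J) x i.
move=> h1 h2; have -> : s - t - b = (s - (a + b)) - (t - a) by ring.
by have := ler_normB (s - (a + b)) (t - a); lra.
Qed.

Lemma absum_ex I (x : I -> R[i]) B : absum x B -> exists s, has_sum x s.
Proof.
move=> h.
have [|s hs] := @real_abs_has_sum I (fun i => complex.Re (x i)) B.
  by apply: rbound_le h => // i; exact: cabs_Re.
have [|t ht] := @real_abs_has_sum I (fun i => complex.Im (x i)) B.
  by apply: rbound_le h => // i; exact: cabs_Im.
exists (s +i* t); apply/has_sumP => e e0; have e2 : 0 < e / 2 by lra.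
have [A hA] := hs _ e2; have [A' hA'] := ht _ e2.
exists (A `|` A')%fset => J; rewrite fsubUset => /andP[/hA h1 /hA' h2].
apply: le_trans (cabs_ReIm _) _.
have -> : \sum_(i <- J) x i =
    (\sum_(i <- J) complex.Re (x i)) +i* (\sum_(i <- J) complex.Im (x i)).
  elim: (enum_fset J) => [|i r IH]; rewrite ?big_nil// !big_cons IH.
  by case: (x i).
by rewrite /=; lra.
Qed.

Lemma absum_has_sum I (x : I -> R[i]) B : absum x B -> has_sum x (sum x).
Proof. by move=> /absum_ex[s hs]; rewrite (has_sum_sum hs). Qed.

Lemma le_eps (a b : R) : (forall e, 0 < e -> a <= b + e) -> a <= b.
Proof. by move=> h; apply/ler_addgt0Pr => e /h. Qed.

Lemma has_sum_le I (x : I -> R[i]) B s : absum x B -> has_sum x s -> cabs s <= B.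
Proof.
move=> h /has_sumP hs; apply: le_eps => e e0.
have [J hJ] := hs _ e0; have {hJ} := hJ J (fsubset_refl J).
set t := \sum_(i <- J) x i => ht.
have : cabs t <= B by apply: le_trans (cabs_sum _ _ _) _; exact: h.
have := cabsD (s - t) t; rewrite subrK; lra.
Qed.

Lemma sum_le I (x : I -> R[i]) B : absum x B -> cabs (sum x) <= B.
Proof. by move=> h; apply: has_sum_le (h) (absum_has_sum h). Qed.

Lemma has_sumD I (x y : I -> R[i]) s t : has_sum x s -> has_sum y t ->
  has_sum (fun i => x i + y i) (s + t).
Proof.
move=> /has_sumP hs /has_sumP ht; apply/has_sumP => e e0.
have e2 : 0 < e / 2 by lra.
have [A hA] := hs _ e2; have [A' hA'] := ht _ e2.
exists (A `|` A')%fset => J; rewrite fsubUset => /andP[/hA + /hA'].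
rewrite big_split/= => h1 h2; rewrite opprD addrACA.
by apply: le_trans (cabsD _ _) _; lra.
Qed.

Lemma has_sumZ I (x : I -> R[i]) s c : has_sum x s ->
  has_sum (fun i => c * x i) (c * s).
Proof.
move=> /has_sumP hs; apply/has_sumP => e e0.
have c0 := cabs_ge0 c.
have [|A hA] := hs (e / (cabs c + 1)); first by apply: divr_gt0 => //; lra.
exists A => J /hA h; rewrite -mulr_sumr -mulrBr cabsM.
apply: le_trans (ler_wpM2l c0 h) _.
by rewrite mulrA ler_pdivrMr; [nra|lra].
Qed.

Lemma has_sumN I (x : I -> R[i]) s : has_sum x s -> has_sum (fun i => - x i) (- s).
Proof.
by move=> /(has_sumZ (c := -1)); rewrite mulN1r; apply: eq_has_sum => i; rewrite mulN1r.
Qed.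

Lemma has_sumB I (x y : I -> R[i]) s t : has_sum x s -> has_sum y t ->
  has_sum (fun i => x i - y i) (s - t).
Proof. by move=> hx /has_sumN; exact: has_sumD. Qed.

Lemma has_sum_big I (J : Type) (r : seq J) (x : J -> I -> R[i]) (s : J -> R[i]) :
  (forall j, has_sum (x j) (s j)) ->
  has_sum (fun i => \sum_(j <- r) x j i) (\sum_(j <- r) s j).
Proof.
move=> h; elim: r => [|j r IH].
  rewrite big_nil; apply/has_sumP => e e0; exists fset0 => L _.
  by rewrite big1 ?subrr ?cabs0 ?ltW// => i _; rewrite big_nil.
rewrite big_cons; apply: eq_has_sum (has_sumD (h j) IH) => i.
by rewrite big_cons.
Qed.

Lemma has_sum_fin I (x : I -> R[i]) (A : {fset I}) :
  (forall i, i \notin A -> x i = 0) -> has_sum x (\sum_(i <- A) x i).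
Proof.
move=> h; apply/has_sumP => e e0; exists A => J AJ.
rewrite (sum_fsetD _ AJ) opprD addrA subrr sub0r cabsN.
rewrite big_seq big1 ?cabs0 ?ltW// => i; rewrite in_fsetD => /andP[/h ->].
by [].
Qed.

Lemma has_sum_fset1 I (x : I -> R[i]) (i0 : I) :
  (forall i, i != i0 -> x i = 0) -> has_sum x (x i0).
Proof.
move=> h; have := @has_sum_fin I x [fset i0]%fset.
rewrite big_seq_fset1; apply => i; rewrite in_fset1; exact: h.
Qed.

Lemma has_sum_conj I (x : I -> R[i]) s : has_sum x s ->
  has_sum (fun i => (x i)^*) s^*.
Proof.
move=> /has_sumP h; apply/has_sumP => e /h [A hA]; exists A => J /hA.
by rewrite -rmorph_sum -rmorphB cabs_conj.
Qed.

Lemma has_sum_reindex I J (x : J -> R[i]) s (f : I -> J) (g : J -> I) :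
  cancel f g -> cancel g f -> has_sum x s -> has_sum (fun i => x (f i)) s.
Proof.
move=> fK gK /has_sumP h; apply/has_sumP => e /h [A hA].
exists (g @` A)%fset => B AB.
have -> : \sum_(i <- B) x (f i) = \sum_(j <- (f @` B)%fset) x j.
  rewrite -(big_map f xpredT x); apply: perm_big; apply: uniq_perm.
  - by rewrite map_inj_uniq ?fset_uniq//; exact: can_inj fK.
  - exact: fset_uniq.
  - move=> j; apply/mapP/imfsetP => -[i /= iB ->]; by exists i.
apply: hA; apply/fsubsetP => j jA; apply/imfsetP; exists (g j) => //=.
by apply: (fsubsetP AB); apply/imfsetP; exists j.
Qed.

(** Tonelli on finite sets: a finite set of pairs lies in the rectangle spanned by its projections,
    and the rectangle is summed by rows. *)
Lemma rbound_pair I J (x : I * J -> R) (N : I -> R) B : (forall ij, 0 <= x ij) ->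
  (forall i, rbound (fun j => x (i, j)) (N i)) -> rbound N B -> rbound x B.
Proof.
move=> x0 hx hN A; pose A1 := [fset ij.1 | ij in A]%fset.
pose A2 := [fset ij.2 | ij in A]%fset.
pose S := [seq (i, j) | i <- A1, j <- A2].
have sub : (A `<=` [fset ij in S])%fset.
  apply/fsubsetP => -[i j] ijA; rewrite in_fset; apply: allpairs_f.
    by apply/imfsetP; exists (i, j).
  by apply/imfsetP; exists (i, j).
apply: le_trans (sum_fset_sub x0 sub) _.
have uS : uniq S by rewrite allpairs_uniq ?fset_uniq// => -[? ?] [? ?] _ _ [-> ->].
rewrite (perm_big S)/=; last first.
  by apply: uniq_perm; rewrite ?fset_uniq// => z; rewrite in_fset.
rewrite big_allpairs; apply: le_trans (hN A1).
by apply: ler_sum => i _; exact: hx.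
Qed.

End UnconditionalSums.

Section DoubleSums.
Context {R : realType}.
Implicit Types I J : choiceType.

Lemma fset_rect I J (A : {fset I}) (A' : {fset J}) : exists K : {fset I * J},
  (forall ij, (ij \in K) = (ij.1 \in A) && (ij.2 \in A')) /\
  forall (V : nmodType) (x : I * J -> V),
    \sum_(ij <- K) x ij = \sum_(i <- A) \sum_(j <- A') x (i, j).
Proof.
pose S := [seq (i, j) | i <- A, j <- A'].
have inS ij : (ij \in S) = (ij.1 \in A) && (ij.2 \in A').
  apply/allpairsP/andP => [[[i j] [/= hi hj ->]]//|[hi hj]].
  by exists ij; split => //; case: ij hi hj.
pose K : {fset I * J} := [fset ij in S]%fset; exists K; split.
  by move=> ij; rewrite /K !inE.
move=> V x; rewrite -(big_allpairs (F := fun ij => x ij))/=; apply: perm_big.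
apply: uniq_perm; first exact: fset_uniq.
  by rewrite allpairs_uniq ?fset_uniq// => -[? ?] [? ?] _ _ [-> ->].
by move=> ij; rewrite /K !inE.
Qed.

Lemma absum_row I J (x : I * J -> R[i]) B i :
  absum x B -> absum (fun j => x (i, j)) B.
Proof.
by apply: (rbound_inj (x := fun ij => cabs (x ij)) (f := fun j => (i, j))) => ? ? [].
Qed.

(** One finite set of columns serves finitely many rows simultaneously; Fubini rests on this
    uniformity. *)
Lemma rows_approx I J (x : I * J -> R[i]) B (r : seq I) : absum x B ->
  forall e, 0 < e -> exists J0 : {fset J}, forall A : {fset J}, (J0 `<=` A)%fset ->
    \sum_(i <- r) cabs (sum (fun j => x (i, j)) - \sum_(j <- A) x (i, j)) <= e.
Proof.
move=> hx; elim: r => [|i r IH] e e0.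
  by exists fset0 => A _; rewrite big_nil ltW.
have e2 : 0 < e / 2 by lra.
have [J1 h1] := IH _ e2.
have /has_sumP/(_ _ e2)[J2 h2] := absum_has_sum (absum_row i hx).
exists (J1 `|` J2)%fset => A; rewrite fsubUset => /andP[/h1 a1 /h2 a2].
by rewrite big_cons; lra.
Qed.

Lemma absum_rows I J (x : I * J -> R[i]) B : absum x B ->
  absum (fun i => sum (fun j => x (i, j))) B.
Proof.
move=> hx A; apply: le_eps => e e0; have [J0 h] := rows_approx A hx e0.
have {h} := h J0 (fsubset_refl _); set S := (X in X <= _ -> _) => hS.
have [K [_ hK]] := fset_rect A J0.
have := hx K; rewrite hK => hK'.
apply: le_trans (lerD hK' hS); rewrite /S -big_split/=; apply: ler_sum => i _.
set s := \sum_(j <- J0) x (i, j).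
have : cabs s <= \sum_(j <- J0) cabs (x (i, j)) by exact: cabs_sum.
have := cabsD s (sum (fun j => x (i, j)) - s).
by rewrite (addrC s) subrK; lra.
Qed.

Lemma has_sum_fubini I J (x : I * J -> R[i]) B : absum x B ->
  has_sum (fun i => sum (fun j => x (i, j))) (sum x).
Proof.
move=> hx; apply/has_sumP => e e0; have e2 : 0 < e / 2 by lra.
have /has_sumP/(_ _ e2)[K hK] := absum_has_sum hx.
exists [fset ij.1 | ij in K]%fset => A KA.
have [J0 h] := rows_approx A hx e2.
(* Adding the second projections of [K] makes the rectangle A x J1 contain [K]; its sum is then
   close both to [sum x] and to the sum of the full rows. *)
pose J1 : {fset J} := (J0 `|` [fset ij.2 | ij in K])%fset.
have {}h := h J1 (fsubsetUl _ _).
have [K' [inK' sK']] := fset_rect A J1.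
have KK' : (K `<=` K')%fset.
  apply/fsubsetP => -[i j] ijK; rewrite inK' /=; apply/andP; split.
    by apply: (fsubsetP KA); apply/imfsetP; exists (i, j).
  by rewrite in_fsetU; apply/orP; right; apply/imfsetP; exists (i, j).
have := hK _ KK'; rewrite sK' => {}hK.
set T := \sum_(i <- A) \sum_(j <- J1) x (i, j) in hK *.
set U := \sum_(i <- A) _.
have : cabs (U - T) <= e / 2.
  apply: le_trans h; rewrite /U /T -sumrB; exact: cabs_sum.
have := cabsB (sum x - T) (U - T).
by rewrite opprB addrA subrK; lra.
Qed.

Lemma absum_swap I J (x : I * J -> R[i]) B : absum x B ->
  absum (fun ji : J * I => x (ji.2, ji.1)) B.
Proof. by apply: (rbound_inj (x := fun ij => cabs (x ij))) => -[? ?] [? ?] [-> ->]. Qed.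

Lemma has_sum_fubini_swap I J (x : I * J -> R[i]) B : absum x B ->
  has_sum (fun j => sum (fun i => x (i, j))) (sum x).
Proof.
move=> hx.
have -> : sum x = sum (fun ji : J * I => x (ji.2, ji.1)).
  apply/esym/has_sum_sum.
  apply: (has_sum_reindex (f := fun ji : J * I => (ji.2, ji.1))
    (g := fun ij => (ij.2, ij.1))) (absum_has_sum hx); by case.
exact: has_sum_fubini (absum_swap hx).
Qed.

Lemma absum_prod I J (x : I -> R[i]) (y : J -> R[i]) B B' :
  absum x B -> absum y B' -> absum (fun ij => x ij.1 * y ij.2) (B * B').
Proof.
move=> hx hy.
apply: (@rbound_pair _ _ _ _ (fun i => cabs (x i) * B')) => [ij|i|].
- exact: cabs_ge0.
- apply: rbound_le (rboundZ (cabs_ge0 (x i)) hy) => // j.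
  by rewrite cabsM.
- rewrite mulrC; apply: rbound_le (rboundZ (rbound_ge0 hy) hx) => // i.
  by rewrite mulrC.
Qed.

Lemma sum_prod I J (x : I -> R[i]) (y : J -> R[i]) B B' :
  absum x B -> absum y B' ->
  sum (fun ij : I * J => x ij.1 * y ij.2) = sum x * sum y.
Proof.
move=> hx hy; apply: has_sum_unique (has_sum_fubini (absum_prod hx hy)) _.
rewrite mulrC; apply: eq_has_sum (has_sumZ (c := sum y) (absum_has_sum hx)) => i /=.
rewrite mulrC; apply/esym/has_sum_sum.
exact: has_sumZ (absum_has_sum hy).
Qed.

Lemma has_sum_series (x : nat -> R[i]) s : has_sum x s ->
  forall e, 0 < e -> exists N, forall n, (N <= n)%N ->
    cabs (s - \sum_(0 <= i < n) x i) <= e.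
Proof.
move=> /has_sumP h e /h [J hJ].
exists (\max_(i <- J) i.+1)%N => n hn.
pose A : {fset nat} := [fset i in index_iota 0 n]%fset.
have -> : \sum_(0 <= i < n) x i = \sum_(i <- A) x i.
  apply: perm_big; apply: uniq_perm; rewrite ?iota_uniq ?fset_uniq// => i.
  by rewrite /A !inE.
apply: hJ; apply/fsubsetP => i iJ; rewrite /A !inE mem_index_iota/=.
by apply: leq_trans hn; rewrite (big_fsetD1 i)//= leq_max leqnn.
Qed.

Lemma rbound_nat (x : nat -> R) B : (forall i, 0 <= x i) ->
  (forall n, \sum_(0 <= i < n) x i <= B) -> rbound x B.
Proof.
move=> x0 h J; pose n := (\max_(i <- J) i.+1)%N.
pose A : {fset nat} := [fset i in index_iota 0 n]%fset.
have AE : \sum_(0 <= i < n) x i = \sum_(i <- A) x i.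
  apply: perm_big; apply: uniq_perm; rewrite ?iota_uniq ?fset_uniq// => i.
  by rewrite /A !inE.
apply: le_trans (h n); rewrite AE; apply: sum_fset_sub => //.
apply/fsubsetP => i iJ; rewrite /A !inE mem_index_iota/=.
by rewrite /n (big_fsetD1 i)//= leq_max leqnn.
Qed.

Lemma cabs_small (x : R[i]) : (forall e, 0 < e -> cabs x <= e) -> x = 0.
Proof.
move=> h; apply: cabs_eq0; apply/eqP; rewrite eq_le cabs_ge0 andbT.
by apply: le_eps => e /h; rewrite add0r.
Qed.

Lemma has_sum_shift (x : nat -> R[i]) B s : absum x B -> has_sum x s ->
  has_sum (fun n => x n.+1) (s - x 0%N).
Proof.
move=> hx hs.
have hS : absum (fun n => x n.+1) B.
  by apply: (rbound_inj (x := fun n => cabs (x n))) => // ? ? [].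
have := absum_has_sum hS; set t := sum _ => ht.
suff -> : s - x 0%N = t by [].
apply/eqP; rewrite -subr_eq0; apply/eqP/cabs_small => e e0.
have e2 : 0 < e / 2 by lra.
have [N hN] := has_sum_series hs e2; have [N' hN'] := has_sum_series ht e2.
have {hN} := hN (maxn N N').+1; rewrite leqW ?leq_maxl// => /(_ isT).
have {hN'} := hN' (maxn N N'); rewrite leq_maxr => /(_ isT).
rewrite [X in s - X]big_nat_recl//; set u := \sum_(0 <= i < _) _ => h1 h2.
have -> : s - x 0%N - t = (s - (x 0%N + u)) - (t - u) by ring.
by apply: le_trans (cabsB _ _) _; lra.
Qed.

Lemma geometric_bound (q : R) : 0 <= q -> q < 1 ->
  rbound (fun n => q ^+ n) (1 - q)^-1.
Proof.
move=> q0 q1; apply: rbound_nat => [i|n]; first exact: exprn_ge0.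
have d0 : 0 < 1 - q by lra.
rewrite -[leRHS]mul1r ler_pdivlMr// mulrC.
suff -> : (1 - q) * \sum_(0 <= i < n) q ^+ i = 1 - q ^+ n.
  by have := exprn_ge0 n q0; lra.
elim: n => [|n IH]; first by rewrite big_geq// expr0; ring.
by rewrite big_nat_recr//= mulrDr IH exprS; ring.
Qed.

End DoubleSums.

(** * The complex exponential *)

Section ComplexExponential.
Context {R : realType}.
Implicit Types (z w : R[i]) (x y : R).

Lemma cexp0 : cexp (0 : R[i]) = 1.
Proof. by rewrite /cexp /= expR0 cos0 sin0 mul1r. Qed.

Lemma cexpD z w : cexp (z + w) = cexp z * cexp w.
Proof.
case: z w => a b [c d]; rewrite /cexp /= expRD cosD sinD.
rewrite rmorphM mulrACA; congr (_ * _).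
by apply/eqP; rewrite eq_complex /=; apply/andP; split; apply/eqP; ring.
Qed.

Lemma cexpN z : cexp z * cexp (- z) = 1.
Proof. by rewrite -cexpD subrr cexp0. Qed.

Lemma cabs_cexp z : cabs (cexp z) = expR (complex.Re z).
Proof.
rewrite /cexp cabsM cabs_nneg ?expR_ge0//.
rewrite -[RHS]mulr1; congr (_ * _).
by rewrite /cabs normc_def /= cos2Dsin2 sqrtr1.
Qed.

Lemma cexp_conj z : (cexp z)^* = cexp z^*.
Proof.
case: z => a b; rewrite /cexp /= cosN sinN.
by apply/eqP; rewrite eq_complex /=; apply/andP; split; apply/eqP; ring.
Qed.

Lemma cexp_polar x y : cexp (x +i* y) = (expR x)%:C * cexp ('i * y%:C) :> R[i].
Proof.
rewrite {1}/cexp /= /cexp /=.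
by rewrite !(mul0r, mulr0, mul1r, add0r, addr0, subr0) oppr0 expR0 mul1r.
Qed.

Lemma cabs_cis y : cabs (cexp ('i * y%:C)) = 1.
Proof. by rewrite cabs_cexp -[RHS]expR0; congr expR => /=; ring. Qed.

Lemma cexp_2pi_nat (k : nat) : cexp ('i * (pi *+ 2 * k%:R)%:C) = 1 :> R[i].
Proof.
elim: k => [|k IH]; first by rewrite mulr0 mulr0 cexp0.
rewrite -natr1 mulrDr mulr1 rmorphD mulrDr cexpD IH mul1r.
by rewrite /cexp /= !(mul0r, mulr0, mul1r, add0r, addr0, subr0, oppr0) expR0 cos2pi sin2pi mul1r.
Qed.

Lemma cexp_2pi (k : int) : cexp ('i * (pi *+ 2 * k%:~R)%:C) = 1 :> R[i].
Proof.
case: (intP k) => [|n|n]; first by rewrite mulr0 mulr0 cexp0.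
  exact: cexp_2pi_nat.
rewrite -[LHS]mul1r -[in LHS](cexp_2pi_nat n.+1) mulrNz mulrN rmorphN mulrN.
exact: cexpN.
Qed.

Lemma series_cvg (x : nat -> R[i]) s : has_sum x s ->
  (fun n => \sum_(0 <= i < n) x i) @ \oo --> s.
Proof.
move=> /has_sum_series h; apply/cvg_cabsP => e /h[N hN].
by exists N => // n /= /hN.
Qed.

Lemma cvg_complex (u v : nat -> R) a b : u @ \oo --> a -> v @ \oo --> b ->
  (fun n => u n +i* v n) @ \oo --> (a +i* b).
Proof.
move=> /cvgrPdist_le ua /cvgrPdist_le vb; apply/cvg_cabsP => e e0.
have e2 : 0 < e / 2 by lra.
near=> n; apply: le_trans (cabs_ReIm _) _ => /=.
have h1 : `|a - u n| <= e / 2 by near: n; exact: ua.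
have h2 : `|b - v n| <= e / 2 by near: n; exact: vb.
lra.
Unshelve. all: by end_near. Qed.

Lemma series_unique (x : nat -> R[i]) (s t : R[i]) : has_sum x s ->
  (fun n => \sum_(0 <= i < n) x i) @ \oo --> t -> s = t.
Proof. by move=> /series_cvg; apply: cvg_unique; exact: norm_hausdorff. Qed.

Lemma exp_series_bound x : 0 <= x -> rbound (fun n => x ^+ n / n`!%:R) (expR x).
Proof.
move=> x0; apply: rbound_nat => [i|n]; first by rewrite divr_ge0 ?exprn_ge0.
apply: (nondecreasing_cvgn_le _ (is_cvg_series_exp_coeff x) n).
apply/nondecreasing_seqP => k; rewrite /series /= big_nat_recr//= lerDl.
by rewrite /exp_coeff /= divr_ge0 ?exprn_ge0.
Qed.

(** [cexp] is defined through [expR], [cos] and [sin]. Its power series is recovered by showing that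
    the sum of the series is multiplicative and has the right values on the real and imaginary
    axes. *)
Let F z : R[i] := sum (fun n => z ^+ n / n`!%:R).

Lemma absum_exp z : absum (fun n => z ^+ n / n`!%:R) (expR (cabs z)).
Proof.
apply: rbound_le (exp_series_bound (cabs_ge0 z)) => // n.
by rewrite cabsM cabsX cabsV cabs_nat.
Qed.

Let has_F z : has_sum (fun n => z ^+ n / n`!%:R) (F z).
Proof. exact: absum_has_sum (absum_exp z). Qed.

Let FD z w : F (z + w) = F z * F w.
Proof.
have hz := absum_exp z; have hw := absum_exp w.
have hp := absum_prod hz hw.
rewrite -[F z * F w](sum_prod hz hw).
set x := fun ij : nat * nat => _ in hp *.
(* Cauchy product: the term (i, j) is placed in row n = i + j, and the resulting family is summed in
   both orders, over n first and over (i, j) first. *)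
pose X (nij : nat * (nat * nat)) :=
  if nij.1 == (nij.2.1 + nij.2.2)%N then x nij.2 else 0.
have hX : absum (fun k : (nat * nat) * nat => X (k.2, k.1)) (expR (cabs z) * expR (cabs w)).
  apply: (@rbound_pair _ _ _ _ (fun ij => cabs (x ij))) => [k|ij|].
  - exact: cabs_ge0.
  - have -> : cabs (x ij) = \sum_(k <- [fset (ij.1 + ij.2)%N]%fset) cabs (X (k, ij)).
      by rewrite big_seq_fset1 /X /= eqxx.
    move=> A; have := has_sum_fin (x := fun k => X (k, ij)).
    case: (boolP ((ij.1 + ij.2)%N \in A)) => hA.
      rewrite big_seq_fset1 (big_fsetD1 _ hA)/= big_seq big1 ?addr0// => k.
      by rewrite in_fsetD1 /X /= => /andP[/negbTE -> _]; rewrite cabs0.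
    rewrite [X in X <= _]big_seq big1 => [|k kA]; first by rewrite sumr_ge0 // => ? _; exact: cabs_ge0.
    by rewrite /X /=; case: eqP => [kE|]; rewrite ?cabs0//; rewrite kE (negbTE hA) in kA.
  - exact: hp.
have h1 := has_sum_fubini hX; have h2 := has_sum_fubini_swap hX.
have -> : sum x = sum (fun k : (nat * nat) * nat => X (k.2, k.1)).
  apply: has_sum_unique (absum_has_sum hp) _.
  apply: eq_has_sum h1 => ij /=; apply: has_sum_sum.
  have -> : x ij = X ((ij.1 + ij.2)%N, ij) by rewrite /X /= eqxx.
  apply: (has_sum_fset1 (x := fun n => X (n, ij))) => k kn.
  by rewrite /X /= (negbTE kn).
apply: (has_sum_unique (@has_F (z + w))); apply: eq_has_sum h2 => n /=.
apply: has_sum_sum.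
pose A : {fset nat * nat} := [fset ij in [seq (n - k, k)%N | k <- iota 0 n.+1]]%fset.
have -> : (z + w) ^+ n / n`!%:R = \sum_(ij <- A) X (n, ij).
  rewrite (perm_big [seq (n - k, k)%N | k <- iota 0 n.+1]); last first.
    apply: uniq_perm; first exact: fset_uniq.
      by rewrite map_inj_uniq ?iota_uniq// => ? ? [].
    by move=> ij; rewrite /A !inE.
  rewrite big_map -[iota 0 n.+1]/(index_iota 0 n.+1) big_mkord exprDn mulr_suml.
  apply: eq_bigr => k _; rewrite /X /= subnK; last by rewrite -ltnS.
  rewrite eqxx /x /= -mulr_natl.
  have kn : (k <= n)%N by rewrite -ltnS.
  have /(congr1 (fun m => m%:R : R[i])) := bin_fact kn.
  rewrite !natrM => fE; rewrite -fE.
  have nz m : m`!%:R != 0 :> R[i] by rewrite pnatr_eq0 -lt0n fact_gt0.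
  have bz : 'C(n, k)%:R != 0 :> R[i] by rewrite pnatr_eq0 -lt0n bin_gt0.
  by field; rewrite !nz bz.
apply: has_sum_fin => -[i j] /negP ijA; rewrite /X [_.1]/= [_.2]/=.
case: eqP => //= nE; case: ijA; rewrite /A in_fset; apply/mapP; exists j.
  by rewrite mem_iota add0n ltnS nE leq_addl.
by rewrite nE addnK.
Qed.

Let F_real x : F x%:C = (expR x)%:C.
Proof.
apply: (series_unique (@has_F _)).
have -> : (fun n => \sum_(0 <= i < n) x%:C ^+ i / i`!%:R) =
    (fun n => series (exp_coeff x) n +i* (fun=> 0) n).
  apply/funext => n; rewrite /series /= complexr0 rmorph_sum; apply: eq_bigr => i _.
  by rewrite rmorphM rmorphXn fmorphV rmorph_nat.
by apply: cvg_complex; [exact: is_cvg_series_exp_coeff|exact: cvg_cst].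
Qed.

Let F_imag y : F ('i * y%:C) = cos y +i* sin y.
Proof.
apply: (series_unique (@has_F _)).
have -> : (fun n => \sum_(0 <= i < n) ('i * y%:C) ^+ i / i`!%:R) =
    (fun n => series (cos_coeff y) n +i* series (sin_coeff y) n).
  apply/funext => n; rewrite /series /=.
  elim: n => [|n IH]; first by rewrite !big_geq.
  rewrite !big_nat_recr//= IH.
  have addcE (a b c d : R) : (a + b) +i* (c + d) = (a +i* c) + (b +i* d) by [].
  rewrite addcE; congr (_ + _); rewrite /cos_coeff /sin_coeff /= exprMn.
  have iE : ('i : R[i]) ^+ n = ((~~ odd n)%:R * (-1) ^+ n./2) +i*
     ((odd n)%:R * (-1) ^+ n.-1./2).
    rewrite -{1}(odd_double_half n); case: (boolP (odd n)) => on.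
      rewrite exprD expr1 -muln2 mulnC exprM sqr_i mul0r mul1r.
      have -> : n.-1./2 = n./2.
        by rewrite -{1}(odd_double_half n) on /= doubleK.
      rewrite -(rmorphN1 (real_complex R)) -rmorphXn.
      by apply/eqP; rewrite eq_complex /=; apply/andP; split; apply/eqP; ring.
    rewrite add0n -muln2 mulnC exprM sqr_i mul0r mul1r.
    by rewrite complexr0 rmorphXn rmorphN1.
  rewrite iE -(rmorphXn (real_complex R)) -(rmorph_nat (real_complex R)) -fmorphV.
  rewrite -exprnP.
  by apply/eqP; rewrite eq_complex /=; apply/andP; split; apply/eqP; ring.
by apply: cvg_complex; rewrite ?unlock; [exact: is_cvg_series_cos_coeff|exact: is_cvg_series_sin_coeff].
Qed.

Lemma cexp_series z : has_sum (fun n => z ^+ n / n`!%:R) (cexp z).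
Proof.
have -> : cexp z = F z by rewrite {2}(complexE z) FD F_real F_imag.
exact: (@has_F z).
Qed.

Lemma cexp_series1 z : has_sum (fun n => z ^+ n.+1 / n.+1`!%:R) (cexp z - 1).
Proof.
have := has_sum_shift (absum_exp z) (@cexp_series z).
by rewrite expr0 divr1.
Qed.

Lemma exp_series_bound1 x : 0 <= x ->
  rbound (fun n => x ^+ n.+1 / n.+1`!%:R) (expR x - 1).
Proof.
move=> x0; apply: rbound_nat => [i|n]; first by rewrite divr_ge0 ?exprn_ge0.
have := rbound_uniq (exp_series_bound x0) (iota_uniq 0 n.+1).
rewrite -[iota 0 n.+1]/(index_iota 0 n.+1) big_nat_recl//= expr0 fact0 divr1.
by lra.
Qed.

Lemma cexp_sub1 z : cabs (cexp z - 1) <= expR (cabs z) - 1.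
Proof.
apply: has_sum_le (@cexp_series1 z).
apply: rbound_le (exp_series_bound1 (cabs_ge0 z)) => // n.
by rewrite cabsM cabsX cabsV cabs_nat.
Qed.

Lemma cexp_sub2 z : cabs (cexp z - 1 - z) <= expR (cabs z) - 1 - cabs z.
Proof.
have h1 : absum (fun n => z ^+ n.+1 / n.+1`!%:R) (expR (cabs z) - 1).
  apply: rbound_le (exp_series_bound1 (cabs_ge0 z)) => // n.
  by rewrite cabsM cabsX cabsV cabs_nat.
have := has_sum_shift h1 (@cexp_series1 z).
rewrite expr1 divr1; apply: has_sum_le.
apply: rbound_nat => [n|n]; first exact: cabs_ge0.
have := rbound_uniq (exp_series_bound1 (cabs_ge0 z)) (iota_uniq 0 n.+1).
rewrite -[iota 0 n.+1]/(index_iota 0 n.+1) big_nat_recl//= expr1 divr1.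
under [X in _ -> X <= _]eq_bigr do rewrite cabsM cabsX cabsV cabs_nat.
by lra.
Qed.

(** The tangent inequality 1 - x <= exp(-x) multiplied by exp x; the next lemma multiplies by 1 + x
    as well. *)
Lemma expR_sub1_le x : 0 <= x -> expR x - 1 <= x * expR x.
Proof.
move=> x0; have h := expR_ge1Dx (- x).
have e0 := expR_gt0 x; have : expR x * expR (- x) = 1 by rewrite -expRD subrr expR0.
by nra.
Qed.

Lemma expR_sub2_le x : 0 <= x -> expR x - 1 - x <= x ^+ 2 * expR x.
Proof.
move=> x0; have h := expR_ge1Dx (- x).
have e0 := expR_gt0 x; have : expR x * expR (- x) = 1 by rewrite -expRD subrr expR0.
move=> e1; have : (1 + x) * (1 + - x) <= (1 + x) * expR (- x) by apply: ler_wpM2l => //; lra.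
by nra.
Qed.

(** The 4 bounds e: exp(-1/2) >= 1/2 gives exp(1/2) <= 2. For |y| > 1 the trivial bound 2 is
    enough. *)
Lemma cabs_cis_sub1 y : cabs (cexp ('i * y%:C) - 1) <= 4 * `|y|.
Proof.
have yE : cabs ('i * y%:C) = `|y| by rewrite cabsM cabs_i mul1r cabs_real.
have y0 := normr_ge0 y.
have [y1|y1] := leP `|y| 1; last first.
  apply: le_trans (cabsB _ _) _; rewrite cabs_cexp cabs1.
  have -> : complex.Re ('i * y%:C) = 0 :> R by rewrite /=; ring.
  by rewrite expR0; lra.
apply: le_trans (cexp_sub1 _) _; rewrite yE.
apply: le_trans (expR_sub1_le y0) _; rewrite mulrC ler_wpM2r//.
apply: le_trans (_ : expR 1 <= 4); first by rewrite ler_expR.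
have h2 : expR 1 = expR (1 / 2) * expR (1 / 2) :> R by rewrite -expRD; congr expR; lra.
have h3 : expR (1 / 2) * expR (- (1 / 2)) = 1 :> R by rewrite -expRD subrr expR0.
have := expR_ge1Dx (- (1 / 2) : R); have := expR_gt0 (1 / 2 : R); rewrite h2; nra.
Qed.

Lemma expR_lip x y M : x <= M -> y <= M -> `|expR x - expR y| <= `|x - y| * expR M.
Proof.
wlog xy : x y / y <= x.
  move=> hw hx hy; have [yx|/ltW xy] := leP y x; [exact: hw|move: (hw _ _ xy hy hx)].
  by rewrite distrC (distrC y).
move=> hx hy; rewrite !ger0_norm ?subr_ge0 ?ler_expR//.
have h : expR x - expR y <= (x - y) * expR x.
  have := expR_sub1_le (_ : 0 <= x - y); rewrite subr_ge0 => /(_ xy).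
  have -> : expR x = expR y * expR (x - y) by rewrite -expRD addrC subrK.
  have e0 := expR_gt0 y => h; nra.
by apply: le_trans h _; rewrite ler_wpM2l ?subr_ge0// ler_expR.
Qed.

(** Modulus and phase are compared separately; the modulus contributes 1 and the phase 4 to the
    constant 5. *)
Lemma cexp_lip z w M : complex.Re z <= M -> complex.Re w <= M ->
  cabs (cexp z - cexp w) <= 5 * cabs (z - w) * expR M.
Proof.
case: z w => a b [c d] /= ha hc.
have -> : cexp (a +i* b) - cexp (c +i* d) =
   (expR a - expR c)%:C * cexp ('i * b%:C)
   + (expR c)%:C * cexp ('i * d%:C) * (cexp ('i * (b - d)%:C) - 1).
  have hb : cexp ('i * b%:C) = cexp ('i * d%:C) * cexp ('i * (b - d)%:C).
    by rewrite -cexpD -mulrDr -rmorphD; congr (cexp ('i * _%:C)); ring.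
  by rewrite (cexp_polar a b) (cexp_polar c d) hb rmorphB; ring.
apply: le_trans (cabsD _ _) _.
rewrite (cabsM _ (cexp _)) cabs_cis mulr1 (cabsM _ (_ - 1)) (cabsM _ (cexp _)).
rewrite cabs_cis mulr1 !cabs_real.
rewrite (ger0_norm (expR_ge0 c)).
have h1 := expR_lip ha hc; have h2 := cabs_cis_sub1 (b - d).
have h3 := cabs_Re ((a +i* b) - (c +i* d)).
have h4 := cabs_Im ((a +i* b) - (c +i* d)); rewrite /= in h3 h4.
set D := cabs _ in h3 h4 *; have eM := expR_gt0 M; have ec := expR_gt0 c.
have ecM : expR c <= expR M by rewrite ler_expR.
have h5 : expR c * cabs (cexp ('i * (b - d)%:C) - 1) <= expR M * (4 * `|b - d|).
  by apply: ler_pM => //; exact: cabs_ge0.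
by nra.
Qed.

End ComplexExponential.

Definition mindex (n : nat) := ({ffun 'I_n -> nat} * {ffun 'I_n -> int})%type.

(** A bound for the modulus of the monomial [m] on [dom a b] (see [cabs_mono]): [a] is the action
    radius and [b] the half-width of the strip. *)
HB.lock Definition wt (R : realType) (n : nat) (a b : R) (m : mindex n) : R :=
  a ^+ mlen m.1 * expR ((klen m.2)%:R * b).
Canonical wt_unlockable := Unlockable wt.unlock.

HB.lock Definition mono (R : realType) (n : nat) (m : mindex n)
    (z : 'rV[R[i]]_(n + n)) : R[i] :=
  (\prod_j act z j ^+ m.1 j) * cexp ('i * \sum_j (m.2 j)%:~R * ang z j).
Canonical mono_unlockable := Unlockable mono.unlock.

Arguments wt {R n} a b m.
Arguments mono {R n} m z.

(** * Weighted Fourier-Taylor series *)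

Section WeightedFourierTaylor.
Context {R : realType} {n : nat}.
Notation point := 'rV[R[i]]_(n + n).
Implicit Types (a b : R) (z : point) (F G : point -> R[i]) (N : R -> R).

Implicit Types (m : mindex n) (c d : mindex n -> R[i]).

Definition madd m m' : mindex n := (m.1 + m'.1, m.2 + m'.2).


Definition ev c z : R[i] := sum (fun m => c m * mono m z).

(** The weighted norm for series of all degrees in the actions together, whereas [ft_norm] treats
    one degree at a time. *)
Definition bnd a b c (B : R) := rbound (fun m => cabs (c m) * wt a b m) B.

Lemma ft_evalE (g : ft_coef R n) z : ft_eval g z = ev (fun m => g m.1 m.2) z.
Proof. by apply: eq_sum => m; rewrite mono.unlock mulrA. Qed.

Lemma wt_ge0 a b m : 0 <= a -> 0 <= wt a b m.
Proof. by move=> a0; rewrite wt.unlock mulr_ge0 ?exprn_ge0 ?expR_ge0. Qed.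

Lemma wt_gt0 a b m : 0 < a -> 0 < wt a b m.
Proof. by move=> a0; rewrite wt.unlock mulr_gt0 ?exprn_gt0 ?expR_gt0. Qed.

Lemma wt_le a b a' b' m : 0 <= a -> a <= a' -> b <= b' -> wt a b m <= wt a' b' m.
Proof.
move=> a0 aa bb; rewrite wt.unlock; apply: ler_pM; rewrite ?exprn_ge0 ?expR_ge0//.
  by rewrite lerXn2r ?nnegrE// (le_trans a0).
by rewrite ler_expR ler_wpM2l.
Qed.

Lemma mlenD (i i' : {ffun 'I_n -> nat}) : mlen (i + i') = (mlen i + mlen i')%N.
Proof. by rewrite /mlen -big_split; apply: eq_bigr => j _; rewrite ffunE. Qed.

Lemma klenD (k k' : {ffun 'I_n -> int}) : (klen (k + k')%R <= klen k + klen k')%N.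
Proof.
rewrite /klen -big_split; apply: leq_sum => j _; rewrite ffunE.
by rewrite -lez_nat PoszD !abszE ler_normD.
Qed.

(** Degrees add and |k| is subadditive; hence the weighted norm is submultiplicative. *)
Lemma wtD a b m m' : 0 <= a -> 0 <= b ->
  wt a b (madd m m') <= wt a b m * wt a b m'.
Proof.
move=> a0 b0; rewrite wt.unlock /= mlenD exprD mulrACA ler_wpM2l ?mulr_ge0 ?exprn_ge0//.
by rewrite -expRD ler_expR -mulrDl ler_wpM2r// -natrD ler_nat klenD.
Qed.

Lemma monoD m m' z : mono (madd m m') z = mono m z * mono m' z.
Proof.
rewrite mono.unlock /= mulrACA -big_split /= -cexpD -mulrDr -big_split /=.
congr (_ * cexp ('i * _)).
  by apply: eq_bigr => j _; rewrite ffunE exprD.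
by apply: eq_bigr => j _; rewrite ffunE rmorphD mulrDl.
Qed.

Lemma dom_le a b a' b' z : a <= a' -> b <= b' -> dom a b z -> dom a' b' z.
Proof.
move=> aa bb [h1 h2]; split=> j; first by apply: lt_le_trans (h1 j) _; rewrite lecR.
exact: lt_le_trans (h2 j) bb.
Qed.

Lemma domP a b z : dom a b z <->
  (forall j, cabs (act z j) < a) /\ (forall j, `|complex.Im (ang z j)| < b).
Proof.
by split=> -[h1 h2]; split=> // j; have := h1 j; rewrite cabsE ltcR.
Qed.

Lemma cabs_mono a b m z : dom a b z -> cabs (mono m z) <= wt a b m.
Proof.
move=> /domP[h1 h2]; rewrite mono.unlock wt.unlock cabsM (cabs_prod _ _ (fun j => act z j ^+ m.1 j)).
apply: ler_pM; rewrite ?cabs_ge0//.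
- by apply: prodr_ge0 => j _; exact: cabs_ge0.
- rewrite /mlen expr_sum; apply: ler_prod => j _; rewrite cabs_ge0 cabsX.
  by rewrite lerXn2r ?nnegrE ?cabs_ge0 ?(ltW (h1 j))// (le_trans (cabs_ge0 _) (ltW (h1 j))).
- rewrite cabs_cexp ler_expR.
  have -> (w : R[i]) : complex.Re ('i * w) = - complex.Im w by case: w => p q /=; ring.
  rewrite /klen natr_sum mulr_suml.
  have -> : - complex.Im (\sum_j (m.2 j)%:~R * ang z j) =
      \sum_j - ((m.2 j)%:~R * complex.Im (ang z j)).
    rewrite sumrN (big_morph (@complex.Im R) (id1 := 0) (op1 := +%R))//; last by case=> ? ? [].
    congr (- _); apply: eq_bigr => j _; rewrite -(rmorph_int (real_complex R)).
    by case: (ang z j) => p q /=; ring.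
  apply: ler_sum => j _; apply: le_trans (ler_norm _) _.
  rewrite normrN normrM -intr_norm natr_absz; apply: ler_wpM2l => //.
  exact: ltW.
Qed.

Lemma bnd_ge0 a b c B : bnd a b c B -> 0 <= B.
Proof. exact: rbound_ge0. Qed.

Lemma bnd_le a b a' b' c B B' : 0 <= a -> a <= a' -> b <= b' -> B <= B' ->
  bnd a' b' c B -> bnd a b c B'.
Proof.
move=> a0 aa bb BB; apply: rbound_le => // m.
by rewrite ler_wpM2l ?cabs_ge0 ?wt_le.
Qed.

Lemma bndD a b c d B B' : 0 <= a -> bnd a b c B -> bnd a b d B' ->
  bnd a b (fun m => c m + d m) (B + B').
Proof.
move=> a0 hc hd; apply: rbound_le (rboundD hc hd) => // m.
by rewrite -mulrDl ler_wpM2r ?wt_ge0 ?cabsD.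
Qed.

Lemma bndZ a b c (k : R[i]) B : bnd a b c B -> bnd a b (fun m => k * c m) (cabs k * B).
Proof.
move=> /(rboundZ (cabs_ge0 k)); apply: rbound_le => // m.
by rewrite cabsM mulrA.
Qed.

Lemma bnd_coef_le a b c d B : 0 <= a -> (forall m, cabs (c m) <= cabs (d m)) ->
  bnd a b d B -> bnd a b c B.
Proof.
by move=> a0 h; apply: rbound_le => // m; rewrite ler_wpM2r ?wt_ge0.
Qed.

Lemma absum_ev a b c B z : bnd a b c B -> dom a b z ->
  absum (fun m => c m * mono m z) B.
Proof.
move=> h hz; apply: rbound_le h => // m.
by rewrite cabsM ler_wpM2l ?cabs_ge0 ?cabs_mono.
Qed.

Lemma has_ev a b c B z : bnd a b c B -> dom a b z ->
  has_sum (fun m => c m * mono m z) (ev c z).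
Proof. by move=> h hz; exact: absum_has_sum (absum_ev h hz). Qed.

Lemma ev_le a b c B z : bnd a b c B -> dom a b z -> cabs (ev c z) <= B.
Proof. by move=> h hz; exact: sum_le (absum_ev h hz). Qed.

(** Coefficientwise summation of a family of series; products, exponentials, Neumann series and
    substitutions are all built from it. *)
Lemma bnd_family (I : choiceType) (Y : I -> mindex n -> R[i]) (M : I -> R) a b B :
  0 < a -> (forall i, bnd a b (Y i) (M i)) -> rbound M B ->
  bnd a b (fun m => sum (fun i => Y i m)) B.
Proof.
move=> a0 hY hM.
(* With the weights included, the norm bounds become absolute summability of a double family, to
   which Fubini applies. *)
pose x (im : I * mindex n) := Y im.1 im.2 * (wt a b im.2)%:C.
have wE m : cabs (wt a b m)%:C = wt a b m by rewrite cabs_nneg ?wt_ge0 ?ltW.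
have hx : absum x B.
  apply: rbound_pair hM => [im|i]; first exact: cabs_ge0.
  by apply: rbound_le (hY i) => // m; rewrite /x /= cabsM wE.
apply: rbound_le (absum_rows (absum_swap hx)) => // m.
have w0 : 0 < wt a b m by exact: wt_gt0.
have hm : absum (fun i => Y i m) (B / wt a b m).
  have wi : 0 <= (wt a b m)^-1 by rewrite invr_ge0 ltW.
  rewrite mulrC; apply: rbound_le (rboundZ wi hM) => // i.
  by rewrite mulrC ler_pdivlMr//; exact: rbound1 (hY i).
have -> : sum (fun i => x ((m, i).2, (m, i).1)) = (wt a b m)%:C * sum (fun i => Y i m).
  apply: has_sum_sum; apply: eq_has_sum (has_sumZ (absum_has_sum hm)) => i.
  by rewrite mulrC.
by rewrite cabsM wE mulrC.
Qed.

Lemma ev_family (I : choiceType) (Y : I -> mindex n -> R[i]) (M : I -> R) a b B z :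
  0 < a -> (forall i, bnd a b (Y i) (M i)) -> rbound M B -> dom a b z ->
  has_sum (fun i => ev (Y i) z) (ev (fun m => sum (fun i => Y i m)) z).
Proof.
move=> a0 hY hM hz.
pose x (im : I * mindex n) := Y im.1 im.2 * mono im.2 z.
have hx : absum x B.
  apply: rbound_pair hM => [im|i]; first exact: cabs_ge0.
  exact: absum_ev (hY i) hz.
have -> : ev (fun m => sum (fun i => Y i m)) z = sum x.
  apply: has_sum_unique (has_ev (bnd_family a0 hY hM) hz) _.
  apply: eq_has_sum (has_sum_fubini_swap hx) => m.
  have hm : absum (fun i => Y i m) (B / wt a b m).
    have w0 : 0 < wt a b m by exact: wt_gt0.
    have wi : 0 <= (wt a b m)^-1 by rewrite invr_ge0 ltW.
    rewrite mulrC; apply: rbound_le (rboundZ wi hM) => // i.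
    by rewrite mulrC ler_pdivlMr//; exact: rbound1 (hY i).
  apply: has_sum_sum; rewrite mulrC.
  by apply: eq_has_sum (has_sumZ (absum_has_sum hm)) => i; rewrite mulrC.
exact: has_sum_fubini hx.
Qed.

Definition csingle (m0 : mindex n) (k : R[i]) m := if m == m0 then k else 0.

Lemma bnd_csingle a b m0 k B : 0 <= a -> cabs k * wt a b m0 <= B ->
  bnd a b (csingle m0 k) B.
Proof.
move=> a0 h A; apply: le_trans h.
case: (boolP (m0 \in A)) => hA.
  rewrite (big_fsetD1 _ hA)/= big_seq big1 => [|m].
    by rewrite addr0 /csingle eqxx.
  by rewrite in_fsetD1 /csingle => /andP[/negbTE -> _]; rewrite cabs0 mul0r.
rewrite big_seq big1 => [|m mA]; first by rewrite mulr_ge0 ?cabs_ge0 ?wt_ge0.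
rewrite /csingle; case: eqP => [mE|]; last by rewrite cabs0 mul0r.
by rewrite -mE mA in hA.
Qed.

Lemma ev_csingle m0 k z : ev (csingle m0 k) z = k * mono m0 z.
Proof.
apply: has_sum_sum; rewrite -[k in k * _](_ : csingle m0 k m0 = k); last first.
  by rewrite /csingle eqxx.
apply: (has_sum_fset1 (x := fun m => csingle m0 k m * mono m z)) => m mm0.
by rewrite /csingle (negbTE mm0) mul0r.
Qed.

(* [frep a1 b F N]: F is given on dom a1 b by one family of Fourier-Taylor
   coefficients, whose weighted norm with action radius a is at most [N a], for
   every a <= a1. Recording the norm at all radii keeps track of the order of
   vanishing in the actions. *)
Definition frep a1 b F N := exists c,
  (forall a, 0 < a -> a <= a1 -> bnd a b c (N a)) /\
  (forall z, dom a1 b z -> F z = ev c z).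

Variables (a1 b : R).
Hypotheses (a1_gt0 : 0 < a1) (b_gt0 : 0 < b).
Local Notation rep := (frep a1 b).

Lemma rep_ge0 F N a : rep F N -> 0 < a -> a <= a1 -> 0 <= N a.
Proof. by move=> [c [hc _]] a0 /(hc _ a0)/bnd_ge0. Qed.

Lemma rep_bound F N z : rep F N -> dom a1 b z -> cabs (F z) <= N a1.
Proof. by move=> [c [hc hF]] hz; rewrite hF//; apply: ev_le hz; exact: hc. Qed.

Lemma rep_le F N N' : (forall a, 0 < a -> a <= a1 -> N a <= N' a) ->
  rep F N -> rep F N'.
Proof.
move=> NN [c [hc hF]]; exists c; split=> // a a0 aa.
by apply: bnd_le (hc a a0 aa) => //; [exact: ltW|exact: NN].
Qed.

Lemma rep_ext F G N : (forall z, dom a1 b z -> G z = F z) -> rep F N -> rep G N.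
Proof. by move=> FG [c [hc hF]]; exists c; split=> // z hz; rewrite FG// hF. Qed.

Lemma repD F G N N' : rep F N -> rep G N' ->
  rep (fun z => F z + G z) (fun a => N a + N' a).
Proof.
move=> [c [hc hF]] [d [hd hG]]; exists (fun m => c m + d m); split=> [a a0 aa|z hz].
  by apply: bndD; [exact: ltW|exact: hc|exact: hd].
rewrite hF// hG//; apply/esym/has_sum_sum.
apply: eq_has_sum (has_sumD (has_ev (hc _ a1_gt0 (lexx _)) hz) (has_ev (hd _ a1_gt0 (lexx _)) hz)) => m.
by rewrite mulrDl.
Qed.

Lemma repZ F N (k : R[i]) : rep F N ->
  rep (fun z => k * F z) (fun a => cabs k * N a).
Proof.
move=> [c [hc hF]]; exists (fun m => k * c m); split=> [a a0 aa|z hz].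
  by apply: bndZ; exact: hc.
rewrite hF//; apply/esym/has_sum_sum.
apply: eq_has_sum (has_sumZ (has_ev (hc _ a1_gt0 (lexx _)) hz)) => m.
by rewrite mulrA.
Qed.

Lemma repN F N : rep F N -> rep (fun z => - F z) N.
Proof.
move=> /(repZ (-1)); rewrite cabsN cabs1.
move=> h; apply: rep_ext (rep_le _ h) => [z _|a _ _]; first by rewrite mulN1r.
by rewrite mul1r.
Qed.

Lemma rep0 : rep (fun=> 0) (fun=> 0).
Proof.
have h0 a : bnd a b (fun=> 0) 0 by apply: rbound0 => m; rewrite cabs0 mul0r.
exists (fun=> 0); split=> // z hz; apply/esym/cabs_eq0/eqP.
by rewrite eq_le cabs_ge0 (ev_le (h0 a1) hz).
Qed.

Lemma rep_sum (J : Type) (r : seq J) (F : J -> point -> R[i]) (N : J -> R -> R) :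
  (forall j, rep (F j) (N j)) ->
  rep (fun z => \sum_(j <- r) F j z) (fun a => \sum_(j <- r) N j a).
Proof.
move=> h; elim: r => [|j r IH].
  by apply: rep_ext (rep_le _ rep0) => [z _|a _ _]; rewrite big_nil.
apply: rep_ext (rep_le _ (repD (h j) IH)) => [z _|a _ _]; by rewrite big_cons.
Qed.

Lemma rep_family (I : choiceType) (F : I -> point -> R[i]) (N : I -> R -> R)
    (B : R -> R) :
  (forall i, rep (F i) (N i)) ->
  (forall a, 0 < a -> a <= a1 -> rbound (fun i => N i a) (B a)) ->
  rep (fun z => sum (fun i => F i z)) B /\
  (forall z, dom a1 b z -> has_sum (fun i => F i z) (sum (fun i => F i z))).
Proof.
move=> /choice[Y hY] hB.
have H z : dom a1 b z ->
    has_sum (fun i => F i z) (ev (fun m => sum (fun i => Y i m)) z).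
  move=> hz; apply: eq_has_sum (ev_family (M := fun i => N i a1) a1_gt0 _ _ hz).
  - by move=> i; rewrite (hY i).2.
  - by move=> i; exact: (hY i).1.
  - exact: hB.
split; last by move=> z /H h; rewrite (has_sum_sum h).
exists (fun m => sum (fun i => Y i m)); split=> [a a0 aa|z /H /has_sum_sum//].
apply: (bnd_family (M := fun i => N i a)) => //; last exact: hB.
by move=> i; exact: (hY i).1.
Qed.

Lemma rep_mono m : rep (mono m) (fun a => wt a b m).
Proof.
exists (csingle m 1); split=> [a a0 aa|z hz]; last by rewrite ev_csingle mul1r.
by apply: bnd_csingle; [exact: ltW|rewrite cabs1 mul1r].
Qed.

(** The product is summed over pairs of monomials as a family of one-term series, so no convolution
    of coefficients has to be written down; [wtD] gives the norm. *)
Lemma repM F G N N' : rep F N -> rep G N' ->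
  rep (fun z => F z * G z) (fun a => N a * N' a).
Proof.
move=> [c [hc hF]] [d [hd hG]].
have hY (mm : mindex n * mindex n) : rep (fun z => c mm.1 * d mm.2 * mono (madd mm.1 mm.2) z)
    (fun a => (cabs (c mm.1) * wt a b mm.1) * (cabs (d mm.2) * wt a b mm.2)).
  apply: rep_le (repZ _ (rep_mono _)) => a a0 aa.
  rewrite cabsM mulrACA ler_wpM2l ?mulr_ge0 ?cabs_ge0//.
  by apply: wtD; exact: ltW.
have hN a : 0 < a -> a <= a1 -> rbound (fun mm : mindex n * mindex n =>
    (cabs (c mm.1) * wt a b mm.1) * (cabs (d mm.2) * wt a b mm.2)) (N a * N' a).
  move=> a0 aa; have w0 m : 0 <= wt a b m by rewrite wt_ge0 ?ltW.
  apply: (@rbound_pair _ _ _ _ (fun m => (cabs (c m) * wt a b m) * N' a)) => [mm|m|].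
  - by rewrite !mulr_ge0 ?cabs_ge0.
  - have k0 : 0 <= cabs (c m) * wt a b m by rewrite mulr_ge0 ?cabs_ge0.
    exact: rboundZ k0 (hd a a0 aa).
  - rewrite mulrC; apply: rbound_le (rboundZ (bnd_ge0 (hd a a0 aa)) (hc a a0 aa)) => // m.
    by rewrite mulrC.
have [h _] := rep_family hY hN; apply: rep_ext h => z hz.
rewrite hF// hG//.
have hcz := absum_ev (hc _ a1_gt0 (lexx _)) hz.
have hdz := absum_ev (hd _ a1_gt0 (lexx _)) hz.
rewrite -[LHS](sum_prod hcz hdz); apply: eq_sum => mm.
by rewrite monoD mulrACA.
Qed.

Lemma rep_cst (k : R[i]) : rep (fun=> k) (fun=> cabs k).
Proof.
have m0E z : mono (0, 0) z = 1.
  rewrite mono.unlock /= big1 => [|j _]; last by rewrite ffunE expr0.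
  by rewrite big1 ?mulr0 ?cexp0 ?mul1r// => j _; rewrite ffunE mul0r.
apply: rep_ext (rep_le _ (repZ k (rep_mono (0, 0)))) => [z _|a _ _].
  by rewrite m0E mulr1.
rewrite wt.unlock /= [X in a ^+ X](_ : _ = 0%N); last by rewrite /mlen big1// => j _; rewrite ffunE.
rewrite [X in X%:R * b](_ : _ = 0%N); last by rewrite /klen big1// => j _; rewrite ffunE.
by rewrite expr0 mul0r expR0 !mulr1.
Qed.

Lemma repX F N k : rep F N -> rep (fun z => F z ^+ k) (fun a => N a ^+ k).
Proof.
move=> h; elim: k => [|k IH].
  by apply: rep_ext (rep_le _ (rep_cst 1)) => [z _|a _ _]; rewrite expr0 ?cabs1.
by apply: rep_ext (rep_le _ (repM h IH)) => [z _|a _ _]; rewrite exprS.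
Qed.

(** Subtracting the constant term makes the majorant vanish together with [N]. *)
Lemma rep_cexp F N : rep F N ->
  rep (fun z => cexp (F z) - 1) (fun a => expR (N a) - 1).
Proof.
move=> h.
have [||hr _] := @rep_family nat (fun k z => F z ^+ k.+1 / k.+1`!%:R)
    (fun k a => N a ^+ k.+1 / k.+1`!%:R) (fun a => expR (N a) - 1).
- move=> k; apply: rep_ext (rep_le _ (repZ (k.+1`!%:R)^-1 (repX k.+1 h))) => [z _|a _ _].
    by rewrite mulrC.
  by rewrite cabsV cabs_nat mulrC.
- by move=> a a0 aa; apply: exp_series_bound1; exact: rep_ge0 h a0 aa.
- apply: rep_ext hr => z hz.
  by apply/esym/has_sum_sum; exact: cexp_series1.
Qed.

End WeightedFourierTaylor.

(** * Substitution *)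

Section Chords.
Context {R : realType}.
Implicit Types (t x y : R).

(* The inequalities satisfied by f0 = f(0), ft = f(t), f1 = f(1) for a convex
   nondecreasing f >= 0; in this form they are visibly stable under products. *)
Definition chord t (f0 ft f1 : R) : Prop :=
  [/\ 0 <= f0, f0 <= ft, ft <= f1 & ft - f0 <= t * (f1 - f0)].

Lemma chordM t f0 ft f1 g0 gt g1 : 0 <= t ->
  chord t f0 ft f1 -> chord t g0 gt g1 -> chord t (f0 * g0) (ft * gt) (f1 * g1).
Proof.
move=> t0 [a1 a2 a3 a4] [b1 b2 b3 b4]; split; first exact: mulr_ge0.
- by apply: ler_pM.
- by apply: ler_pM; lra.
have h1 : (ft - f0) * gt <= t * (f1 - f0) * gt by apply: ler_wpM2r => //; lra.
have h2 : t * (f1 - f0) * gt <= t * (f1 - f0) * g1.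
  by apply: ler_wpM2l => //; apply: mulr_ge0 => //; lra.
have h3 : f0 * (gt - g0) <= f0 * (t * (g1 - g0)) by apply: ler_wpM2l.
have -> : ft * gt - f0 * g0 = (ft - f0) * gt + f0 * (gt - g0) by ring.
have -> : t * (f1 * g1 - f0 * g0) = t * (f1 - f0) * g1 + f0 * (t * (g1 - g0)) by ring.
lra.
Qed.

Lemma chordX t f0 ft f1 k : 0 <= t ->
  chord t f0 ft f1 -> chord t (f0 ^+ k) (ft ^+ k) (f1 ^+ k).
Proof.
move=> t0 h; elim: k => [|k IH]; first by rewrite !expr0; split => //; lra.
by rewrite !exprS; exact: chordM.
Qed.

Lemma chord_affine t x y : 0 <= t <= 1 -> 0 <= x -> 0 <= y -> chord t x (x + t * y) (x + y).
Proof.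
move=> /andP[t0 t1] x0 y0; split => //; nra.
Qed.

Lemma chord_expR t x y : 0 <= t <= 1 -> 0 <= y ->
  chord t (expR x) (expR (x + t * y)) (expR (x + y)).
Proof.
move=> /andP[t0 t1] y0; split; first exact: expR_ge0.
- by rewrite ler_expR; nra.
- by rewrite ler_expR; nra.
rewrite !expRD; set E := expR x; have E0 : 0 < E by exact: expR_gt0.
suff : expR (t * y) <= (1 - t) + t * expR y by nra.
(* Convexity from the tangent at t * y: it lies below the exponential at 0 and at y, and the two
   inequalities are averaged with weights 1 - t and t. *)
have h1 := expR_ge1Dx (- (t * y)); have h2 := expR_ge1Dx ((1 - t) * y).
have e1 : expR (t * y) * expR (- (t * y)) = 1 by rewrite -expRD subrr expR0.
have e2 : expR (t * y) * expR ((1 - t) * y) = expR y.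
  by rewrite -expRD; congr expR; ring.
have e0 := expR_gt0 (t * y); set X := expR (t * y) in e0 e1 e2 *.
have k1 : X * (1 - t * y) <= 1 by rewrite -[leRHS]e1 ler_wpM2l// ltW.
have k2 : X * (1 + (1 - t) * y) <= expR y by rewrite -[leRHS]e2 ler_wpM2l// ltW.
have k3 : (1 - t) * (X * (1 - t * y)) <= 1 - t by rewrite -[leRHS]mulr1 ler_wpM2l//; lra.
have k4 : t * (X * (1 + (1 - t) * y)) <= t * expR y by rewrite ler_wpM2l.
have -> : X = (1 - t) * (X * (1 - t * y)) + t * (X * (1 + (1 - t) * y)) by ring.
lra.
Qed.

(** Enlarging the radii by a fraction t of (d, e) raises a weight by at most t times its full
    increase. This convexity plays the role of a Cauchy estimate for increments under
    substitution. *)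
Lemma chord_wt (n : nat) t (a b d e : R) (m : mindex n) : 0 <= t <= 1 -> 0 <= a ->
  0 <= d -> 0 <= e ->
  chord t (wt a b m) (wt (a + t * d) (b + t * e) m) (wt (a + d) (b + e) m).
Proof.
move=> ht a0 d0 e0; have /andP[t0 t1] := ht; rewrite wt.unlock; apply: chordM => //.
  by apply: chordX => //; exact: chord_affine.
rewrite !mulrDr mulrCA; apply: chord_expR => //.
exact: mulr_ge0.
Qed.

End Chords.

Section Substitution.
Context {R : realType} {n : nat}.
Notation point := 'rV[R[i]]_(n + n).
Implicit Types (a : R) (z : point) (m : mindex n).
Variables (a1 b : R).
Hypotheses (a1_gt0 : 0 < a1) (b_gt0 : 0 < b).
Local Notation rep := (frep a1 b).

(** [F0] is the main part of [F], and the increment of the majorant bounds the increment of the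
    function. The form is stable under products, because F G - F0 G0 expands in the main parts and
    the two increments with plus signs only. *)
Definition drep (F F0 : point -> R[i]) (N N0 : R -> R) :=
  rep F0 N0 /\ rep (fun z => F z - F0 z) (fun a => N a - N0 a).

Lemma drep_refl F N : rep F N -> drep F F N N.
Proof.
move=> h; split=> //; by apply: rep_ext (rep_le _ (rep0 a1 b)) => [z _|a _ _]; rewrite subrr.
Qed.

Lemma drepM F F0 N N0 G G0 M M0 : drep F F0 N N0 -> drep G G0 M M0 ->
  drep (fun z => F z * G z) (fun z => F0 z * G0 z)
       (fun a => N a * M a) (fun a => N0 a * M0 a).
Proof.
move=> [f0 f1] [g0 g1]; split; first exact: repM.
apply: rep_ext (rep_le _ (repD a1_gt0 (repM a1_gt0 b_gt0 f1 g1)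
  (repD a1_gt0 (repM a1_gt0 b_gt0 f0 g1) (repM a1_gt0 b_gt0 f1 g0)))) => [z _|a _ _].
  by ring.
by rewrite le_eqVlt; apply/orP; left; apply/eqP; ring.
Qed.

Lemma drepX F F0 N N0 k : drep F F0 N N0 ->
  drep (fun z => F z ^+ k) (fun z => F0 z ^+ k) (fun a => N a ^+ k) (fun a => N0 a ^+ k).
Proof.
move=> h; elim: k => [|k [IH1 IH2]].
  split; first by apply: rep_ext (rep_le _ (rep_cst b a1_gt0 1)) => [z _|a _ _]; rewrite expr0 ?cabs1.
  by apply: rep_ext (rep_le _ (rep0 a1 b)) => [z _|a _ _]; rewrite !expr0 subrr.
have [h1 h2] := drepM h (conj IH1 IH2); split.
  by apply: rep_ext (rep_le _ h1) => [z _|a _ _]; rewrite exprS.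
by apply: rep_ext (rep_le _ h2) => [z _|a _ _]; rewrite !exprS.
Qed.

Lemma drep_prod (J : Type) (r : seq J) (F F0 : J -> point -> R[i]) (N N0 : J -> R -> R) :
  (forall j, drep (F j) (F0 j) (N j) (N0 j)) ->
  drep (fun z => \prod_(j <- r) F j z) (fun z => \prod_(j <- r) F0 j z)
       (fun a => \prod_(j <- r) N j a) (fun a => \prod_(j <- r) N0 j a).
Proof.
move=> h; elim: r => [|j r [IH1 IH2]].
  split; first by apply: rep_ext (rep_le _ (rep_cst b a1_gt0 1)) => [z _|a _ _]; rewrite big_nil ?cabs1.
  by apply: rep_ext (rep_le _ (rep0 a1 b)) => [z _|a _ _]; rewrite !big_nil subrr.
have [h1 h2] := drepM (h j) (conj IH1 IH2); split.
  by apply: rep_ext (rep_le _ h1) => [z _|a _ _]; rewrite big_cons.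
by apply: rep_ext (rep_le _ h2) => [z _|a _ _]; rewrite !big_cons.
Qed.

Definition eunit (j : 'I_n) : {ffun 'I_n -> nat} := [ffun j' => (j' == j : nat)].

Lemma mlen_eunit j : mlen (eunit j) = 1%N.
Proof.
rewrite /mlen (bigD1 j)//= ffunE eqxx big1// => j' jj'.
by rewrite ffunE (negbTE jj').
Qed.

Lemma klen0 : klen (0 : {ffun 'I_n -> int}) = 0%N.
Proof. by rewrite /klen big1// => j _; rewrite ffunE. Qed.

Lemma mlen0 : mlen (0 : {ffun 'I_n -> nat}) = 0%N.
Proof. by rewrite /mlen big1// => j _; rewrite ffunE. Qed.

Lemma mono_act j z : mono (eunit j, 0) z = act z j.
Proof.
rewrite mono.unlock /= (bigD1 j)//= ffunE eqxx expr1 big1 => [|j' jj'].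
  by rewrite mulr1 big1 ?mulr0 ?cexp0 ?mulr1// => j' _; rewrite ffunE mul0r.
by rewrite ffunE (negbTE jj') expr0.
Qed.

Lemma mono_ang (k : {ffun 'I_n -> int}) z :
  mono (0, k) z = cexp ('i * \sum_j (k j)%:~R * ang z j).
Proof.
by rewrite mono.unlock /= big1 ?mul1r// => j _; rewrite ffunE expr0.
Qed.

Lemma rep_act j : rep (fun z => act z j) id.
Proof.
apply: rep_ext (rep_le _ (rep_mono a1 b (eunit j, 0))) => [z _|a _ _].
  by rewrite mono_act.
by rewrite wt.unlock /= mlen_eunit klen0 expr1 mul0r expR0 mulr1.
Qed.

Variables (Psi : point -> point) (d u : 'I_n -> point -> R[i]) (gam : R -> R) (ups : R).
Hypotheses
  (Psi_act : forall z, dom a1 b z -> forall j, act (Psi z) j = act z j + d j z)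
  (Psi_ang : forall z, dom a1 b z -> forall j, ang (Psi z) j = ang z j + u j z)
  (d_rep : forall j, rep (d j) gam) (u_rep : forall j, rep (u j) (fun=> ups)).

(** Each factor moves within its own majorant, p_j + d_j within a + gam a and exp(i k u) within
    exp(|k| ups); the products of these reassemble into weights. *)
Lemma rep_mono_subst m : rep (fun z => mono m (Psi z) - mono m z)
  (fun a => wt (a + gam a) (b + ups) m - wt a b m).
Proof.
have hP : drep (fun z => \prod_j (act z j + d j z) ^+ m.1 j)
    (fun z => \prod_j act z j ^+ m.1 j)
    (fun a => \prod_(j < n) (a + gam a) ^+ m.1 j) (fun a => \prod_(j < n) a ^+ m.1 j).
  apply: drep_prod => j; apply: drepX; split; first exact: rep_act.
  by apply: rep_ext (rep_le _ (d_rep j)) => [z _|a _ _]; rewrite addrAC subrr add0r.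
have hQ : drep (fun z => cexp ('i * \sum_j (m.2 j)%:~R * ang z j))
    (fun z => cexp ('i * \sum_j (m.2 j)%:~R * ang z j))
    (fun=> expR ((klen m.2)%:R * b)) (fun=> expR ((klen m.2)%:R * b)).
  apply: drep_refl.
  apply: rep_ext (rep_le _ (rep_mono a1 b (0, m.2))) => [z _|a _ _].
    by rewrite mono_ang.
  by rewrite wt.unlock /= mlen0 expr0 mul1r.
have hU : drep (fun z => cexp ('i * \sum_j (m.2 j)%:~R * u j z)) (fun=> 1)
    (fun=> expR ((klen m.2)%:R * ups)) (fun=> 1).
  split; first by apply: rep_le (rep_cst b a1_gt0 1) => a _ _; rewrite cabs1.
  apply: rep_cexp => //.
  apply: rep_le (repZ a1_gt0 'i (rep_sum a1_gt0 _
     (fun j => repZ a1_gt0 (m.2 j)%:~R (u_rep j)))) => a _ _.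
  rewrite cabs_i mul1r /klen natr_sum mulr_suml.
  by apply: ler_sum => j _; rewrite cabs_int.
have [_ h] := drepM hP (drepM hQ hU).
apply: rep_ext (rep_le _ h) => [z hz|a _ _].
  rewrite mono.unlock /= mulr1 -cexpD -mulrDr -big_split/=.
  congr (_ * cexp ('i * _) - _); first by apply: eq_bigr => j _; rewrite Psi_act.
  by apply: eq_bigr => j _; rewrite Psi_ang// mulrDr.
rewrite wt.unlock /mlen !expr_sum mulr1 -expRD -mulrDr.
exact: lexx.
Qed.

Lemma subst_dom z : dom a1 b z -> dom (a1 + gam a1) (b + ups) (Psi z).
Proof.
move=> hz; have [h1 h2] := (domP a1 b z).1 hz; apply/domP; split=> j.
  rewrite Psi_act//; apply: le_lt_trans (cabsD _ _) _.
  by apply: ltr_leD => //; exact: rep_bound (d_rep j) hz.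
rewrite Psi_ang//; have -> : complex.Im (ang z j + u j z) =
    complex.Im (ang z j) + complex.Im (u j z) by case: (ang z j) (u j z) => ? ? [].
apply: le_lt_trans (ler_normD _ _) _; apply: ltr_leD => //.
apply: le_trans (cabs_Im _) _.
exact: (rep_bound a1_gt0 (u_rep j) hz).
Qed.

Hypotheses (gam_ge0 : 0 <= gam a1) (ups_ge0 : 0 <= ups).

Lemma rep_subst (g : mindex n -> R[i]) (B : R) (N : R -> R) :
  bnd (a1 + gam a1) (b + ups) g B ->
  (forall a, 0 < a -> a <= a1 ->
    rbound (fun m => cabs (g m) * (wt (a + gam a) (b + ups) m - wt a b m)) (N a)) ->
  rep (fun z => ev g (Psi z) - ev g z) N.
Proof.
move=> gB gN.
have gB0 : bnd a1 b g B by apply: bnd_le gB => //; [exact: ltW|rewrite lerDl|rewrite lerDl].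
have [|h _] := @rep_family R n a1 b a1_gt0 _
  (fun m z => g m * (mono m (Psi z) - mono m z))
  (fun m a => cabs (g m) * (wt (a + gam a) (b + ups) m - wt a b m)) N _ gN.
  by move=> m; apply: repZ => //; exact: rep_mono_subst.
apply: rep_ext h => z hz; apply/esym/has_sum_sum.
apply: eq_has_sum (has_sumB (has_ev gB (subst_dom hz)) (has_ev gB0 hz)) => m.
by rewrite mulrBr.
Qed.

End Substitution.

Section SubstitutionBounds.
Context {R : realType} {n : nat}.
Notation point := 'rV[R[i]]_(n + n).
Implicit Types (a : R) (z : point) (m : mindex n).
Variables (a1 b : R).
Hypotheses (a1_gt0 : 0 < a1) (b_gt0 : 0 < b).
Local Notation rep := (frep a1 b).

Lemma bnd_deg (c : mindex n -> R[i]) (rho a : R) (l : nat) B : 0 < rho -> 0 <= a ->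
  a <= rho -> (forall m, (mlen m.1 < l)%N -> c m = 0) -> bnd rho b c B ->
  bnd a b c ((a / rho) ^+ l * B).
Proof.
move=> r0 a0 ar cl h.
have q0 : 0 <= a / rho by rewrite divr_ge0// ltW.
have q1 : a / rho <= 1 by rewrite ler_pdivrMr// mul1r.
apply: rbound_le (rboundZ (exprn_ge0 l q0) h) => // m.
have [/cl ->|lm] := ltnP (mlen m.1) l; first by rewrite cabs0 !mul0r mulr0.
rewrite mulrCA ler_wpM2l ?cabs_ge0// wt.unlock mulrA ler_wpM2r ?expR_ge0//.
rewrite -{1}[a](divfK (lt0r_neq0 r0)) exprMn ler_wpM2r ?exprn_ge0 ?(ltW r0)//.
by rewrite ler_wiXn2l.
Qed.

(** Terms of degree at most one grow at most linearly with the radius, so passing from [nu] to [a1]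
    costs a1 / nu. A majorant of order nu^2 or nu^3 at radius [nu] thus leaves a positive power of
    nu. *)
Lemma bnd_low (c : mindex n -> R[i]) (nu B : R) : 0 < nu -> nu <= a1 ->
  bnd nu b c B ->
  bnd a1 b (fun m => if (mlen m.1 < 2)%N then c m else 0) (a1 / nu * B).
Proof.
move=> n0 na h; have q0 : 0 <= a1 / nu by rewrite divr_ge0// ltW.
have q1 : 1 <= a1 / nu by rewrite ler_pdivlMr// mul1r.
apply: rbound_le (rboundZ q0 h) => // m.
have w0 : 0 <= wt nu b m by rewrite wt_ge0// ltW.
case: ifP => ml; last by rewrite cabs0 mul0r; apply: mulr_ge0 => //; apply: mulr_ge0 => //; exact: cabs_ge0.
rewrite mulrCA ler_wpM2l ?cabs_ge0// wt.unlock mulrA ler_wpM2r ?expR_ge0//.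
case: (mlen m.1) ml => [|[|//]] _; first by rewrite !expr0 mulr1.
by rewrite !expr1 divfK// lt0r_neq0.
Qed.

End SubstitutionBounds.

(** * Canonical transformations *)

Section QuadraticEstimate.
Context {R : realType}.

Lemma mx_norm_leP (p q : nat) (A : 'M[R[i]]_(p, q)) (eta : R) : 0 <= eta ->
  `|A| <= eta%:C <-> forall i j, cabs (A i j) <= eta.
Proof.
move=> eta0; split=> [h i j|h].
  rewrite -lecR -cabsE; apply: le_trans h; rewrite [leRHS]/Num.norm /= mx_normE.
  have -> : `|A i j| = (`|A i j|%:nng)%:num by [].
  by rewrite num_le; apply: (le_bigmax _ _ (i, j)).
rewrite /Num.norm /=; have [->|/mx_norm_neq0[[i j] ->]] := eqVneq (mx_norm A) 0.
  by rewrite ler0c.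
by rewrite cabsE lecR; exact: h.
Qed.

(** A second-order remainder in coordinates, which can be read off a series and yields
    differentiability and the Jacobian together. *)
Definition quad_diff (p q : nat) (F : 'rV[R[i]]_p -> 'rV[R[i]]_q)
    (J : 'M[R[i]]_(p, q)) (z : 'rV[R[i]]_p) :=
  exists K delta : R, 0 < delta /\ forall (h : 'rV[R[i]]_p) (eta : R),
    0 <= eta -> eta <= delta -> (forall j, cabs (h 0 j) <= eta) ->
    forall i, cabs ((F (z + h) - F z - h *m J) 0 i) <= K * eta ^+ 2.

Lemma near_dist (V : normedModType R[i]) (x : V) (r : R) : 0 < r ->
  \forall y \near x, `|x - y| <= r%:C.
Proof.
move=> r0; apply: filterS (nbhsx_ballx x r%:C _); last by rewrite ltcR.
by move=> y; rewrite -ball_normE => /ltW.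
Qed.

Lemma mulmxr_continuous (p q : nat) (J : 'M[R[i]]_(p, q)) :
  continuous (fun h : 'rV[R[i]]_p => h *m J).
Proof.
pose B := 1 + \sum_k \sum_i cabs (J k i).
have B0 : 0 < B.
  have : 0 <= \sum_k \sum_i cabs (J k i).
    by apply: sumr_ge0 => k _; apply: sumr_ge0 => i _; exact: cabs_ge0.
  by rewrite /B; lra.
move=> h; apply: (@cvgrPdist_le _ _ _ (nbhs h) (nbhs_filter h) _ _).2 => e e0.
have eE : e = (complex.Re e)%:C by rewrite RRe_real// gtr0_real.
set r := complex.Re e in eE; rewrite eE ltcR in e0; rewrite eE.
apply: (@filterS _ _ (nbhs_filter h)) (near_dist h (divr_gt0 e0 B0)) => h'.
have rB : 0 <= r / B by rewrite divr_ge0// ltW.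
move=> /(mx_norm_leP _ rB) hh; rewrite -mulmxBl; apply/mx_norm_leP; first exact: ltW.
move=> i j; rewrite !mxE; apply: le_trans (cabs_sum _ _ _) _.
apply: (@le_trans _ _ (\sum_k r / B * cabs (J k j))).
  by apply: ler_sum => k _; rewrite cabsM ler_wpM2r ?cabs_ge0.
rewrite -mulr_sumr -[leRHS](divfK (lt0r_neq0 B0)) ler_wpM2l//.
apply: (@le_trans _ _ (\sum_k \sum_i cabs (J k i))); last by rewrite lerDr.
apply: ler_sum => k _; rewrite (bigD1 j)//= lerDl sumr_ge0// => l _.
exact: cabs_ge0.
Qed.

Lemma quad_diff_differentiable (p q : nat) (F : 'rV[R[i]]_p -> 'rV[R[i]]_q) J z :
  quad_diff F J z -> differentiable F z /\ 'J F z = J.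
Proof.
move=> [K [delta [delta0 hF]]].
have Jc : continuous (mulmxr J : 'rV[R[i]]_p -> 'rV[R[i]]_q).
  exact: mulmxr_continuous.
have Fo : F \o shift z = cst (F z) + (mulmxr J : {linear 'rV[R[i]]_p -> 'rV[R[i]]_q}) +o_ (0 : 'rV[R[i]]_p) id.
  apply/eqaddoP => e e0.
  have eE : e = (complex.Re e)%:C by rewrite RRe_real// gtr0_real.
  set r := complex.Re e in eE; rewrite eE ltcR in e0; rewrite eE.
  have K1 : 0 < `|K| + 1 by have := normr_ge0 K; lra.
  pose d := Num.min delta (r / (`|K| + 1)).
  have d0 : 0 < d by rewrite lt_min delta0 divr_gt0.
  have near0 := near_dist (0 : 'rV[R[i]]_p) d0.
  refine (@filterS _ _ (nbhs_filter (0 : 'rV[R[i]]_p)) _ _ _ near0) => h.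
  rewrite sub0r normrN => hd.
  have nE : `|h| = (complex.Re `|h|)%:C by rewrite RRe_real// ger0_real.
  have n0 : 0 <= complex.Re `|h| by rewrite -ler0c -nE.
  have nd : complex.Re `|h| <= d by rewrite -lecR -nE.
  rewrite [X in _ <= _ * X](_ : _ = `|h|)// nE -rmorphM.
  apply/mx_norm_leP; first by rewrite mulr_ge0// ltW.
  move=> i j; rewrite (ord1 i).
  have -> : (F \o shift z - (cst (F z) + mulmxr J)) h = F (z + h) - F z - h *m J.
    by rewrite -[LHS]/(F (h + z) - (F z + h *m J)) (addrC h) opprD addrA.
  have hj k : cabs (h 0 k) <= complex.Re `|h|.
    have hle : `|h| <= (complex.Re `|h|)%:C by rewrite -nE.
    exact: ((mx_norm_leP h n0).1 hle 0 k).
  have [nd1 nd2] : complex.Re `|h| <= delta /\ complex.Re `|h| <= r / (`|K| + 1).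
    by move: nd; rewrite /d le_min => /andP.
  apply: le_trans (hF _ _ n0 nd1 hj j) _.
  rewrite expr2 mulrA ler_wpM2r//; move: nd2; rewrite ler_pdivlMr//.
  by have := ler_norm K; nra.
have dF := diff_unique Jc Fo.
split.
  by apply/diff_locallyP; rewrite dF.
by rewrite /jacobian dF; apply/row_matrixP => i; rewrite !rowE mul_rV_lin1.
Qed.

End QuadraticEstimate.

(** * Fourier series in the angles alone and their Cauchy estimates *)

Section AngleSeries.
Context {R : realType} {n : nat}.
Notation point := 'rV[R[i]]_(n + n).
Implicit Types (a b : R) (z : point) (m : mindex n) (c : mindex n -> R[i]).

Definition ang_only c := forall m, m.1 != 0 -> c m = 0.

(** The coefficients of the derivative in the j-th angle. *)
Definition dang (j : 'I_n) c m : R[i] := 'i * (m.2 j)%:~R * c m.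

(** A series in the angles alone converges here whatever the actions are, so its use is not tied to
    an action radius. *)
Definition strip b : set point := [set z | forall j, `|complex.Im (ang z j)| < b].

Definition kdot m z : R[i] := \sum_j (m.2 j)%:~R * ang z j.

Lemma actE z j : act z j = z 0 (lshift n j).
Proof. by rewrite /act mxE. Qed.

Lemma angE z j : ang z j = z 0 (rshift n j).
Proof. by rewrite /ang mxE. Qed.

Lemma angD z h j : ang (z + h) j = ang z j + ang h j.
Proof. by rewrite !angE mxE. Qed.

Lemma actD z h j : act (z + h) j = act z j + act h j.
Proof. by rewrite !actE mxE. Qed.

Lemma kdotD m z h : kdot m (z + h) = kdot m z + kdot m h.
Proof. by rewrite /kdot -big_split; apply: eq_bigr => j _; rewrite angD mulrDr. Qed.

Lemma kdot_le m z eta : (forall j, cabs (ang z j) <= eta) ->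
  cabs (kdot m z) <= (klen m.2)%:R * eta.
Proof.
move=> h; apply: le_trans (cabs_sum _ _ _) _; rewrite /klen natr_sum mulr_suml.
by apply: ler_sum => j _; rewrite cabsM cabs_int ler_wpM2l.
Qed.

Lemma mono_ang0 m z : m.1 = 0 -> mono m z = cexp ('i * kdot m z).
Proof. by case: m => i k /= ->; rewrite mono_ang. Qed.

Lemma wt_ang0 a b m : m.1 = 0 -> wt a b m = expR ((klen m.2)%:R * b).
Proof. by case: m => i k /= ->; rewrite wt.unlock /= mlen0 expr0 mul1r. Qed.

Lemma Re_iM (w : R[i]) : complex.Re ('i * w) = - complex.Im w.
Proof. by case: w => p q /=; ring. Qed.

Lemma Im_sum (J : Type) (r : seq J) (F : J -> R[i]) :
  complex.Im (\sum_(j <- r) F j) = \sum_(j <- r) complex.Im (F j).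
Proof. by rewrite (big_morph (@complex.Im R) (id1 := 0) (op1 := +%R))//; case=> ? ? []. Qed.

Lemma Re_ikdot b m z : strip b z -> complex.Re ('i * kdot m z) <= (klen m.2)%:R * b.
Proof.
move=> hz; rewrite Re_iM Im_sum -sumrN /klen natr_sum mulr_suml.
apply: ler_sum => j _; apply: le_trans (ler_norm _) _; rewrite normrN.
rewrite -(rmorph_int (real_complex R)).
have -> : complex.Im ((m.2 j)%:~R%:C * ang z j) = (m.2 j)%:~R * complex.Im (ang z j).
  by case: (ang z j) => p q /=; ring.
by rewrite normrM -intr_norm natr_absz; apply: ler_wpM2l => //; exact: ltW (hz j).
Qed.

Lemma ev_eq_ang c z z' : ang_only c -> (forall j, ang z j = ang z' j) ->
  ev c z = ev c z'.
Proof.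
move=> hc h; apply: eq_sum => m; have [m0|/hc ->] := eqVneq m.1 0.
  by rewrite !mono_ang0//; congr (_ * cexp ('i * _)); apply: eq_bigr => j _; rewrite h.
by rewrite !mul0r.
Qed.

Lemma has_ev_ang a b c B z : ang_only c -> bnd a b c B -> strip b z ->
  has_sum (fun m => c m * mono m z) (ev c z).
Proof.
move=> hc h hz; apply: (@absum_has_sum _ _ _ B); apply: rbound_le h => // m.
have [m0|/hc ->] := eqVneq m.1 0; last by rewrite mul0r cabs0 mul0r.
rewrite cabsM ler_wpM2l ?cabs_ge0// mono_ang0// (wt_ang0 _ _ m0) cabs_cexp ler_expR.
exact: Re_ikdot.
Qed.

Lemma ang_only_dang j c : ang_only c -> ang_only (dang j c).
Proof. by move=> hc m /hc h; rewrite /dang h mulr0. Qed.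

Lemma klen_le j m : (`|m.2 j|%N <= klen m.2)%N.
Proof. by rewrite /klen (bigD1 j)//= leq_addr. Qed.

(** The Cauchy estimate on one coefficient: k delta <= exp(k delta), so a derivative costs a factor
    1 / delta and the width delta. *)
Lemma klen_exp (k : nat) (b delta : R) : 0 < delta ->
  k%:R * expR (k%:R * b) <= delta^-1 * expR (k%:R * (b + delta)).
Proof.
move=> d0; rewrite mulrDr expRD; set E := expR (k%:R * b); set X := expR _.
have E0 : 0 <= E by exact: expR_ge0.
have h : k%:R <= delta^-1 * X.
  by rewrite mulrC ler_pdivlMr//; have := expR_ge1Dx (k%:R * delta); rewrite -/X; lra.
have -> : delta^-1 * (E * X) = delta^-1 * X * E by ring.
exact: ler_wpM2r.
Qed.

Lemma bnd_klen a b c (delta B : R) : 0 < delta -> 0 <= a -> bnd a (b + delta) c B ->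
  bnd a b (fun m => (klen m.2)%:R * c m) (B / delta).
Proof.
move=> d0 a0 h; have di : 0 <= delta^-1 by rewrite invr_ge0 ltW.
rewrite mulrC; apply: rbound_le (rboundZ di h) => // m.
rewrite cabsM cabs_nat wt.unlock; have hk := klen_exp (klen m.2) b d0.
set E := expR _ in hk *; set E' := expR _ in hk *; set k := _%:R in hk *.
have -> : k * cabs (c m) * (a ^+ mlen m.1 * E) = cabs (c m) * a ^+ mlen m.1 * (k * E) by ring.
have -> : delta^-1 * (cabs (c m) * (a ^+ mlen m.1 * E')) =
  cabs (c m) * a ^+ mlen m.1 * (delta^-1 * E') by ring.
by rewrite ler_wpM2l// mulr_ge0 ?cabs_ge0 ?exprn_ge0.
Qed.

Lemma bnd_dang a b c (delta B : R) j : 0 < delta -> 0 <= a ->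
  bnd a (b + delta) c B -> bnd a b (dang j c) (B / delta).
Proof.
move=> d0 a0 h; apply: bnd_coef_le (bnd_klen d0 a0 h) => // m.
rewrite /dang !cabsM cabs_i mul1r cabs_int cabs_nat ler_wpM2r ?cabs_ge0//.
by rewrite ler_nat klen_le.
Qed.

Lemma ev_lip a b c (delta B eta : R) z z' : 0 < delta -> 0 < a -> ang_only c ->
  bnd a (b + delta) c B -> strip b z -> strip b z' -> 0 <= eta ->
  (forall j, cabs (ang z j - ang z' j) <= eta) ->
  cabs (ev c z - ev c z') <= 5 * (B / delta) * eta.
Proof.
move=> d0 a0 hc h hz hz' e0 he.
have h0 : bnd a b c B.
  by apply: bnd_le h => //; rewrite ?lerDl; exact: ltW.
have hk := bnd_klen d0 (ltW a0) h.
apply: has_sum_le (has_sumB (has_ev_ang hc h0 hz) (has_ev_ang hc h0 hz')).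
have e5 : 0 <= 5 * eta by rewrite mulr_ge0.
have -> : 5 * (B / delta) * eta = 5 * eta * (B / delta) by ring.
apply: rbound_le (rboundZ e5 hk) => // m.
rewrite -mulrBr cabsM; have [m0|/hc ->] := eqVneq m.1 0; last first.
  by rewrite !(cabs0, mul0r, mulr0).
rewrite !mono_ang0// (wt_ang0 _ _ m0) cabsM cabs_nat.
have hl := cexp_lip (Re_ikdot m hz) (Re_ikdot m hz').
have hd : cabs ('i * kdot m z - 'i * kdot m z') <= (klen m.2)%:R * eta.
  rewrite -mulrBr cabsM cabs_i mul1r /kdot -sumrB.
  under eq_bigr do rewrite -mulrBr.
  apply: le_trans (cabs_sum _ _ _) _; rewrite /klen natr_sum mulr_suml.
  by apply: ler_sum => j _; rewrite cabsM cabs_int ler_wpM2l.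
have c0 := cabs_ge0 (c m).
have -> : 5 * eta * ((klen m.2)%:R * cabs (c m) * expR ((klen m.2)%:R * b)) =
  cabs (c m) * (5 * ((klen m.2)%:R * eta) * expR ((klen m.2)%:R * b)) by ring.
rewrite ler_wpM2l//; apply: le_trans hl _.
by rewrite ler_wpM2r ?expR_ge0// ler_wpM2l.
Qed.

(** Taylor's formula in each exponential. Of the spare factor exp(|k| delta), one half absorbs the
    displacement, as eta <= delta / 2, and the other absorbs |k|^2. *)
Lemma ev_quad a b c (delta B eta : R) z h : 0 < delta -> 0 < a -> ang_only c ->
  bnd a (b + delta) c B -> strip b z -> 0 <= eta -> eta <= delta / 2 ->
  (forall j, cabs (ang h j) <= eta) ->
  cabs (ev c (z + h) - ev c z - \sum_j ang h j * ev (dang j c) z)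
    <= 64 * (B / delta ^+ 2) * eta ^+ 2.
Proof.
move=> d0 a0 hc hB hz e0 ed he.
have h0 : bnd a b c B.
  by apply: bnd_le hB => //; rewrite ?lerDl; exact: ltW.
have hzh : strip (b + delta) (z + h).
  move=> j; rewrite angD.
  have -> : complex.Im (ang z j + ang h j) = complex.Im (ang z j) + complex.Im (ang h j).
    by case: (ang z j) (ang h j) => ? ? [].
  apply: le_lt_trans (ler_normD _ _) _; apply: ltr_leD (hz j) _.
  by apply: le_trans (cabs_Im _) _; apply: le_trans (he j) _; lra.
have hs j : has_sum (fun m => ang h j * (dang j c m * mono m z)) (ang h j * ev (dang j c) z).
  apply: has_sumZ; apply: has_ev_ang hz; first exact: ang_only_dang.
  exact: bnd_dang d0 (ltW a0) hB.
have hS := has_sum_big (r := index_enum 'I_n) hs.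
have H := has_sumB (has_sumB (has_ev_ang hc hB hzh) (has_ev_ang hc h0 hz)) hS.
apply: has_sum_le H.
have q0 : 0 <= 64 * eta ^+ 2 / delta ^+ 2 by rewrite divr_ge0 ?mulr_ge0 ?exprn_ge0// ltW.
have -> : 64 * (B / delta ^+ 2) * eta ^+ 2 = 64 * eta ^+ 2 / delta ^+ 2 * B by ring.
apply: rbound_le (rboundZ q0 hB) => // m.
have [m0|/hc cm] := eqVneq m.1 0; last first.
  rewrite !cm !mul0r subrr sub0r big1 ?oppr0 ?cabs0 ?mul0r ?mulr0// => j _.
  by rewrite /dang cm mulr0 mul0r mulr0.
have -> : c m * mono m (z + h) - c m * mono m z - \sum_j ang h j * (dang j c m * mono m z) =
    c m * mono m z * (cexp ('i * kdot m h) - 1 - 'i * kdot m h).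
  rewrite !mono_ang0// kdotD mulrDr cexpD.
  have -> : \sum_j ang h j * (dang j c m * cexp ('i * kdot m z)) =
      c m * cexp ('i * kdot m z) * ('i * kdot m h).
    by rewrite /kdot !mulr_sumr; apply: eq_bigr => j _; rewrite /dang; ring.
  by ring.
rewrite (wt_ang0 _ _ m0) mono_ang0// (cabsM (c m * _)) (cabsM (c m)).
set k := (klen m.2)%:R : R; have k0 : 0 <= k by rewrite /k.
have c0 := cabs_ge0 (c m).
have -> : 64 * eta ^+ 2 / delta ^+ 2 * (cabs (c m) * expR (k * (b + delta))) =
  cabs (c m) * (expR (k * b) * (64 * eta ^+ 2 / delta ^+ 2 * expR (k * delta))).
  by rewrite mulrDr expRD; ring.
rewrite -mulrA ler_wpM2l//; apply: ler_pM; rewrite ?cabs_ge0//.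
  by rewrite cabs_cexp ler_expR; exact: Re_ikdot.
apply: le_trans (cexp_sub2 _) _.
set x := cabs _; have x0 : 0 <= x by exact: cabs_ge0.
have xk : x <= k * eta by rewrite /x cabsM cabs_i mul1r; exact: kdot_le.
apply: le_trans (expR_sub2_le x0) _.
have h1 : x ^+ 2 <= (k * eta) ^+ 2 by rewrite lerXn2r ?nnegrE ?mulr_ge0.
have h2 : expR x <= expR (k * delta / 2).
  by rewrite ler_expR; apply: le_trans xk _; rewrite -mulrA ler_wpM2l.
apply: (@le_trans _ _ ((k * eta) ^+ 2 * expR (k * delta / 2))).
  by apply: ler_pM => //; rewrite ?exprn_ge0 ?expR_ge0.
have -> : expR (k * delta) = expR (k * delta / 2) * expR (k * delta / 2).
  by rewrite -expRD; congr expR; lra.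
rewrite mulrA ler_wpM2r ?expR_ge0//.
(* Squaring x <= 4 exp(x / 4) gives 16 already; the constant 64 is not sharp. *)
have h3 : (k * delta) ^+ 2 <= 64 * expR (k * delta / 2).
  have -> : expR (k * delta / 2) = expR (k * delta / 4) ^+ 2.
    by rewrite expr2 -expRD; congr expR; lra.
  have kd : 0 <= k * delta by rewrite mulr_ge0// ltW.
  have h4 : k * delta / 4 <= expR (k * delta / 4).
    have := expR_ge1Dx (k * delta / 4); lra.
  by rewrite !expr2; nra.
have -> : (k * eta) ^+ 2 = eta ^+ 2 / delta ^+ 2 * (k * delta) ^+ 2.
  by field; rewrite lt0r_neq0.
have -> : 64 * eta ^+ 2 / delta ^+ 2 * expR (k * delta / 2) =
  eta ^+ 2 / delta ^+ 2 * (64 * expR (k * delta / 2)) by ring.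
by rewrite ler_wpM2l// divr_ge0 ?exprn_ge0// ltW.
Qed.

End AngleSeries.

Section JacobianComp.
Context {K : numFieldType} {p q r : nat}.

Lemma mul_jacobian (k l : nat) (F : 'rV[K]_k -> 'rV[K]_l) x v :
  v *m 'J F x = 'd F x v.
Proof. exact: mul_rV_lin1. Qed.

(** Row vectors multiply the Jacobian from the left, so the factors stand in the order in which the
    maps are applied. *)
Lemma jacobian_comp (F : 'rV[K]_p -> 'rV[K]_q) (G : 'rV[K]_q -> 'rV[K]_r) x :
  differentiable F x -> differentiable G (F x) ->
  'J (G \o F) x = 'J F x *m 'J G (F x).
Proof.
move=> dF dG; apply/row_matrixP => i; rewrite !rowE mulmxA.
set v := delta_mx _ _; rewrite (mul_jacobian (G \o F)) (mul_jacobian F).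
rewrite (mul_jacobian G).
have E := diff_comp dF dG.
exact: (congr1 (fun f => f v) E).
Qed.

End JacobianComp.

Section Conjugation.
Context {R : realType}.
Implicit Types x y : R[i].

Lemma conjM x y : conjc (x * y) = conjc x * conjc y.
Proof. exact: rmorphM. Qed.

Lemma conjD x y : conjc (x + y) = conjc x + conjc y.
Proof. exact: rmorphD. Qed.

Lemma conjN x : conjc (- x) = - conjc x.
Proof. exact: rmorphN. Qed.

Lemma conjX x k : conjc (x ^+ k) = conjc x ^+ k.
Proof. exact: rmorphXn. Qed.

Lemma conj_sum (J : Type) (r : seq J) (F : J -> R[i]) :
  conjc (\sum_(j <- r) F j) = \sum_(j <- r) conjc (F j).
Proof. exact: rmorph_sum. Qed.

Lemma conj_prod (J : Type) (r : seq J) (F : J -> R[i]) :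
  conjc (\prod_(j <- r) F j) = \prod_(j <- r) conjc (F j).
Proof. exact: rmorph_prod. Qed.

Lemma conj_i : conjc ('i : R[i])%R = - 'i%R.
Proof. by rewrite -complexiE; apply/eqP; rewrite eq_complex /= oppr0 !eqxx. Qed.

Lemma conj_int (k : int) : conjc (k%:~R : R[i]) = k%:~R.
Proof. by rewrite -(rmorph_int (real_complex R)) conjc_real. Qed.

End Conjugation.

(** * Complex conjugation, periodicity and near-identity canonical maps *)

Section PhaseMaps.
Context {R : realType} {n : nat}.
Notation point := 'rV[R[i]]_(n + n).
Implicit Types (z w : point) (m : mindex n) (c : mindex n -> R[i]).

Definition conjv z : point := map_mx (@conjc R) z.

Lemma act_conjv z j : act (conjv z) j = conjc (act z j).
Proof. by rewrite !actE mxE. Qed.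

Lemma ang_conjv z j : ang (conjv z) j = conjc (ang z j).
Proof. by rewrite !angE mxE. Qed.

Lemma conjvK z : conjv (conjv z) = z.
Proof. by apply/rowP => j; rewrite !mxE conjcK. Qed.

Lemma dom_conjv a b z : dom a b z -> dom a b (conjv z).
Proof.
move=> /domP[h1 h2]; apply/domP; split=> j; first by rewrite act_conjv cabs_conj.
by rewrite ang_conjv; have := h2 j; case: (ang z j) => p q /=; rewrite normrN.
Qed.

Lemma real_point_conjv z : real_point z <-> conjv z = z.
Proof.
have E (x : R[i]) : conjc x = x <-> complex.Im x = 0.
  case: x => p q /=; split=> [[]|->]; last by rewrite oppr0.
  by move=> h; lra.
split=> [h|h j].
  apply/rowP => k; rewrite mxE; apply/E.
  by case: (split_ordP k) => j ->; have [] := h j; rewrite !(actE, angE).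
by rewrite -!E -act_conjv -ang_conjv h.
Qed.

(** The coefficients of the reflected function sending z to the conjugate of F(conj z). *)
Definition cstar c m : R[i] := conjc (c (m.1, - m.2)).

Lemma cstar_cabs c m : cabs (cstar c m) = cabs (c (m.1, - m.2)).
Proof. exact: cabs_conj. Qed.

Lemma klenN (k : {ffun 'I_n -> int}) : klen (- k) = klen k.
Proof. by rewrite /klen; apply: eq_bigr => j _; rewrite ffunE abszN. Qed.

Lemma bnd_cstar a b c (B : R) : bnd a b c B -> bnd a b (cstar c) B.
Proof.
have fi : injective (fun m : mindex n => (m.1, - m.2) : mindex n).
  by move=> [i k] [i' k'] /= [-> /oppr_inj ->].
move=> /(rbound_inj fi); apply: rbound_le => // m.
by rewrite cstar_cabs !wt.unlock /= klenN.
Qed.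

Lemma mono_conjv m z : mono m (conjv z) = conjc (mono (m.1, - m.2) z).
Proof.
rewrite !mono.unlock conjM conj_prod cexp_conj conjM conj_sum conj_i.
congr (_ * cexp _); first by apply: eq_bigr => j _; rewrite act_conjv conjX.
rewrite mulNr -mulrN; congr ('i * _); rewrite -sumrN; apply: eq_bigr => j _.
by rewrite ang_conjv conjM ffunE mulrNz conjN conj_int mulNr opprK.
Qed.

Lemma ev_cstar a b c (B : R) z : bnd a b c B -> dom a b z ->
  ev (cstar c) (conjv z) = conjc (ev c z).
Proof.
move=> hc hz; apply: has_sum_sum.
have h := has_sum_conj (has_ev hc hz).
have mK : cancel (fun m : mindex n => (m.1, - m.2) : mindex n) (fun m => (m.1, - m.2)).
  by move=> [i k] /=; rewrite opprK.
apply: eq_has_sum (has_sum_reindex mK mK h) => m.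
by rewrite mono_conjv /cstar conjM.
Qed.

Definition creal c := forall m, c (m.1, - m.2) = conjc (c m).

Lemma creal_cstar c : creal c -> cstar c = c.
Proof. by move=> h; apply/funext => m; rewrite /cstar h conjcK. Qed.

Lemma ev_creal a b c (B : R) z : creal c -> bnd a b c B -> dom a b z ->
  ev c (conjv z) = conjc (ev c z).
Proof. by move=> /creal_cstar {2}<- hc hz; rewrite -(ev_cstar hc hz). Qed.

Lemma creal_dang j c : creal c -> creal (dang j c).
Proof.
move=> h m; rewrite /dang h /= ffunE mulrNz !conjM conj_i conj_int.
by rewrite mulrN !mulNr.
Qed.

Lemma ev_periodic c z z' : same_point z z' -> ev c z' = ev c z.
Proof.
move=> [hact [k hang]]; apply: eq_sum => m; rewrite !mono.unlock; congr (_ * (_ * _)).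
  by apply: eq_bigr => j _; rewrite hact.
have -> : \sum_j (m.2 j)%:~R * ang z' j =
    \sum_j (m.2 j)%:~R * ang z j + (pi *+ 2 * (\sum_j m.2 j * k j)%:~R)%:C.
  rewrite rmorph_sum mulr_sumr rmorph_sum -big_split; apply: eq_bigr => j _.
  rewrite hang mulrDr; congr (_ + _).
  have -> : pi *+ 2 * (m.2 j * k j)%:~R = (m.2 j)%:~R * (pi *+ 2 * (k j)%:~R) :> R.
    by rewrite intrM; ring.
  by rewrite [RHS]rmorphM rmorph_int.
by rewrite mulrDr cexpD cexp_2pi mulr1.
Qed.

Lemma same_point_refl z : same_point z z.
Proof.
by split=> //; exists (fun=> 0) => j; rewrite mulr0z mulr0 addr0.
Qed.

Lemma same_point_trans z1 z2 z3 :
  same_point z1 z2 -> same_point z2 z3 -> same_point z1 z3.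
Proof.
move=> [a1 [k1 b1]] [a2 [k2 b2]]; split=> [j|]; first by rewrite a2 a1.
exists (fun j => k1 j + k2 j) => j.
by rewrite b2 b1 -addrA -rmorphD -mulrDr rmorphD.
Qed.

Variables (rho sigma : R).
Hypotheses (rho_gt0 : 0 < rho) (sigma_gt0 : 0 < sigma).

Definition D (t : R) : set point := dom (t * rho) (t * sigma).

Lemma D_le s t z : s <= t -> D s z -> D t z.
Proof. by move=> st; apply: dom_le; rewrite ler_wpM2r// ltW. Qed.

(* Canonical and moves points by at most [eta], in units of the domain sizes. *)
Definition near_identity (rp : Prop) (t eta : R) (Psi : point -> point) :=
  [/\ canonical_transformation (D t) Psi,
      forall s z, 0 < s -> s <= t -> D s z -> D (s + eta) (Psi z),
      forall s, 0 < s -> s + eta <= t -> covers (D (s + eta)) (D s) Psi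
    & rp -> forall z, D t z -> Psi (conjv z) = conjv (Psi z)].

Lemma canonical_comp (A B : set point) Phi Psi :
  canonical_transformation A Psi -> canonical_transformation B Phi ->
  (forall z, A z -> B (Psi z)) -> canonical_transformation A (Phi \o Psi).
Proof.
move=> [a1 a2 a3] [b1 b2 b3] AB; split=> [z hz|z z' hz hz'|z hz].
- by apply: differentiable_comp; [exact: a1|apply: b1; exact: AB].
- by rewrite /= b2; [exact: a2|exact: AB|exact: AB].
have -> : 'J (Phi \o Psi) z = 'J Psi z *m 'J Phi (Psi z).
  exact: jacobian_comp (a1 _ hz) (b1 _ (AB _ hz)).
rewrite trmx_mul; set P := 'J Psi z; set Q := 'J Phi (Psi z).
have bQ : Q *m symplectic_mx *m Q^T = symplectic_mx by apply: b3; exact: AB.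
have -> : P *m Q *m symplectic_mx *m (Q^T *m P^T) =
  P *m (Q *m symplectic_mx *m Q^T) *m P^T by rewrite !mulmxA.
by rewrite bQ; exact: a3.
Qed.

End PhaseMaps.

(** In the shear and in the lift the new angles depend on the old angles only, so the Jacobian has
    this triangular shape; the two hypotheses are what remains of symplecticity. *)
Lemma block_symplectic (K : comNzRingType) (n : nat) (A X D : 'M[K]_n) :
  A *m D^T = 1%:M -> (X *m D^T)^T = X *m D^T ->
  block_mx A 0 X D *m block_mx 0 1%:M (- 1%:M) 0 *m (block_mx A 0 X D)^T =
    block_mx 0 1%:M (- 1%:M) 0.
Proof.
move=> AD XD; rewrite tr_block_mx trmx0 !mulmx_block.
rewrite !(mulmx0, mul0mx, mulmx1, mul1mx, addr0, add0r, mulmxN, mulNmx).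
have DA : D *m A^T = 1%:M by rewrite -[D]trmxK -trmx_mul AD trmx1.
by rewrite AD DA -[D *m X^T]trmxK trmx_mul trmxK XD addNr.
Qed.

(** * The shear of the actions by a closed one-form *)

Section Shear.
Context {R : realType} {n : nat}.
Notation point := 'rV[R[i]]_(n + n).
Implicit Types (z w : point) (m : mindex n).
Variables (rho sigma : R).
Hypotheses (rho_gt0 : 0 < rho) (sigma_gt0 : 0 < sigma).
Local Notation D := (@D R n rho sigma).

Variables (cc : 'I_n -> mindex n -> R[i]) (t eta delta B : R) (rp : Prop).
Hypotheses (t_gt0 : 0 < t) (eta_gt0 : 0 < eta) (delta_gt0 : 0 < delta).
Hypotheses (cc_ang : forall j, ang_only (cc j))
  (cc_bnd : forall j, bnd rho (t * sigma + delta) (cc j) B)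
  (B_le : B <= eta * rho)
  (cc_closed : forall j l, dang l (cc j) = dang j (cc l))
  (cc_real : rp -> forall j, creal (cc j)).

(** Canonical because the form sum c_j dq_j is closed, which [cc_closed] states on coefficients.
    Closed rather than exact: the constant zeta is not the gradient of a periodic function. *)
Definition shear z : point :=
  row_mx (\row_j (act z j + ev (cc j) z)) (rsubmx z).

Lemma act_row_mx (x y : 'rV[R[i]]_n) j : act (row_mx x y) j = x 0 j.
Proof. by rewrite actE row_mxEl. Qed.

Lemma ang_row_mx (x y : 'rV[R[i]]_n) j : ang (row_mx x y) j = y 0 j.
Proof. by rewrite angE row_mxEr. Qed.

Lemma act_shear z j : act (shear z) j = act z j + ev (cc j) z.
Proof. by rewrite act_row_mx mxE. Qed.

Lemma ang_shear z j : ang (shear z) j = ang z j.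
Proof. by rewrite ang_row_mx. Qed.

Lemma point_eq z w : (forall j, act z j = act w j) -> (forall j, ang z j = ang w j) ->
  z = w.
Proof.
move=> h1 h2; apply/rowP => k; case: (split_ordP k) => j ->.
  by rewrite -!actE.
by rewrite -!angE.
Qed.

Lemma D_strip s z : D s z -> strip (s * sigma) z.
Proof. by case/domP. Qed.

Let cc_bnd0 j : bnd rho (t * sigma) (cc j) B.
Proof. by apply: bnd_le (cc_bnd j) => //; [exact: ltW|rewrite lerDl ltW]. Qed.

Lemma cc_le s z j : s <= t -> D s z -> cabs (ev (cc j) z) <= B.
Proof.
(* The value depends on the angles only; with zero actions the point lies in the domain where the
   norm bound applies. *)
move=> st hz; pose z0 : point := row_mx 0 (rsubmx z).
rewrite (ev_eq_ang (z' := z0))//; last by move=> l; rewrite ang_row_mx.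
apply: ev_le (cc_bnd0 j) _; apply/domP; split=> l.
  by rewrite act_row_mx mxE cabs0.
rewrite ang_row_mx; apply: lt_le_trans (D_strip hz l) _.
by rewrite ler_wpM2r// ltW.
Qed.

Lemma shear_quad z : D t z ->
  quad_diff shear (block_mx 1%:M 0 (\matrix_(l, j) ev (dang l (cc j)) z) 1%:M) z.
Proof.
move=> hz; exists (64 * (B / delta ^+ 2)), (delta / 2).
split=> [|h e e0 ed he k]; first by rewrite divr_gt0.
have hk : forall j, cabs (ang h j) <= e by move=> j; rewrite angE.
have B0 : 0 <= 64 * (B / delta ^+ 2) * e ^+ 2.
  rewrite mulr_ge0 ?exprn_ge0// mulr_ge0// divr_ge0 ?exprn_ge0// ?(ltW delta_gt0)//.
  by case: (split_ordP k) => j _; exact: bnd_ge0 (cc_bnd0 j).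
have sub3 (X Y Z : point) l : (X - Y - Z) 0 l = X 0 l - Y 0 l - Z 0 l by rewrite !mxE.
rewrite sub3 -[h in h *m _]hsubmxK mul_row_block !mulmx1 mulmx0 add0r.
case: (split_ordP k) => j ->; last first.
  rewrite [X in cabs (_ - X)]row_mxEr -!angE !ang_shear angD /ang.
  by rewrite addrAC addrK subrr cabs0.
rewrite [X in cabs (_ - X)]row_mxEl -!actE !act_shear actD.
have -> : (lsubmx h + rsubmx h *m \matrix_(l, j0) ev (dang l (cc j0)) z) 0 j =
    act h j + \sum_l ang h l * ev (dang l (cc j)) z.
  rewrite mxE [X in _ + X]mxE /act; congr (_ + _); apply: eq_bigr => l _.
  by rewrite [X in _ * X]mxE.
have := ev_quad delta_gt0 rho_gt0 (@cc_ang j) (cc_bnd j) (D_strip hz) e0 ed hk.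
congr (is_true (cabs _ <= _)); ring.
Qed.

Lemma shear_canonical : canonical_transformation (D t) shear.
Proof.
split=> [z hz|z z' hz hz'|z hz].
- by have [] := quad_diff_differentiable (shear_quad hz).
- split=> [[ha [k hk]]|hs].
    have hang : forall j, ang z' j = ang z j + (pi *+ 2 * (k j)%:~R)%:C.
      by move=> j; rewrite -(ang_shear z') hk ang_shear.
    split; last by exists k.
    move=> j; have := ha j; rewrite !act_shear.
    have -> : ev (cc j) z' = ev (cc j) z.
      pose w : point := row_mx (lsubmx z') (rsubmx z).
      rewrite (@ev_periodic _ _ (cc j) w z'); last first.
        split=> [l|]; first by rewrite act_row_mx.
        by exists k => l; rewrite ang_row_mx hang.
      by apply: ev_eq_ang => // l; rewrite ang_row_mx.
    exact: addIr.
  have [ha [k hk]] := hs; split=> [j|]; last by exists k => j; rewrite !ang_shear.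
  by rewrite !act_shear (ev_periodic _ hs) ha.
- have [_ ->] := quad_diff_differentiable (shear_quad hz).
  (* Closedness of the form is the symmetry of the lower left block. *)
  set X := \matrix_(_, _) _; have XT : X^T = X.
    by apply/matrixP => i j; rewrite !mxE cc_closed.
  by apply: block_symplectic; rewrite trmx1 ?mulmx1.
Qed.

Lemma shear_near_identity : near_identity rho sigma rp t eta shear.
Proof.
split; first exact: shear_canonical.
- move=> s z s0 st hz; have [h1 h2] := (domP _ _ z).1 hz; apply/domP; split=> j.
    rewrite act_shear mulrDl; apply: le_lt_trans (cabsD _ _) _.
    by apply: ltr_leD (h1 j) _; apply: le_trans (cc_le j st hz) B_le.
  by rewrite ang_shear mulrDl ltr_wpDr// ltW// mulr_gt0.
- move=> s s0 st y hy; have sT : s <= t by rewrite (le_trans _ st)// lerDl ltW.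
  pose z : point := row_mx (\row_j (act y j - ev (cc j) y)) (rsubmx y).
  have za j : ang z j = ang y j by rewrite ang_row_mx.
  have zy : shear z = y.
    apply: point_eq => j; last by rewrite ang_shear za.
    by rewrite act_shear act_row_mx mxE (ev_eq_ang (z' := y))// subrK.
  exists z; last by rewrite zy; exact: same_point_refl.
  have [h1 h2] := (domP _ _ y).1 hy; apply/domP; split=> j.
    rewrite act_row_mx mxE mulrDl; apply: le_lt_trans (cabsB _ _) _.
    by apply: ltr_leD (h1 j) _; apply: le_trans (cc_le j sT hy) B_le.
  by rewrite za mulrDl ltr_wpDr// ltW// mulr_gt0.
- move=> hr z hz; apply: point_eq => j.
    rewrite act_conjv !act_shear act_conjv conjD; congr (_ + _).
    pose z0 : point := row_mx 0 (rsubmx z).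
    have za l : ang z l = ang z0 l by rewrite ang_row_mx.
    rewrite (ev_eq_ang (z' := conjv z0))//; last by move=> l; rewrite !ang_conjv za.
    rewrite (ev_eq_ang (z := z) (z' := z0))//.
    apply: (ev_creal _ (cc_bnd0 j)); first exact: cc_real.
    apply/domP; split=> l; first by rewrite act_row_mx mxE cabs0.
    by rewrite -za; exact: (D_strip hz).
  by rewrite ang_conjv !ang_shear ang_conjv.
Qed.

End Shear.

Section EntrywiseBounds.
Context {R : realType}.

Definition mxle (p q : nat) (A : 'M[R[i]]_(p, q)) (x : R) := forall i j, cabs (A i j) <= x.

Lemma mxleM (p q r : nat) (A : 'M[R[i]]_(p, q)) (B : 'M[R[i]]_(q, r)) x y :
  0 <= x -> mxle A x -> mxle B y -> mxle (A *m B) (q%:R * (x * y)).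
Proof.
move=> x0 hA hB i j; rewrite mxE; apply: le_trans (cabs_sum _ _ _) _.
apply: (@le_trans _ _ (\sum_(k < q) x * y)).
  by apply: ler_sum => k _; rewrite cabsM ler_pM ?cabs_ge0.
by rewrite sumr_const card_ord mulr_natl.
Qed.

Lemma mxleD (p q : nat) (A B : 'M[R[i]]_(p, q)) x y :
  mxle A x -> mxle B y -> mxle (A + B) (x + y).
Proof.
by move=> hA hB i j; rewrite mxE; apply: le_trans (cabsD _ _) (lerD (hA _ _) (hB _ _)).
Qed.

Lemma mxleN (p q : nat) (A : 'M[R[i]]_(p, q)) x : mxle A x -> mxle (- A) x.
Proof. by move=> hA i j; rewrite mxE cabsN. Qed.

(* Second-order expansion of (P + hP) (1 + B')^-1, from the resolvent identity
   A' - A = - A' (B' - B) A. *)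
Lemma resolvent_expand (p q : nat) (P hP : 'M[R[i]]_(p, q)) (A A' B B' L : 'M[R[i]]_q) :
  (1%:M + B) *m A = 1%:M -> A' *m (1%:M + B') = 1%:M ->
  (P + hP) *m A' - P *m A - (hP *m A - P *m A *m L *m A) =
  - (P *m A *m (B' - B - L) *m A)
  + (P *m A' *m (B' - B) *m A *m (B' - B) *m A) - hP *m A' *m (B' - B) *m A.
Proof.
move=> hA hA'; set dB := B' - B.
have AE : A' *m dB *m A = A - A'.
  have -> : dB = (1%:M + B') - (1%:M + B) by rewrite /dB opprD addrACA subrr add0r.
  by rewrite mulmxBr mulmxBl hA' mul1mx -mulmxA hA mulmx1.
clearbody dB.
have E (Y : 'M[R[i]]_(p, q)) : Y *m A' *m dB *m A = Y *m A - Y *m A'.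
  by have := congr1 (mulmx Y) AE; rewrite !mulmxA mulmxBr.
rewrite (E hP) (E P) !mulmxBl !mulmxBr !mulmxBl (E P) mulmxDl.
set x1 := P *m A'; set x2 := hP *m A'; set x3 := P *m A; set x4 := hP *m A.
set x5 := x3 *m dB *m A; set x6 := x3 *m L *m A.
rewrite !opprB !addrA.
apply/matrixP => i j; rewrite !mxE; ring.
Qed.

End EntrywiseBounds.

(** * Inverses of matrices near the identity, and preimages of angle maps *)

Section Neumann.
Context {R : realType} {n : nat}.
Notation point := 'rV[R[i]]_(n + n).
Variables (a1 b mu : R) (M : point -> 'M[R[i]]_n).
Hypotheses (a1_gt0 : 0 < a1) (b_gt0 : 0 < b) (mu_ge0 : 0 <= mu)
  (mu_small : n%:R * mu <= 1 / 2)
  (M_rep : forall i j, frep a1 b (fun z => M z i j) (fun=> mu)).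

(** [X k] is (-M)^(k+1), so 1 plus the sum of all [X k] is the inverse of 1 + M. Each entry is
    represented with norm at most mu (n mu)^k, a geometric series of ratio at most 1/2; hence the
    total 2 mu. *)
Let X (k : nat) z : 'M[R[i]]_n := iter k (fun Y => - (Y *m M z)) (- M z).

Let q := n%:R * mu.

Let X_rep k i j : frep a1 b (fun z => X k z i j) (fun=> mu * q ^+ k).
Proof.
elim: k i j => [|k IH] i j.
  apply: rep_ext (rep_le _ (repN a1_gt0 (M_rep i j))) => [z _|a _ _]; first by rewrite /X /= mxE.
  by rewrite expr0 mulr1.
apply: rep_ext (rep_le _ (repN a1_gt0 (rep_sum a1_gt0 (index_enum 'I_n)
  (fun l => repM a1_gt0 b_gt0 (IH i l) (M_rep l j))))) => [z _|a _ _].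
  by rewrite /X /= !mxE.
rewrite sumr_const card_ord -(mulr_natl _ n) exprS /q.
by rewrite le_eqVlt; apply/orP; left; apply/eqP; ring.
Qed.

Let Y z : 'M[R[i]]_n := \matrix_(i, j) sum (fun k => X k z i j).

Let q_sum : rbound (fun k => mu * q ^+ k) (2 * mu).
Proof.
have q0 : 0 <= q by rewrite mulr_ge0.
have q1 : q < 1 by rewrite /q; apply: le_lt_trans mu_small _; lra.
apply: rbound_le (rboundZ mu_ge0 (geometric_bound q0 q1)) => //.
rewrite mulrC ler_wpM2r// invf_ple ?posrE ?subr_gt0//.
by rewrite -[2^-1]div1r lerBrDr -lerBrDl (le_trans mu_small)//; lra.
Qed.

Let X_absum z i j : dom a1 b z -> absum (fun k => X k z i j) (2 * mu).
Proof.
move=> hz; apply: rbound_le q_sum => // k.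
by refine (rep_bound a1_gt0 (X_rep k i j) hz).
Qed.

Let Y_rep i j : frep a1 b (fun z => Y z i j) (fun=> 2 * mu).
Proof.
have [|h1 _] := rep_family a1_gt0 (B := fun=> 2 * mu) (fun k => X_rep k i j).
  by move=> a _ _; exact: q_sum.
by apply: rep_ext h1 => z _; rewrite mxE.
Qed.

Let YE z : dom a1 b z -> Y z = - M z - Y z *m M z.
Proof.
move=> hz; apply/matrixP => i j.
have hX i' j' : has_sum (fun k => X k z i' j') (Y z i' j').
  by rewrite mxE; exact: absum_has_sum (X_absum i' j' hz).
have h1 := has_sum_shift (X_absum i j hz) (hX i j).
have h2 := has_sum_big (r := index_enum 'I_n)
  (fun l => has_sumZ (c := M z l j) (hX i l)).
have h3 : has_sum (fun k => X k.+1 z i j) (- \sum_l M z l j * Y z i l).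
  apply: eq_has_sum (has_sumN h2) => k; rewrite /X /= !mxE; congr (- _).
  by apply: eq_bigr => l _; rewrite mulrC.
have /eqP := has_sum_unique h1 h3; rewrite subr_eq => /eqP ->.
rewrite addrC [X 0%N z]/X [iter 0 _ _]/= !mxE; congr (_ - _).
by apply: eq_bigr => l _; rewrite mulrC [Y z i l]mxE.
Qed.

Let YM z : dom a1 b z -> (1%:M + Y z) *m (1%:M + M z) = 1%:M.
Proof.
move=> hz; rewrite mulmxDr mulmx1 mulmxDl mul1mx {1}(YE hz).
by rewrite addrA addrA addrAC subrK -addrA addNr addr0.
Qed.

Lemma neumann_unit z : dom a1 b z -> 1%:M + M z \in unitmx.
Proof. by move=> /YM/mulmx1_unit[]. Qed.

Lemma neumann_rep i j :
  frep a1 b (fun z => (invmx (1%:M + M z) - 1%:M) i j) (fun=> 2 * mu).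
Proof.
apply: rep_ext (Y_rep i j) => z hz.
have -> : invmx (1%:M + M z) = 1%:M + Y z.
  have := congr1 (mulmx^~ (invmx (1%:M + M z))) (YM hz).
  by rewrite mul1mx -mulmxA mulmxV ?mulmx1//; exact: neumann_unit.
by rewrite addrC addKr.
Qed.

End Neumann.

Section FixedPoint.
Context {R : realType} {n : nat}.
Notation point := 'rV[R[i]]_(n + n).
Variables (U : 'I_n -> 'rV[R[i]]_n -> R[i]) (b beta : R) (y : 'rV[R[i]]_n).
Hypotheses (beta_ge0 : 0 <= beta)
  (y_strip : forall j, `|complex.Im (y 0 j)| + beta < b)
  (U_le : forall j (q : 'rV[R[i]]_n), (forall j, `|complex.Im (q 0 j)| < b) ->
    cabs (U j q) <= beta)
  (U_lip : forall j (q q' : 'rV[R[i]]_n) e, (forall j, `|complex.Im (q 0 j)| < b) ->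
    (forall j, `|complex.Im (q' 0 j)| < b) -> 0 <= e ->
    (forall j, cabs (q 0 j - q' 0 j) <= e) -> cabs (U j q - U j q') <= e / 2).

(** Picard iteration for q = y - U(q), a contraction of ratio 1/2 in the maximum norm. *)
Let qs (k : nat) : 'rV[R[i]]_n := iter k (fun q => \row_j (y 0 j - U j q)) y.

Let qsS k j : qs k.+1 0 j = y 0 j - U j (qs k).
Proof. by rewrite /qs /= mxE. Qed.

Let ImB (v w : R[i]) : `|complex.Im (v - w)| <= `|complex.Im v| + cabs w.
Proof.
have -> : complex.Im (v - w) = complex.Im v - complex.Im w by case: v w => ? ? [].
by apply: le_trans (ler_normB _ _) _; rewrite lerD2l cabs_Im.
Qed.

Let qs_im k j : `|complex.Im (qs k 0 j)| <= `|complex.Im (y 0 j)| + beta.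
Proof.
elim: k j => [|k IH] j; first by rewrite /qs /= lerDl.
rewrite qsS; apply: le_trans (ImB _ _) _; rewrite lerD2l.
by apply: U_le => l; apply: le_lt_trans (IH l) (y_strip l).
Qed.

Let qs_strip k j : `|complex.Im (qs k 0 j)| < b.
Proof. exact: le_lt_trans (qs_im k j) (y_strip j). Qed.

Let step_le k j : cabs (qs k.+1 0 j - qs k 0 j) <= beta * (1 / 2) ^+ k.
Proof.
elim: k j => [|k IH] j.
  rewrite qsS expr0 mulr1 -[qs 0%N]/y addrC addKr cabsN.
  by apply: U_le; exact: qs_strip 0%N.
have -> : qs k.+2 0 j - qs k.+1 0 j = U j (qs k) - U j (qs k.+1) by rewrite !qsS; ring.
have -> : beta * (1 / 2) ^+ k.+1 = beta * (1 / 2) ^+ k / 2 by rewrite exprS; lra.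
apply: U_lip => [l|l||l]; [exact: qs_strip|exact: qs_strip| |by rewrite cabsC].
by rewrite mulr_ge0 ?exprn_ge0.
Qed.

Let x j k := qs k.+1 0 j - qs k 0 j.

Let x_absum j : absum (x j) (beta * (1 - 1 / 2)^-1).
Proof.
have h0 : 0 <= 1 / 2 :> R by lra.
have h1 : 1 / 2 < 1 :> R by lra.
by apply: rbound_le (rboundZ beta_ge0 (geometric_bound h0 h1)) => // k; exact: step_le.
Qed.

Let s : 'rV[R[i]]_n := \row_j (y 0 j + sum (x j)).

Let s_approx e : 0 < e -> exists N, forall k, (N <= k)%N ->
  forall j, cabs (s 0 j - qs k 0 j) <= e.
Proof.
move=> e0.
have /choice[N hN] : forall j, exists N, forall k, (N <= k)%N ->
    cabs (sum (x j) - \sum_(0 <= i < k) x j i) <= e.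
  by move=> j; exact: has_sum_series (absum_has_sum (x_absum j)) _ e0.
exists (\max_j N j)%N => k hk j.
have -> : s 0 j - qs k 0 j = sum (x j) - \sum_(0 <= i < k) x j i.
  rewrite mxE /x (telescope_sumr (fun i => qs i 0 j))// /qs /=.
  by rewrite opprB [y 0 j + _]addrC -addrA.
by apply: hN; apply: leq_trans hk; exact: leq_bigmax.
Qed.

(** Supplies the angles of preimages under the lift. The limit inherits only the non-strict bound on
    imaginary parts, which [y_strip] turns into membership in the open strip. *)
Lemma fixed_point : exists q : 'rV[R[i]]_n,
  (forall j, `|complex.Im (q 0 j)| <= `|complex.Im (y 0 j)| + beta) /\
  (forall j, q 0 j + U j q = y 0 j).
Proof.
have s_im j : `|complex.Im (s 0 j)| <= `|complex.Im (y 0 j)| + beta.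
  apply: le_eps => e e0; have [N /(_ N (leqnn N) j) hN] := s_approx e0.
  have := ImB (qs N 0 j) (qs N 0 j - s 0 j); rewrite opprB addrC subrK => h.
  by apply: le_trans h _; rewrite cabsC lerD.
exists s; split=> // j; apply/eqP; rewrite -subr_eq0; apply/eqP/cabs_small => e e0.
have e2 : 0 < e / 2 by lra.
have [N hN] := s_approx e2.
have h1 := hN N (leqnn N); have h2 := hN N.+1 (leqnSn N) j.
have h3 : cabs (U j s - U j (qs N)) <= e / 2 / 2.
  apply: U_lip => // [l|]; last exact: ltW.
  exact: le_lt_trans (s_im l) (y_strip l).
have -> : s 0 j + U j s - y 0 j = (s 0 j - qs N.+1 0 j) + (U j s - U j (qs N)).
  by rewrite qsS; ring.
by apply: le_trans (cabsD _ _) _; lra.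
Qed.

End FixedPoint.

Lemma map_mul_invmx1 (K : fieldType) (f : {rmorphism K -> K}) (n : nat)
    (P : 'rV[K]_n) (M : 'M[K]_n) :
  map_mx f (P *m invmx (1%:M + M)) = map_mx f P *m invmx (1%:M + map_mx f M).
Proof. by rewrite map_mxM map_invmx map_mxD map_scalar_mx rmorph1. Qed.

(** * The cotangent lift of a near-identity map of the torus *)

Section Lift.
Context {R : realType} {n : nat}.
Notation point := 'rV[R[i]]_(n + n).
Implicit Types (z w : point) (m : mindex n).
Variables (rho sigma : R).
Hypotheses (rho_gt0 : 0 < rho) (sigma_gt0 : 0 < sigma).
Local Notation D := (@D R n rho sigma).

Variables (uc : 'I_n -> mindex n -> R[i]) (t eta delta B : R) (rp : Prop).
Local Notation mu := (B / (delta / 2)).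
Hypotheses (t_gt0 : 0 < t) (t_le1 : t <= 1) (eta_gt0 : 0 < eta) (delta_gt0 : 0 < delta).
Hypotheses (B_ge0 : 0 <= B) (uc_ang : forall j, ang_only (uc j))
  (uc_bnd : forall j, bnd rho (t * sigma + delta) (uc j) B)
  (B_le : B <= eta * sigma) (mu_small : n%:R * mu <= 1 / 2)
  (mu_eta : 2 * (n%:R * mu) <= eta) (B_lip : 5 * (B / delta) <= 1 / 2)
  (uc_real : rp -> forall j, creal (uc j)).

Local Notation b1 := (t * sigma + delta / 2).

Definition lift_mx z : 'M[R[i]]_n := \matrix_(i, k) ev (dang k (uc i)) z.
Definition lift_inv z : 'M[R[i]]_n := invmx (1%:M + lift_mx z).
(** Invariance of the one-form sum p_j dq_j under Q = q + u(q) forces P (1 + Du) = p, and preserving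
    this form makes the map canonical. *)
Definition cotangent_lift z : point :=
  row_mx (lsubmx z *m lift_inv z) (\row_j (ang z j + ev (uc j) z)).

Let b1_gt0 : 0 < b1.
Proof. by rewrite addr_gt0 ?mulr_gt0// divr_gt0. Qed.

Let d2_gt0 : 0 < delta / 2.
Proof. by rewrite divr_gt0. Qed.

Let mu_ge0 : 0 <= mu.
Proof. by rewrite divr_ge0// ltW. Qed.

Let uc_bnd0 j : bnd rho (t * sigma) (uc j) B.
Proof. by apply: bnd_le (uc_bnd j) => //; [exact: ltW|rewrite lerDl ltW]. Qed.

(** Half of [delta] is spent here on the first derivatives of u; the other half goes to the second
    derivatives, which enter the Jacobian. *)
Let duc_bnd k i : bnd rho b1 (dang k (uc i)) mu.
Proof.
apply: bnd_dang => //; first exact: ltW.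
by rewrite -addrA -splitr.
Qed.

Lemma lift_mx_eq_ang z w : (forall j, ang z j = ang w j) -> lift_mx z = lift_mx w.
Proof.
move=> h; apply/matrixP => i k; rewrite !mxE; apply: ev_eq_ang => //.
exact: ang_only_dang.
Qed.

Lemma lift_inv_eq_ang z w : (forall j, ang z j = ang w j) -> lift_inv z = lift_inv w.
Proof. by move=> h; rewrite /lift_inv (lift_mx_eq_ang h). Qed.

Let ang0 z : point := row_mx 0 (rsubmx z).

Let ang_ang0 z j : ang (ang0 z) j = ang z j.
Proof. by rewrite ang_row_mx. Qed.

Let dom_ang0 b z : strip b z -> dom rho b (ang0 z).
Proof.
move=> hz; apply/domP; split=> j; last by rewrite ang_ang0; exact: hz.
by rewrite act_row_mx mxE cabs0.
Qed.

Let mx_rep i k : frep rho b1 (fun z => lift_mx z i k) (fun=> mu).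
Proof.
exists (dang k (uc i)); split=> [a a0 aa|z _]; last by rewrite mxE.
by apply: bnd_le (duc_bnd k i) => //; exact: ltW.
Qed.

Lemma lift_unit z : strip b1 z -> 1%:M + lift_mx z \in unitmx.
Proof.
move=> hz; rewrite -(lift_mx_eq_ang (ang_ang0 z)).
exact: (neumann_unit rho_gt0 b1_gt0 mu_ge0 mu_small mx_rep (dom_ang0 hz)).
Qed.

Lemma lift_inv_rep i k :
  frep rho b1 (fun z => (lift_inv z - 1%:M) i k) (fun=> 2 * mu).
Proof. exact: (neumann_rep rho_gt0 b1_gt0 mu_ge0 mu_small mx_rep). Qed.

Lemma lift_inv_sub1 z : strip b1 z -> mxle (lift_inv z - 1%:M) (2 * mu).
Proof.
move=> hz i k; rewrite -(lift_inv_eq_ang (ang_ang0 z)).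
by refine (rep_bound rho_gt0 (lift_inv_rep i k) (dom_ang0 hz)).
Qed.

Let mu_half (i : 'I_n) : mu <= 1 / 2.
Proof.
apply: le_trans mu_small; rewrite -[leLHS]mul1r ler_wpM2r// ler1n.
by case: n i => [[]|].
Qed.

Lemma lift_inv_le z : strip b1 z -> mxle (lift_inv z) 2.
Proof.
move=> hz i k; have := mxleD (lift_inv_sub1 hz) (_ : mxle 1%:M 1).
rewrite subrK => h; apply: le_trans (h _ i k) _.
  by move=> i' k'; rewrite mxE; case: eqP; rewrite ?cabs1 ?cabs0.
by have := mu_half i; lra.
Qed.

Let strip_b1 s z : s <= t -> D s z -> strip b1 z.
Proof.
move=> st /D_strip hz j; apply: lt_le_trans (hz j) _.
by apply: le_trans (_ : t * sigma <= _); [rewrite ler_wpM2r// ltW|rewrite lerDl ltW].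
Qed.

Let strip_t s z : s <= t -> D s z -> strip (t * sigma) z.
Proof.
move=> st /D_strip hz j; apply: lt_le_trans (hz j) _.
by rewrite ler_wpM2r// ltW.
Qed.

Lemma uc_le z j : strip (t * sigma) z -> cabs (ev (uc j) z) <= B.
Proof.
move=> hz; rewrite (ev_eq_ang (z' := ang0 z))//.
exact: ev_le (uc_bnd0 j) (dom_ang0 hz).
Qed.

Lemma uc_lip z w j e : strip (t * sigma) z -> strip (t * sigma) w -> 0 <= e ->
  (forall l, cabs (ang z l - ang w l) <= e) ->
  cabs (ev (uc j) z - ev (uc j) w) <= e / 2.
Proof.
move=> hz hw e0 he.
apply: le_trans (ev_lip delta_gt0 rho_gt0 (@uc_ang j) (uc_bnd j) hz hw e0 he) _.
by rewrite [leRHS]mulrC ler_wpM2r//; move: B_lip; rewrite div1r.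
Qed.

Lemma act_lift z j : act (cotangent_lift z) j = (lsubmx z *m lift_inv z) 0 j.
Proof. by rewrite act_row_mx. Qed.

Lemma ang_lift z j : ang (cotangent_lift z) j = ang z j + ev (uc j) z.
Proof. by rewrite ang_row_mx mxE. Qed.

Definition lift_dmx l z : 'M[R[i]]_n := \matrix_(i, k) ev (dang l (dang k (uc i))) z.

(** The lower left block comes from d_l A = - A (d_l M) A for A = (1 + M)^-1. *)
Definition lift_jac z : 'M[R[i]]_(n + n) :=
  block_mx (lift_inv z) 0
    (\matrix_(l, j) (- (lsubmx z *m lift_inv z *m lift_dmx l z *m lift_inv z)) 0 j)
    (1%:M + lift_mx z)^T.

Let dduc_bnd l k i : bnd rho (t * sigma) (dang l (dang k (uc i))) (mu / (delta / 2)).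
Proof. by apply: bnd_dang; [|exact: ltW|exact: duc_bnd]. Qed.

Let C2 := 64 * (mu / (delta / 2) ^+ 2).
Let C1 := n%:R * (mu / (delta / 2)) + C2 * (delta / 2).

Let C2_ge0 : 0 <= C2.
Proof. by rewrite mulr_ge0// divr_ge0 ?exprn_ge0// ltW. Qed.

Let C1_ge0 : 0 <= C1.
Proof.
have dg : 0 <= delta / 2 by exact: ltW.
have h1 : 0 <= n%:R * (mu / (delta / 2)) by apply: mulr_ge0 => //; exact: divr_ge0.
have h2 : 0 <= C2 * (delta / 2) by apply: mulr_ge0.
exact: addr_ge0.
Qed.

Lemma lift_mx_quad z h e : strip (t * sigma) z -> 0 <= e -> e <= delta / 2 / 2 ->
  (forall j, cabs (ang h j) <= e) ->
  mxle (lift_mx (z + h) - lift_mx z - \sum_l ang h l *: lift_dmx l z) (C2 * e ^+ 2).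
Proof.
move=> hz e0 ed he i k.
have := ev_quad d2_gt0 rho_gt0 (@ang_only_dang _ _ k _ (@uc_ang i)) (duc_bnd k i) hz e0 ed he.
congr (is_true (cabs _ <= _)).
have sub3 (X Y Z : 'M[R[i]]_n) : (X - Y - Z) i k = X i k - Y i k - Z i k by rewrite !mxE.
rewrite sub3 summxE; congr (_ - _ - _); [by rewrite mxE|by rewrite mxE|].
by apply: eq_bigr => l _; rewrite !mxE.
Qed.

Lemma lift_mx_lip z h e : strip (t * sigma) z -> 0 <= e -> e <= delta / 2 / 2 ->
  (forall j, cabs (ang h j) <= e) -> mxle (lift_mx (z + h) - lift_mx z) (C1 * e).
Proof.
move=> hz e0 ed he.
have h1 := lift_mx_quad hz e0 ed he.
set L := \sum_l _ in h1.
have h2 : mxle L (n%:R * (mu / (delta / 2)) * e).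
  move=> i k; rewrite /L summxE; apply: le_trans (cabs_sum _ _ _) _.
  rewrite -mulrA mulr_natl -[X in _ *+ X]card_ord -sumr_const; apply: ler_sum => l _.
  rewrite mxE cabsM mulrC ler_pM ?cabs_ge0// mxE.
  rewrite (ev_eq_ang (z' := ang0 z))//; last by do 2!apply: ang_only_dang.
  exact: ev_le (dduc_bnd l k i) (dom_ang0 hz).
have := mxleD h1 h2; rewrite subrK => h12 i k; apply: le_trans (h12 i k) _.
have -> : C1 * e = C2 * (delta / 2) * e + n%:R * (mu / (delta / 2)) * e.
  by rewrite /C1; ring.
rewrite lerD2r (_ : C2 * e ^+ 2 = C2 * e * e); last by ring.
apply: ler_wpM2r => //; apply: ler_wpM2l => //.
by apply: le_trans ed _; rewrite ler_piMr ?(ltW d2_gt0)//; lra.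
Qed.

Lemma lift_quad z : D t z -> quad_diff cotangent_lift (lift_jac z) z.
Proof.
move=> hz; have hst := strip_t (lexx t) hz.
pose pmax := \sum_j cabs (act z j); have p0 : 0 <= pmax.
  by apply: sumr_ge0 => j _; exact: cabs_ge0.
have hP : mxle (lsubmx z) pmax.
  move=> i j; rewrite (ord1 i) -[lsubmx z 0 j]/(act z j) /pmax (bigD1 j)//= lerDl.
  by apply: sumr_ge0 => l _; exact: cabs_ge0.
pose nn : R := n%:R; have nn0 : 0 <= nn by [].
(* [K1], [K2] and [K3] bound the three terms of [resolvent_expand] entry by entry; [K4] belongs to
   the angle components. *)
pose K1 := nn * (nn * (nn * (pmax * 2) * C2) * 2).
pose K2 := nn * (nn * (nn * (nn * (nn * (pmax * 2) * C1) * 2) * C1) * 2).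
pose K3 := nn * (nn * (nn * (1 * 2) * C1) * 2).
pose K4 := 64 * (B / delta ^+ 2).
have K10 : 0 <= K1 by do !apply: mulr_ge0 => //.
have K20 : 0 <= K2 by do !apply: mulr_ge0 => //.
have K30 : 0 <= K3 by do !apply: mulr_ge0 => //.
have K40 : 0 <= K4 by rewrite mulr_ge0// divr_ge0 ?exprn_ge0// ltW.
exists (K1 + K2 + K3 + K4), (delta / 2 / 2).
split=> [|h e e0 ed he k]; first by rewrite divr_gt0.
have hk : forall j, cabs (ang h j) <= e by move=> j; rewrite angE.
have sub3 (X Y Z : point) l : (X - Y - Z) 0 l = X 0 l - Y 0 l - Z 0 l by rewrite !mxE.
have e20 : 0 <= e ^+ 2 by rewrite exprn_ge0.
rewrite sub3 /lift_jac -[h in h *m _]hsubmxK mul_row_block mulmx0 add0r.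
case: (split_ordP k) => j ->; last first.
  rewrite [X in cabs (_ - X)]row_mxEr -!angE !ang_lift angD.
  have -> : (rsubmx h *m (1%:M + lift_mx z)^T) 0 j =
      ang h j + \sum_l ang h l * ev (dang l (uc j)) z.
    rewrite linearD /= trmx1 mulmxDr mulmx1 mxE [X in _ + X]mxE /ang; congr (_ + _).
    by apply: eq_bigr => l _; rewrite !mxE.
  apply: (@le_trans _ _ (K4 * e ^+ 2)); last by rewrite ler_wpM2r// lerDr !addr_ge0.
  have ed2 : e <= delta / 2.
    by apply: le_trans ed _; rewrite ler_piMr ?(ltW d2_gt0)//; lra.
  have := ev_quad delta_gt0 rho_gt0 (@uc_ang j) (uc_bnd j) hst e0 ed2 hk.
  congr (is_true (cabs _ <= _)); ring.
rewrite [X in cabs (_ - X)]row_mxEl -!actE !act_lift.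
set A := lift_inv z; set A' := lift_inv (z + h).
set L := \sum_l ang h l *: lift_dmx l z.
have hzh : strip b1 (z + h).
  move=> l; rewrite angD.
  have -> : complex.Im (ang z l + ang h l) = complex.Im (ang z l) + complex.Im (ang h l).
    by case: (ang z l) (ang h l) => ? ? [].
  apply: le_lt_trans (ler_normD _ _) _; apply: ltr_leD (hst l) _.
  apply: le_trans (cabs_Im _) _; apply: le_trans (hk l) _; apply: le_trans ed _.
  by rewrite ler_piMr ?(ltW d2_gt0)//; lra.
have hzb : strip b1 z by exact: strip_b1 (lexx t) hz.
have jE : lsubmx h *m A + rsubmx h *m
    (\matrix_(l, j0) (- (lsubmx z *m A *m lift_dmx l z *m A)) 0 j0) =
    lsubmx h *m A - lsubmx z *m A *m L *m A.
  congr (_ + _); apply/rowP => j0; rewrite mxE [RHS]mxE /L mulmx_sumr mulmx_suml.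
  rewrite summxE -sumrN; apply: eq_bigr => l _.
  rewrite [X in _ * X]mxE [X in _ * X]mxE mulrN -scalemxAr -scalemxAl.
  by rewrite [X in _ = - X]mxE.
rewrite jE linearD /=.
have sub3' (X Y Z : 'rV[R[i]]_n) : X 0 j - Y 0 j - Z 0 j = (X - Y - Z) 0 j by rewrite !mxE.
rewrite sub3'.
have AE : (1%:M + lift_mx z) *m A = 1%:M by rewrite mulmxV//; exact: lift_unit.
have AE' : A' *m (1%:M + lift_mx (z + h)) = 1%:M by rewrite mulVmx//; exact: lift_unit.
rewrite (resolvent_expand (lsubmx z) (lsubmx h) L AE AE').
have hA := lift_inv_le hzb; have hA' := lift_inv_le hzh.
have hQ := lift_mx_quad hst e0 ed hk; have hL := lift_mx_lip hst e0 ed hk.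
rewrite -/A in hA; rewrite -/A' in hA'; rewrite -/L in hQ.
set dB := lift_mx (z + h) - lift_mx z in hQ hL *.
have hh : mxle (lsubmx h) e by move=> i l; rewrite mxE (ord1 i).
have C1e : 0 <= C1 * e by rewrite mulr_ge0.
have C2e : 0 <= C2 * e ^+ 2 by rewrite mulr_ge0.
have t1 := mxleM _ (mxleM _ (mxleM p0 hP hA) hQ) hA.
have t2 := mxleM _ (mxleM _ (mxleM _ (mxleM _ (mxleM p0 hP hA') hL) hA) hL) hA.
have t3 := mxleM _ (mxleM _ (mxleM e0 hh hA') hL) hA.
have := mxleD (mxleD (mxleN (t1 _ _)) (t2 _ _ _ _)) (mxleN (t3 _ _)).
move=> h4; apply: le_trans (h4 _ _ _ _ _ _ _ _ 0 j) _;
  try by do !apply: mulr_ge0 => //.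
rewrite -/nn.
have -> : nn * (nn * (nn * (pmax * 2) * (C2 * e ^+ 2)) * 2) = K1 * e ^+ 2 by rewrite /K1; ring.
have -> : nn * (nn * (nn * (nn * (nn * (pmax * 2) * (C1 * e)) * 2) * (C1 * e)) * 2) = K2 * e ^+ 2.
  by rewrite /K2; ring.
have -> : nn * (nn * (nn * (e * 2) * (C1 * e)) * 2) = K3 * e ^+ 2 by rewrite /K3; ring.
by rewrite -!mulrDl ler_wpM2r// lerDl.
Qed.

Lemma dangC l k (c : mindex n -> R[i]) : dang l (dang k c) = dang k (dang l c).
Proof. by apply/funext => m; rewrite /dang mulrCA. Qed.

(** The symmetry condition of [block_symplectic] reduces to d_l d_k u_i = d_k d_l u_i. *)
Lemma lift_symplectic z : D t z ->
  lift_jac z *m symplectic_mx *m (lift_jac z)^T = symplectic_mx.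
Proof.
move=> hz; have hu := lift_unit (strip_b1 (lexx t) hz).
apply: block_symplectic; rewrite trmxK; first exact: mulVmx.
set X := \matrix_(_, _) _.
have XE l k : (X *m (1%:M + lift_mx z)) l k =
    - (lsubmx z *m lift_inv z *m lift_dmx l z) 0 k.
  have rE : row l X = - (lsubmx z *m lift_inv z *m lift_dmx l z *m lift_inv z).
    by apply/rowP => j; rewrite [LHS]mxE [LHS]mxE.
  have := congr1 (fun Y : 'rV[R[i]]_n => (Y *m (1%:M + lift_mx z)) 0 k) rE.
  rewrite /= -row_mul [LHS]mxE => ->.
  have AM : lift_inv z *m (1%:M + lift_mx z) = 1%:M by exact: mulVmx.
  set Y := lsubmx z *m _ *m lift_dmx l z.
  by rewrite mulNmx -(mulmxA Y) AM mulmx1 mxE.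
apply/matrixP => l k; rewrite mxE !XE; congr (- _).
rewrite !mxE; apply: eq_bigr => i _; congr (_ * _).
by rewrite [LHS]mxE [RHS]mxE dangC.
Qed.

Lemma lift_mx_periodic z w : same_point z w -> lift_mx w = lift_mx z.
Proof. by move=> h; apply/matrixP => i k; rewrite !mxE (ev_periodic _ h). Qed.

Lemma lift_canonical : canonical_transformation (D t) cotangent_lift.
Proof.
split=> [z hz|z w hz hw|z hz].
- by have [] := quad_diff_differentiable (lift_quad hz).
- have hst := strip_t (lexx t) hz; have hsw := strip_t (lexx t) hw.
  split=> [[ha [k hk]]|hs]; last first.
    have [ha [k hk]] := hs; split=> [j|].
      rewrite !act_lift /lift_inv (lift_mx_periodic hs).
      congr ((_ *m _) 0 j); apply/rowP => l.
      by have := ha l; rewrite /act.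
    by exists k => j; rewrite !ang_lift (ev_periodic _ hs) hk addrAC.
  (* The translate of [w] whose image has exactly the angles of the image of [z], not merely the
     same ones modulo 2 pi. *)
  pose v : point := row_mx (lsubmx w) (\row_j (ang w j - (pi *+ 2 * (k j)%:~R)%:C)).
  have va j : ang v j = ang w j - (pi *+ 2 * (k j)%:~R)%:C by rewrite ang_row_mx mxE.
  have vw : same_point v w.
    split=> [j|]; first by rewrite act_row_mx.
    by exists k => j; rewrite va subrK.
  have hsv : strip (t * sigma) v.
    move=> j; rewrite va; have := hsw j; case: (ang w j) => p q /=.
    by rewrite subr0.
  have uv j : ang v j + ev (uc j) v = ang z j + ev (uc j) z.
    have := hk j; rewrite !ang_lift (ev_periodic _ vw) va => h.
    by rewrite addrAC h addrK.
  have vz : forall j, ang v j = ang z j.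
    (* Injectivity by contraction: the largest angle difference satisfies e <= e / 2. *)
    pose e := \big[Num.max/0]_j cabs (ang v j - ang z j).
    have he j : cabs (ang v j - ang z j) <= e by exact: le_bigmax.
    have e0 : 0 <= e by exact: bigmax_ge_id.
    have e2 : e <= e / 2.
      apply: bigmax_le => [|j _]; first by rewrite divr_ge0.
      have -> : ang v j - ang z j = ev (uc j) z - ev (uc j) v.
        have /eqP := uv j; rewrite -subr_eq0 => /eqP h.
        by apply/eqP; rewrite -subr_eq0 -h; apply/eqP; ring.
      by apply: uc_lip => // l; rewrite cabsC.
    move=> j; apply/eqP; rewrite -subr_eq0; apply/eqP/cabs_eq0/eqP.
    by rewrite eq_le cabs_ge0 andbT; apply: le_trans (he j) _; lra.
  have hang : forall j, ang w j = ang z j + (pi *+ 2 * (k j)%:~R)%:C.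
    by move=> j; rewrite -vz va subrK.
  split; last by exists k.
  have AE : lift_inv w = lift_inv z.
    rewrite /lift_inv (lift_mx_periodic vw); congr (invmx (_ + _)).
    exact: lift_mx_eq_ang.
  have hu := lift_unit (strip_b1 (lexx t) hz).
  have aE : lsubmx w *m lift_inv z = lsubmx z *m lift_inv z.
    by apply/rowP => j; have := ha j; rewrite !act_lift AE.
  have := congr1 (mulmx^~ (1%:M + lift_mx z)) aE.
  have AM : lift_inv z *m (1%:M + lift_mx z) = 1%:M by exact: mulVmx.
  rewrite /= -!(mulmxA _ (lift_inv z)) AM !mulmx1 => lE j.
  by rewrite /act lE.
- have [_ ->] := quad_diff_differentiable (lift_quad hz).
  exact: lift_symplectic.
Qed.

Lemma lift_near_identity : near_identity rho sigma rp t eta cotangent_lift.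
Proof.
have r0 : 0 <= rho by exact: ltW.
split; first exact: lift_canonical.
- move=> s z s0 st hz; have [h1 h2] := (domP _ _ z).1 hz; apply/domP; split=> j.
    have hs := lift_inv_sub1 (strip_b1 st hz).
    have hP : mxle (lsubmx z) (s * rho).
      by move=> i l; rewrite (ord1 i); apply: ltW; exact: h1.
    have sr : 0 <= s * rho by rewrite mulr_ge0// ltW.
    rewrite act_lift -[lift_inv z](subrK 1%:M) mulmxDr mulmx1 addrC mxE.
    have -> : lsubmx z 0 j = act z j by [].
    rewrite mulrDl; apply: le_lt_trans (cabsD _ _) _.
    apply: ltr_leD (h1 j) _; apply: le_trans (mxleM sr hP hs 0 j) _.
    have -> : n%:R * (s * rho * (2 * mu)) = s * (2 * (n%:R * mu)) * rho by ring.
    rewrite ler_wpM2r//; apply: le_trans mu_eta.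
    have nm : 0 <= 2 * (n%:R * mu) by apply: mulr_ge0 => //; apply: mulr_ge0.
    by rewrite -[leRHS]mul1r ler_wpM2r// (le_trans st).
  rewrite ang_lift mulrDl.
  have -> : complex.Im (ang z j + ev (uc j) z) =
      complex.Im (ang z j) + complex.Im (ev (uc j) z).
    by case: (ang z j) (ev _ _) => ? ? [].
  apply: le_lt_trans (ler_normD _ _) _; apply: ltr_leD (h2 j) _.
  apply: le_trans (cabs_Im _) _; apply: le_trans B_le.
  exact: uc_le (strip_t st hz).
- move=> s s0 st y hy; have [h1 h2] := (domP _ _ y).1 hy.
  have stb : (s + eta) * sigma <= t * sigma by rewrite ler_wpM2r// ltW.
  have strip0 (q : 'rV[R[i]]_n) : (forall j, `|complex.Im (q 0 j)| < (s + eta) * sigma) ->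
      strip (t * sigma) (row_mx 0 q : point).
    by move=> hq j; rewrite ang_row_mx; exact: lt_le_trans (hq j) stb.
  (* The angles of a preimage of y solve q + u(q) = y; its actions are then those of y times 1 +
     Du(q). *)
  have [||j q q' e hq hq' e0 he|q [q1 q2]] := @fixed_point R n
      (fun j q => ev (uc j) (row_mx 0 q)) ((s + eta) * sigma) B (rsubmx y) B_ge0.
  + by move=> j; rewrite mulrDl; apply: ltr_leD => //; exact: h2.
  + by move=> j q hq; exact: uc_le (strip0 _ hq).
  + by apply: uc_lip => // [||l]; [exact: strip0|exact: strip0|rewrite !ang_row_mx].
  pose z0 : point := row_mx 0 q.
  pose z : point := row_mx (lsubmx y *m (1%:M + lift_mx z0)) q.
  have zz0 : forall j, ang z j = ang z0 j by move=> j; rewrite !ang_row_mx.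
  have hz0 : strip (t * sigma) z.
    move=> j; rewrite ang_row_mx; apply: le_lt_trans (q1 j) _.
    by apply: lt_le_trans stb; rewrite mulrDl; apply: ltr_leD => //; exact: h2.
  have hzb : strip b1 z.
    by move=> j; apply: lt_le_trans (hz0 j) _; rewrite lerDl ltW.
  exists z.
    apply/domP; split=> j; last first.
      rewrite ang_row_mx; apply: le_lt_trans (q1 j) _.
      by rewrite mulrDl; apply: ltr_leD => //; exact: h2.
    have hP : mxle (lsubmx y) (s * rho).
      by move=> i l; rewrite (ord1 i); apply: ltW; exact: h1.
    have hM : mxle (lift_mx z0) mu.
      move=> i k; rewrite -(lift_mx_eq_ang zz0) -(lift_mx_eq_ang (ang_ang0 z)).
      by refine (rep_bound rho_gt0 (mx_rep i k) (dom_ang0 hzb)).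
    have sr : 0 <= s * rho by rewrite mulr_ge0// ltW.
    rewrite act_row_mx mulmxDr mulmx1 mxE -[lsubmx y 0 j]/(act y j) mulrDl.
    apply: le_lt_trans (cabsD _ _) _; apply: ltr_leD (h1 j) _.
    apply: le_trans (mxleM sr hP hM 0 j) _.
    have -> : n%:R * (s * rho * mu) = s * (n%:R * mu) * rho by ring.
    rewrite ler_wpM2r//; apply: le_trans mu_eta.
    have nm : 0 <= n%:R * mu by apply: mulr_ge0.
    have sT : s <= t by rewrite (le_trans _ st)// lerDl ltW.
    by rewrite ler_wpM2r// (le_trans sT)// (le_trans t_le1)// ler1n.
  have -> : cotangent_lift z = y; last exact: same_point_refl.
  apply: point_eq => j.
    rewrite act_lift row_mxKl /lift_inv (lift_mx_eq_ang zz0) -mulmxA mulmxV ?mulmx1//.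
    by rewrite -(lift_mx_eq_ang zz0); exact: lift_unit.
  rewrite ang_lift (ev_eq_ang (uc_ang j) zz0) zz0 ang_row_mx; exact: q2.
- move=> hr z hz; have hb := strip_b1 (lexx t) hz.
  have hc : strip b1 (conjv z) by exact: strip_b1 (lexx t) (dom_conjv hz).
  have conj0 : forall j, ang (conjv z) j = ang (conjv (ang0 z)) j.
    by move=> j; rewrite !ang_conjv ang_ang0.
  have evC (c : mindex n -> R[i]) B' : ang_only c -> creal c -> bnd rho b1 c B' ->
      ev c (conjv z) = conjc (ev c z).
    move=> ca cr cb; rewrite (ev_eq_ang ca conj0) (ev_creal cr cb) ?(ev_eq_ang ca (ang_ang0 z))//.
    exact: dom_ang0.
  have uB j : bnd rho b1 (uc j) B.
    by apply: bnd_le (uc_bnd j) => //; rewrite lerD2l ler_pdivrMr// ler_peMr ?ler1n// ltW.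
  have MC : lift_mx (conjv z) = map_mx (@conjc R) (lift_mx z).
    apply/matrixP => i k; rewrite !mxE (evC _ _ _ _ (duc_bnd k i))//.
      exact: ang_only_dang.
    by apply: creal_dang; exact: uc_real.
  apply: point_eq => j; last first.
    rewrite ang_conjv !ang_lift ang_conjv conjD; congr (_ + _).
    by apply: (evC _ _ _ _ (uB j)) => //; exact: uc_real.
  rewrite act_conjv !act_lift /lift_inv MC.
  have PC : lsubmx (conjv z) = map_mx (@conjc R) (lsubmx z).
    by apply/rowP => l; rewrite !mxE.
  have := map_mul_invmx1 (@conjc R : {rmorphism R[i] -> R[i]}) (lsubmx z) (lift_mx z).
  by move=> /rowP/(_ j); rewrite PC => <-; rewrite mxE.
Qed.

End Lift.

(** * Normal forms *)

Section SingleRadius.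
Context {R : realType} {n : nat}.
Notation point := 'rV[R[i]]_(n + n).
Implicit Types (a b : R) (z : point) (m : mindex n) (c d : mindex n -> R[i]) (F G : point -> R[i]).

(** As [g] is a left inverse of [f], the indices outside the image of [f] are those with f (g j) !=
    j. *)
Lemma has_sum_inj (I J : choiceType) (x : J -> R[i]) s (f : I -> J) (g : J -> I) :
  cancel f g -> (forall j, f (g j) != j -> x j = 0) ->
  has_sum (fun i => x (f i)) s -> has_sum x s.
Proof.
move=> fK x0 /has_sumP h; apply/has_sumP => e /h[I0 hI0].
exists (f @` I0)%fset => A IA.
pose A' : {fset J} := [fset j in A | f (g j) == j]%fset.
have -> : \sum_(j <- A) x j = \sum_(j <- A') x j.
  have A'A : (A' `<=` A)%fset by apply/fsubsetP => j; rewrite !inE => /andP[].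
  rewrite (sum_fsetD _ A'A) (_ : \sum_(j <- (A `\` A')%fset) x j = 0) ?addr0//.
  rewrite big_seq big1// => j.
  by rewrite !inE => /andP[+ jA]; rewrite jA /= => /x0.
have -> : \sum_(j <- A') x j = \sum_(i <- (g @` A')%fset) x (f i).
  transitivity (\sum_(i <- [seq g j | j <- A']) x (f i)).
    rewrite big_map [LHS]big_seq [RHS]big_seq; apply: eq_bigr => j.
    by rewrite !inE => /andP[_ /eqP ->].
  apply: perm_big; apply: uniq_perm; last 2 first.
  - exact: fset_uniq.
  - by move=> i; apply/mapP/imfsetP => -[j /= jA ->]; exists j.
  rewrite map_inj_in_uniq ?fset_uniq// => j j'.
  by rewrite !inE => /andP[_ /eqP jj] /andP[_ /eqP jj'] gg; rewrite -jj gg jj'.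
apply: hI0; apply/fsubsetP => i iI; apply/imfsetP; exists (f i); last by rewrite fK.
rewrite !inE fK eqxx andbT; apply: (fsubsetP IA).
by apply/imfsetP; exists i.
Qed.

(** Once the part of low degree has been split off, the order of vanishing in the actions has done
    its work and the norm at one radius suffices. *)
Definition repc a b (F : point -> R[i]) (N : R) := exists c,
  bnd a b c N /\ forall z, dom a b z -> F z = ev c z.

Lemma repc_of_rep a b F (N : R -> R) : 0 < a -> frep a b F N -> repc a b F (N a).
Proof. by move=> a0 [c [hc hF]]; exists c; split=> //; exact: hc. Qed.

Lemma rep_of_repc a b F (N : R) : 0 < a -> repc a b F N -> frep a b F (fun=> N).
Proof.
move=> a0 [c [hc hF]]; exists c; split=> // a' a'0 aa.
by apply: bnd_le hc => //; exact: ltW.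
Qed.

Lemma repc_le a b F (N N' : R) : 0 <= a -> N <= N' -> repc a b F N -> repc a b F N'.
Proof. by move=> a0 NN [c [hc hF]]; exists c; split=> //; apply: bnd_le hc. Qed.

Lemma repcD a b F G (N N' : R) : 0 < a -> repc a b F N -> repc a b G N' ->
  repc a b (fun z => F z + G z) (N + N').
Proof.
move=> a0 /(rep_of_repc a0) hF /(rep_of_repc a0) hG.
exact: (repc_of_rep a0 (repD a0 hF hG)).
Qed.

Lemma evD a b c d (B B' : R) z : bnd a b c B -> bnd a b d B' -> dom a b z ->
  ev (fun m => c m + d m) z = ev c z + ev d z.
Proof.
move=> hc hd hz; apply: has_sum_sum.
by apply: eq_has_sum (has_sumD (has_ev hc hz) (has_ev hd hz)) => m; rewrite mulrDl.
Qed.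

Lemma evZ a b c (k : R[i]) (B : R) z : bnd a b c B -> dom a b z ->
  ev (fun m => k * c m) z = k * ev c z.
Proof.
move=> hc hz; apply: has_sum_sum.
by apply: eq_has_sum (has_sumZ (has_ev hc hz)) => m; rewrite mulrA.
Qed.

Lemma ev_sum (J : Type) (r : seq J) (c : J -> mindex n -> R[i]) a b (B : J -> R) z :
  (forall j, bnd a b (c j) (B j)) -> dom a b z ->
  ev (fun m => \sum_(j <- r) c j m) z = \sum_(j <- r) ev (c j) z.
Proof.
move=> hc hz; apply: has_sum_sum.
apply: eq_has_sum (has_sum_big (fun j => has_ev (hc j) hz)) => m.
by rewrite mulr_suml.
Qed.

Lemma bnd_sum (J : Type) (r : seq J) (c : J -> mindex n -> R[i]) a b (B : J -> R) :
  0 <= a -> (forall j, bnd a b (c j) (B j)) ->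
  bnd a b (fun m => \sum_(j <- r) c j m) (\sum_(j <- r) B j).
Proof.
move=> a0 hc; apply: rbound_le (rbound_sum r hc) => // m.
by rewrite -mulr_suml ler_wpM2r ?wt_ge0// cabs_sum.
Qed.

(* The coefficient series of p_j in the part of degree one. *)
Definition vcoef (j : 'I_n) c m : R[i] := if m.1 == 0 then c (eunit j, m.2) else 0.

(** The coefficients of p_j times a series in the angles alone. *)
Definition shiftc (j : 'I_n) (v : mindex n -> R[i]) m : R[i] :=
  if m.1 == eunit j then v (0, m.2) else 0.

Lemma vcoef_ang j c : ang_only (vcoef j c).
Proof. by move=> m m0; rewrite /vcoef (negbTE m0). Qed.

Lemma ffnat_add0 (i i' : {ffun 'I_n -> nat}) : (i + i' == i') = (i == 0).
Proof.
apply/eqP/eqP => [/ffunP h|->]; last by rewrite add0r.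
apply/ffunP => l; have := h l; rewrite !ffunE => /eqP.
by rewrite -[X in _ == X]add0n eqn_add2r => /eqP.
Qed.

Let sh j m : mindex n := madd m (eunit j, 0).
Let shinv j m : mindex n := ([ffun l => (m.1 l - eunit j l)%N], m.2).

Let shK j : cancel (sh j) (shinv j).
Proof.
case=> i k; rewrite /sh /shinv /madd /= addr0; congr pair.
by apply/ffunP => l; rewrite !ffunE addnK.
Qed.

Lemma wt_shift a b j m : wt a b (sh j m) = a * wt a b m.
Proof. by rewrite !wt.unlock /sh /madd /= mlenD mlen_eunit addn1 exprS addr0 mulrA. Qed.

Lemma bnd_vcoef a b c (B : R) j : 0 < a -> bnd a b c B -> bnd a b (vcoef j c) (a^-1 * B).
Proof.
move=> a0 /(rbound_inj (can_inj (shK j))) h.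
have ai : 0 <= a^-1 by rewrite invr_ge0 ltW.
apply: rbound_le (rboundZ ai h) => // m.
have w0 : 0 <= wt a b m by rewrite wt_ge0// ltW.
rewrite wt_shift.
have -> : a^-1 * (cabs (c (sh j m)) * (a * wt a b m)) = cabs (c (sh j m)) * wt a b m.
  by field; rewrite lt0r_neq0.
rewrite /vcoef; case: eqP => [m0|_].
  by rewrite /sh /madd m0 /= add0r addr0.
by rewrite cabs0 mul0r mulr_ge0// cabs_ge0.
Qed.

Lemma bnd_shiftc a b v (B : R) j : 0 < a -> bnd a b v B -> bnd a b (shiftc j v) (a * B).
Proof.
move=> a0 h A.
pose A' : {fset mindex n} := [fset (0, m.2) | m in A]%fset.
apply: (@le_trans _ _ (\sum_(m <- [fset m in A | m.1 == eunit j]%fset) cabs (shiftc j v m) * wt a b m)).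
  have sub : ([fset m in A | m.1 == eunit j] `<=` A)%fset.
    by apply/fsubsetP => m; rewrite !inE => /andP[].
  rewrite (sum_fsetD _ sub) gerDl big_seq; apply: sumr_le0 => m.
  by rewrite !inE => /andP[+ mA]; rewrite mA /= /shiftc => /negbTE ->; rewrite cabs0 mul0r.
have hu : uniq [seq (0, m.2) : mindex n | m <- [fset m in A | m.1 == eunit j]%fset].
  rewrite map_inj_in_uniq ?fset_uniq// => -[i k] [i' k'].
  by rewrite !inE /= => /andP[_ /eqP ->] /andP[_ /eqP ->] [->].
have a0' : 0 <= a by exact: ltW.
apply: le_trans (ler_wpM2l a0' (rbound_uniq h hu)).
rewrite big_map mulr_sumr big_seq [leRHS]big_seq; apply: ler_sum => m.
rewrite !inE => /andP[_ me]; rewrite /shiftc me.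
by rewrite mulrCA ler_wpM2l ?cabs_ge0// !wt.unlock /= (eqP me) mlen_eunit mlen0 expr0 expr1 mul1r.
Qed.

Lemma ev_shiftc a b v (B : R) j z : ang_only v -> bnd a b v B -> dom a b z ->
  ev (shiftc j v) z = act z j * ev v z.
Proof.
move=> va hv hz; apply: has_sum_sum; apply: (has_sum_inj (shK j)) => [m mm|].
  rewrite /shiftc; case: eqP => [mE|]; last by rewrite mul0r.
  case/eqP: mm; rewrite /sh /shinv /madd /= addr0 mE; case: m mE => i k /= ->; congr pair.
  by apply/ffunP => l; rewrite !ffunE subnn add0r.
apply: eq_has_sum (has_sumZ (c := act z j) (has_ev hv hz)) => m.
rewrite /sh monoD mono_act /shiftc /= ffnat_add0 addr0.
case: eqP => [m0|/eqP/va ->]; last by rewrite !mul0r mulr0.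
by case: m m0 => i k /= ->; ring.
Qed.

Definition linc (v : 'I_n -> mindex n -> R[i]) m : R[i] := \sum_j shiftc j (v j) m.

Lemma bnd_linc a b v (B : 'I_n -> R) : 0 < a -> (forall j, bnd a b (v j) (B j)) ->
  bnd a b (linc v) (\sum_j a * B j).
Proof. by move=> a0 h; apply: bnd_sum => [|j]; [exact: ltW|exact: bnd_shiftc]. Qed.

Lemma ev_linc a b v (B : 'I_n -> R) z : 0 < a -> (forall j, ang_only (v j)) ->
  (forall j, bnd a b (v j) (B j)) -> dom a b z ->
  ev (linc v) z = \sum_j act z j * ev (v j) z.
Proof.
move=> a0 va hv hz; rewrite (ev_sum (B := fun j => a * B j) _ _ hz); last first.
  by move=> j; exact: bnd_shiftc.
by apply: eq_bigr => j _; exact: ev_shiftc (va j) (hv j) hz.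
Qed.

Lemma eunit_inj : injective (@eunit n).
Proof.
move=> j l /ffunP/(_ j); rewrite !ffunE eqxx.
by case: (eqVneq j l).
Qed.

Lemma linc_eunit v j k : linc v (eunit j, k) = v j (0, k).
Proof.
rewrite /linc (bigD1 j)//= /shiftc eqxx big1 ?addr0// => l lj /=.
by rewrite (inj_eq eunit_inj) eq_sym (negbTE lj).
Qed.

Lemma linc_deg v m : (mlen m.1 != 1)%N -> linc v m = 0.
Proof.
move=> m1; rewrite /linc big1// => j _; rewrite /shiftc.
by case: eqP => // mE; rewrite mE mlen_eunit in m1.
Qed.

Lemma mlen1P (i : {ffun 'I_n -> nat}) : mlen i = 1%N -> exists j, i = eunit j.
Proof.
move=> i1; have /existsP[j ij] : [exists j, i j != 0%N].
  apply: contra_eqT i1 => /existsPn h; rewrite /mlen big1// => j _.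
  by have := h j; rewrite negbK => /eqP.
exists j; move: i1; rewrite /mlen (bigD1 j)//=; set S := (\sum_(_ < _ | _) _)%N => i1.
have ij1 : i j = 1%N by lia.
have /eqP : S = 0%N by lia.
rewrite /S sum_nat_eq0 => /forallP h.
apply/ffunP => l; rewrite ffunE; case: (eqVneq l j) => [->|lj]; first by rewrite ij1.
by have := h l; rewrite lj => /eqP.
Qed.

Lemma linc_vcoef c m : mlen m.1 = 1%N -> linc (vcoef^~ c) m = c m.
Proof.
by case: m => i k /= /mlen1P[j ->]; rewrite linc_eunit /vcoef /= eqxx.
Qed.

Lemma mlen0P (i : {ffun 'I_n -> nat}) : mlen i = 0%N -> i = 0.
Proof.
move=> /eqP; rewrite /mlen sum_nat_eq0 => /forallP h.
by apply/ffunP => j; rewrite ffunE; apply/eqP; exact: h.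
Qed.

End SingleRadius.

Section NearIdentity.
Context {R : realType} {n : nat}.
Notation point := 'rV[R[i]]_(n + n).
Variables (rho sigma : R).
Hypotheses (rho_gt0 : 0 < rho) (sigma_gt0 : 0 < sigma).
Local Notation D := (@D R n rho sigma).

Lemma near_identity_comp (rp : Prop) (t1 t2 e1 e2 : R) (Psi1 Psi2 : point -> point) :
  0 < t2 -> 0 <= e1 -> 0 <= e2 -> t2 + e2 <= t1 ->
  near_identity rho sigma rp t1 e1 Psi1 -> near_identity rho sigma rp t2 e2 Psi2 ->
  near_identity rho sigma rp t2 (e1 + e2) (Psi1 \o Psi2).
Proof.
move=> t20 e10 e20 t21 [a1 a2 a3 a4] [b1 b2 b3 b4].
have t12 : t2 <= t1 by rewrite (le_trans _ t21)// lerDl.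
have map2 z : D t2 z -> D t1 (Psi2 z).
  by move=> hz; apply: (D_le rho_gt0 sigma_gt0 t21); exact: b2.
have [_ a1s _] := a1.
split.
- exact: canonical_comp b1 a1 map2.
- move=> s z s0 st hz.
  have -> : s + (e1 + e2) = (s + e2) + e1 by ring.
  apply: a2; last exact: b2.
    by rewrite ltr_wpDr.
  by rewrite (le_trans _ t21)// lerD2r.
- move=> s s0 st y hy.
  have s1 : s + e1 <= t1 by rewrite (le_trans _ t12)// (le_trans _ st)// lerD2l lerDl.
  have [w hw wy] := a3 s s0 s1 y hy.
  have s2 : (s + e1) + e2 <= t2 by rewrite -addrA.
  have [z hz zw] := b3 (s + e1) (ltr_wpDr e10 s0) s2 w hw.
  exists z; first by rewrite addrA.
  apply: same_point_trans wy; apply/a1s => //.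
    by apply: map2; apply: D_le s2 hz.
  exact: D_le s1 hw.
- move=> hr z hz; rewrite /= b4// a4//; exact: map2.
Qed.

End NearIdentity.

Section NormalForms.
Context {R : realType} {n : nat}.
Notation point := 'rV[R[i]]_(n.+1 + n.+1).
Implicit Types (a b : R) (z : point) (m : mindex n.+1) (c d : mindex n.+1 -> R[i])
  (F G : point -> R[i]).
Variable qstar : 'rV[R]_n.

(* The value of the first angle is immaterial, as the series to be evaluated here
   do not depend on it. *)
Definition zstar : point := row_mx 0
  (\row_j if unlift ord0 j is Some l then (qstar 0 l)%:C else 0).

Lemma zstar_dom a b : 0 < a -> 0 < b -> dom a b zstar.
Proof.
move=> a0 b0; apply/domP; split=> j; first by rewrite act_row_mx mxE cabs0.
by rewrite ang_row_mx mxE; case: unlift => [l|] /=; rewrite normr0.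
Qed.

Lemma conjv_zstar : conjv zstar = zstar.
Proof.
apply: point_eq => j; first by rewrite act_conjv act_row_mx mxE conjc0.
rewrite ang_conjv ang_row_mx mxE; case: unlift => [l|]; last by rewrite conjc0.
exact: conjc_real.
Qed.

(** Linear conditions on a single series, with no reference to powers of eps. The parts of degree at
    least two are free, so they can always be counted as normal. *)
Definition normalc c :=
  (forall m, (mlen m.1 < 2)%N -> m.2 ord0 != 0 -> c m = 0) /\
  (forall j, ev (vcoef j c) zstar = 0).

Definition repn a b F (N : R) := exists c,
  [/\ normalc c, bnd a b c N & forall z, dom a b z -> F z = ev c z].

Lemma vcoefD j c d : vcoef j (fun m => c m + d m) = (fun m => vcoef j c m + vcoef j d m).
Proof. by apply/funext => m; rewrite /vcoef; case: eqP; rewrite ?addr0. Qed.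

Lemma normalcD a b c d (B B' : R) : 0 < a -> 0 < b -> bnd a b c B -> bnd a b d B' ->
  normalc c -> normalc d -> normalc (fun m => c m + d m).
Proof.
move=> a0 b0 hc hd [c1 c2] [d1 d2]; split=> [m ml mk|j].
  by rewrite c1// d1// addr0.
rewrite vcoefD (evD (bnd_vcoef j a0 hc) (bnd_vcoef j a0 hd) (zstar_dom a0 b0)).
by rewrite c2 d2 addr0.
Qed.

Lemma normalcZ a b c (k : R[i]) (B : R) : 0 < a -> 0 < b -> bnd a b c B ->
  normalc c -> normalc (fun m => k * c m).
Proof.
move=> a0 b0 hc [c1 c2]; split=> [m ml mk|j]; first by rewrite c1// mulr0.
have -> : vcoef j (fun m => k * c m) = (fun m => k * vcoef j c m).
  by apply/funext => m; rewrite /vcoef; case: eqP; rewrite ?mulr0.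
by rewrite (evZ k (bnd_vcoef j a0 hc) (zstar_dom a0 b0)) c2 mulr0.
Qed.

Lemma ev_eq0 c z : (forall m, c m = 0) -> ev c z = 0.
Proof.
move=> h; have h0 : bnd 1 0 c 0 by apply: rbound0 => m; rewrite h cabs0 mul0r.
rewrite /ev (_ : (fun m => c m * mono m z) = fun=> 0); last first.
  by apply/funext => m; rewrite h mul0r.
apply: has_sum_sum; have := has_sum_fin (x := fun _ : mindex n.+1 => 0 : R[i]) (A := fset0).
by rewrite big_seq_fset0; apply.
Qed.

Lemma normalc_deg c : (forall m, (mlen m.1 < 2)%N -> c m = 0) -> normalc c.
Proof.
move=> h; split=> [m ml _|j]; first exact: h.
by apply: ev_eq0 => m; rewrite /vcoef h ?if_same//= mlen_eunit.
Qed.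

Lemma repnD a b F G (N N' : R) : 0 < a -> 0 < b -> repn a b F N -> repn a b G N' ->
  repn a b (fun z => F z + G z) (N + N').
Proof.
move=> a0 b0 [c [nc hc hF]] [d [nd hd hG]]; exists (fun m => c m + d m); split.
- exact: normalcD a0 b0 hc hd nc nd.
- by apply: bndD => //; exact: ltW.
- by move=> z hz; rewrite hF// hG// (evD hc hd hz).
Qed.

Lemma repn_le a b F (N N' : R) : 0 <= a -> N <= N' -> repn a b F N -> repn a b F N'.
Proof. by move=> a0 NN [c [nc hc hF]]; exists c; split=> //; apply: bnd_le hc. Qed.

Lemma repn_cst a b (k : R[i]) : 0 < a -> 0 < b -> repn a b (fun=> k) (cabs k).
Proof.
move=> a0 b0; exists (csingle (0, 0) k); split.
- split=> [m ml mk|j].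
    rewrite /csingle; case: eqP => // mE; rewrite mE /= ffunE eqxx in mk.
    by [].
  apply: ev_eq0 => m; rewrite /vcoef /csingle; case: ifP => // _.
  case: eqP => // -[] /(congr1 mlen); rewrite mlen_eunit.
  by rewrite mlen0.
- apply: bnd_csingle; first exact: ltW.
  by rewrite wt.unlock /= mlen0 klen0 expr0 mul0r expR0 !mulr1.
- move=> z hz; rewrite ev_csingle mono.unlock /= big1 => [|j _]; last by rewrite ffunE expr0.
  by rewrite big1 ?mulr0 ?cexp0 ?mulr1// => j _; rewrite ffunE mul0r.
Qed.

(** The part of degree at least two is automatically normal and keeps its norm at radius [a]; only
    the rest is measured at the small radius [nu]. *)
Lemma rep_split_low a b F (N : R -> R) nu : 0 < nu -> nu <= a -> frep a b F N ->
  exists F1 F2, [/\ repn a b F1 (N a), repc a b F2 (a / nu * N nu) &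
    forall z, dom a b z -> F z = F1 z + F2 z].
Proof.
move=> n0 na [c [hc hF]]; have a0 : 0 < a by exact: lt_le_trans na.
pose lo m := if (mlen m.1 < 2)%N then c m else 0.
pose hi m := if (mlen m.1 < 2)%N then 0 else c m.
have hlo : bnd a b lo (a / nu * N nu) by apply: bnd_low => //; exact: hc.
have hhi : bnd a b hi (N a).
  apply: bnd_coef_le (hc a a0 (lexx _)) => [|m]; first exact: ltW.
  by rewrite /hi; case: ifP => //; rewrite cabs0 cabs_ge0.
exists (ev hi), (ev lo); split.
- by exists hi; split=> //; apply: normalc_deg => m ml; rewrite /hi ml.
- by exists lo.
- move=> z hz; rewrite hF// -(evD hhi hlo hz); apply: eq_sum => m.
  by rewrite /hi /lo; case: ifP; rewrite ?add0r ?addr0.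
Qed.

Lemma normalc_cstar a b c (B : R) : 0 < a -> 0 < b -> bnd a b c B ->
  normalc c -> normalc (cstar c).
Proof.
move=> a0 b0 hc [c1 c2]; split=> [m ml mk|j].
  by rewrite /cstar c1 ?conjc0//= ffunE oppr_eq0.
have -> : vcoef j (cstar c) = cstar (vcoef j c).
  by apply/funext => m; rewrite /vcoef /cstar /=; case: ifP; rewrite ?conjc0.
rewrite -conjv_zstar (ev_cstar (bnd_vcoef j a0 hc) (zstar_dom a0 b0)) c2.
exact: conjc0.
Qed.

End NormalForms.

(** * Restoring the reality of coefficients *)

Section Symmetrization.
Context {R : realType} {n : nat}.
Notation point := 'rV[R[i]]_(n + n).
Implicit Types (a b : R) (z : point) (m : mindex n) (c d : mindex n -> R[i]).

(** The representations obtained by substitution do not record reality; averaging with the reflected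
    series restores it without increasing the norm. *)
Definition creal_part c m : R[i] := 2^-1 * (c m + cstar c m).

Lemma creal_part_creal c : creal (creal_part c).
Proof.
move=> [i k]; rewrite /creal_part /cstar /= opprK conjM conjD conjcK.
have -> : conjc (2^-1 : R[i]) = 2^-1.
  by rewrite -(rmorph_nat (real_complex R)) -fmorphV conjc_real.
by rewrite addrC.
Qed.

Let half2 (x : R) : cabs (2^-1 : R[i]) * (x + x) = x.
Proof. by rewrite cabsV cabs_nat -mulr2n -[x *+ 2]mulr_natl mulrA mulVf ?mul1r. Qed.

Lemma bnd_creal_part a b c (B : R) : 0 <= a -> bnd a b c B -> bnd a b (creal_part c) B.
Proof.
move=> a0 hc; rewrite -(half2 B); apply: bndZ; apply: bndD => //.
exact: bnd_cstar.
Qed.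

Lemma ev_creal_part a b c (B : R) z : 0 <= a -> bnd a b c B -> dom a b z ->
  ev (creal_part c) z = 2^-1 * (ev c z + conjc (ev c (conjv z))).
Proof.
move=> a0 hc hz; have hs := bnd_cstar hc.
rewrite (evZ _ (bndD a0 hc hs) hz) (evD hc hs hz) -[z in ev (cstar c) z]conjvK.
by rewrite (ev_cstar hc (dom_conjv hz)).
Qed.

End Symmetrization.

(** * The normalisation step *)

Section SmallSubstitution.
Context {R : realType} {n : nat}.
Notation point := 'rV[R[i]]_(n + n).

Lemma bnd_ang (a a' b B : R) (c : mindex n -> R[i]) : ang_only c ->
  bnd a b c B -> bnd a' b c B.
Proof.
move=> ca; apply: rbound_le => // m; have [m0|/ca ->] := eqVneq m.1 0.
  by rewrite !wt_ang0.
by rewrite cabs0 !mul0r.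
Qed.

(** Two bounds for one and the same coefficient family: a fraction [s] of the norm on a larger
    domain, by [chord_wt], and the whole norm after substitution. The first serves at full radius,
    the second at a small radius where [M] is tiny; a minimum keeps both. *)
Lemma rep_subst_small (a1 b : R) (Psi : point -> point) (d u : 'I_n -> point -> R[i])
    (gam : R -> R) (ups s dd ee B : R) (M : R -> R) (g : mindex n -> R[i]) :
  0 < a1 -> 0 < b ->
  (forall z, dom a1 b z -> forall j, act (Psi z) j = act z j + d j z) ->
  (forall z, dom a1 b z -> forall j, ang (Psi z) j = ang z j + u j z) ->
  (forall j, frep a1 b (d j) gam) -> (forall j, frep a1 b (u j) (fun=> ups)) ->
  (forall a, 0 < a -> a <= a1 -> 0 <= gam a <= s * dd) -> 0 <= ups <= s * ee ->
  0 <= s <= 1 -> 0 <= dd -> 0 <= ee -> bnd (a1 + dd) (b + ee) g B ->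
  (forall a, 0 < a -> a <= a1 -> bnd (a + gam a) (b + ups) g (M a)) ->
  frep a1 b (fun z => ev g (Psi z) - ev g z) (fun a => Num.min (s * B) (M a)).
Proof.
move=> a10 b0 hd hu dr ur hgam /andP[u0 us] s01 d0 e0 gB gM.
have /andP[g0 _] := hgam a1 a10 (lexx _).
have /andP[s0 s1] := s01.
apply: (rep_subst a10 b0 hd hu dr ur g0 u0 (gM a1 a10 (lexx _))) => a a0 aa J.
have /andP[ga0 gas] := hgam a a0 aa.
rewrite le_min; apply/andP; split.
  apply: le_trans (rboundZ s0 gB J); apply: ler_sum => m _.
  rewrite mulrCA ler_wpM2l ?cabs_ge0//.
  have [_ _ _ h] := chord_wt b m s01 (ltW a0) d0 e0.
  have w1 : wt (a + gam a) (b + ups) m <= wt (a + s * dd) (b + s * ee) m.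
    by apply: wt_le; [rewrite addr_ge0// ltW|rewrite lerD2l|rewrite lerD2l].
  have w2 : wt (a + dd) (b + ee) m <= wt (a1 + dd) (b + ee) m.
    by apply: wt_le => //; [rewrite addr_ge0// ltW|rewrite lerD2r].
  have w3 : 0 <= wt a b m by rewrite wt_ge0// ltW.
  have w4 : s * (wt (a + dd) (b + ee) m - wt a b m) <= s * wt (a1 + dd) (b + ee) m.
    by apply: ler_wpM2l => //; lra.
  lra.
apply: le_trans (gM a a0 aa J); apply: ler_sum => m _.
by rewrite ler_wpM2l ?cabs_ge0// gerBl wt_ge0// ltW.
Qed.

Definition degc (l : nat) (c : mindex n -> R[i]) m : R[i] := if mlen m.1 == l then c m else 0.

End SmallSubstitution.

(** * The shear step: degree zero, and the average of degree one at q = q* *)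

Section ShearStep.
Context {R : realType} {n : nat}.
Notation point := 'rV[R[i]]_(n.+1 + n.+1).
Implicit Types (a b : R) (z : point) (m : mindex n.+1) (c d : mindex n.+1 -> R[i])
  (F G : point -> R[i]).
Variable qstar : 'rV[R]_n.
Variables (rho sigma omega E0 Cb Ci : R).
Hypotheses (rho_gt0 : 0 < rho) (sigma_gt0 : 0 < sigma) (omega_neq0 : omega != 0)
  (E0_ge0 : 0 <= E0) (Ci_ge0 : 0 <= Ci).
Local Notation D := (@D R n.+1 rho sigma).
Local Notation N := (n.+1%:R : R).

(* [h] stands for the sum of the f_2l^(0,0), l > 1, and [Cq] for the Hessian of
   f_4^(0,0); the last clause is the invertibility of [Cq] with a bound on its
   inverse. *)
Definition unperturbed (h : mindex n.+1 -> R[i]) (Cq : 'M[R[i]]_n.+1) :=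
  [/\ forall m, (mlen m.1 < 2)%N -> h m = 0,
      bnd rho sigma h E0,
      Cq^T = Cq /\ mxle Cq Cb,
      forall z, dom rho sigma z ->
        ev (degc 2 h) z = 2^-1 * \sum_j \sum_k Cq j k * act z j * act z k
    & forall (beta : 'I_n.+1 -> R[i]) (x : R), (forall j, cabs (beta j) <= x) ->
        exists zeta : 'I_n.+1 -> R[i],
          [/\ forall j, \sum_k Cq j k * zeta k = beta j,
              forall k, cabs (zeta k) <= Ci * x
            & (forall j, conjc (beta j) = beta j) ->
              forall k, conjc (zeta k) = zeta k]].

Definition remainder (h : mindex n.+1 -> R[i]) (H : point -> R[i]) z : R[i] :=
  H z - omega%:C * act z ord0 - ev h z.

(* [A] is normalised and of order eps, [B] is the rest, of the current order in
   eps. Under [rp], which will be the hypothesis that H is real, so are both. *)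
Definition state (rp : Prop) F (t KA KB : R) := exists A B,
  [/\ normalc qstar A, bnd (t * rho) (t * sigma) A KA, bnd (t * rho) (t * sigma) B KB,
      forall z, D t z -> F z = ev A z + ev B z & rp -> creal A /\ creal B].

(* The situation after the shear: the last sum is the part of degree one
   depending on q_1, which is left to the point transformation. *)
Definition mid_state (rp : Prop) F (t KA KB Kv : R) := exists FA FB v,
  [/\ repn qstar (t * rho) (t * sigma) FA KA, repc (t * rho) (t * sigma) FB KB,
      [/\ forall j, ang_only (v j), forall j m, m.2 ord0 = 0 -> v j m = 0,
          forall j, bnd (t * rho) (t * sigma) (v j) Kv
        & rp -> forall j, creal (v j)]
    & forall z, D t z -> F z = FA z + FB z + \sum_j act z j * ev (v j) z].

Section Step.
Variables (rp : Prop) (h : mindex n.+1 -> R[i]) (Cq : 'M[R[i]]_n.+1) (H : point -> R[i]).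
Variables (A B : mindex n.+1 -> R[i]) (t g KA KB : R).
Hypotheses (hC : unperturbed h Cq) (h_real : rp -> forall j k, conjc (Cq j k) = Cq j k).
Hypotheses (g_gt0 : 0 < g) (gt : g < t) (t_le1 : t <= 1).
Hypotheses (A_normal : normalc qstar A) (A_bnd : bnd (t * rho) (t * sigma) A KA)
  (B_bnd : bnd (t * rho) (t * sigma) B KB)
  (H_eq : forall z, D t z -> remainder h H z = ev A z + ev B z)
  (B_real : rp -> creal B).

Let t' := t - g.
Let t'_gt0 : 0 < t'. Proof. by rewrite subr_gt0. Qed.
Let t_gt0 : 0 < t. Proof. exact: lt_trans gt. Qed.
Let tr : 0 < t * rho. Proof. exact: mulr_gt0. Qed.
Let ts : 0 < t * sigma. Proof. exact: mulr_gt0. Qed.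
Let tr' : 0 < t' * rho. Proof. exact: mulr_gt0. Qed.
Let ts' : 0 < t' * sigma. Proof. exact: mulr_gt0. Qed.
Let KA_ge0 : 0 <= KA. Proof. exact: bnd_ge0 A_bnd. Qed.
Let KB_ge0 : 0 <= KB. Proof. exact: bnd_ge0 B_bnd. Qed.
(** Half of the lost width pays for the derivatives of S, the other half for the Jacobian of the
    shear. *)
Let delta := g * sigma / 2.
Let delta_gt0 : 0 < delta. Proof. by rewrite divr_gt0 ?mulr_gt0. Qed.

(* [cS j] are the coefficients of d_j S, where S solves omega d_1 S = - B0 and
   B0 is the part of [B] of degree zero depending on q_1. *)
Let isB0 m := (m.1 == 0) && (m.2 ord0 != 0).
Let cS j m : R[i] :=
  if isB0 m then - ((m.2 j)%:~R / (omega%:C * (m.2 ord0)%:~R)) * B m else 0.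
Let Bn m : R[i] := if (mlen m.1 < 2)%N && (m.2 ord0 != 0) then 0 else B m.
Let beta j : R[i] := ev (vcoef j Bn) (zstar qstar).

Let Bn_bnd : bnd (t * rho) (t * sigma) Bn KB.
Proof.
apply: bnd_coef_le B_bnd => [|m]; first exact: ltW.
by rewrite /Bn; case: ifP => _; rewrite ?cabs0 ?cabs_ge0.
Qed.

Let beta_le j : cabs (beta j) <= (t * rho)^-1 * KB.
Proof.
exact: ev_le (bnd_vcoef j tr Bn_bnd) (zstar_dom qstar tr ts).
Qed.

(** The size of c per unit norm of [B]: the first summand is for grad S, the second for zeta, where
    (t rho)^-1 comes from extracting the coefficient of p_j. *)
Definition shear_gain : R := (`|omega| * delta)^-1 + Ci * (t * rho)^-1.
Local Notation G0 := shear_gain.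

Let om0 : 0 < `|omega|. Proof. by rewrite normr_gt0. Qed.

Let cS_bnd j : bnd (t * rho) (t' * sigma + delta) (cS j) (KB / (`|omega| * delta)).
Proof.
have E : t' * sigma + delta = t * sigma - delta by rewrite /t' /delta; lra.
have hB : bnd (t * rho) (t' * sigma + delta + delta) B KB.
  by rewrite E subrK.
have oi : 0 <= `|omega|^-1 by rewrite invr_ge0 ltW.
have hk := bnd_klen delta_gt0 (ltW tr) hB.
have -> : KB / (`|omega| * delta) = `|omega|^-1 * (KB / delta).
  by field; rewrite !lt0r_neq0.
apply: rbound_le (rboundZ oi hk) => // m.
have w0 : 0 <= wt (t * rho) (t' * sigma + delta) m by rewrite wt_ge0// ltW.
rewrite mulrA ler_wpM2r//; rewrite /cS; case: ifP => [/andP[_ mk]|_]; last first.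
  by rewrite cabs0 mulr_ge0// cabs_ge0.
have hc : cabs (- ((m.2 j)%:~R / (omega%:C * (m.2 ord0)%:~R))) =
    (`|m.2 j|%N)%:R * (`|omega| * (`|m.2 ord0|%N)%:R)^-1.
  by rewrite cabsN cabsM cabs_int cabsV cabsM cabs_real cabs_int.
rewrite (cabsM (- _)) hc (cabsM _%:R) cabs_nat.
(* The divisors stay away from zero because k_1 is a nonzero integer. *)
have k1 : 1 <= (`|m.2 ord0|%N)%:R :> R by rewrite ler1n absz_gt0.
have kj : (`|m.2 j|%N)%:R <= (klen m.2)%:R :> R by rewrite ler_nat klen_le.
set x := (`|m.2 ord0|%N)%:R in k1 *; set y := (`|m.2 j|%N)%:R in kj *.
have y0 : 0 <= y by rewrite /y.
have xi : x^-1 <= 1 by rewrite invf_le1//; exact: lt_le_trans k1.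
have xi0 : 0 <= x^-1 by rewrite invr_ge0 (le_trans _ k1).
have yx : y * x^-1 <= (klen m.2)%:R.
  by apply: le_trans kj; rewrite -[leRHS]mulr1 ler_wpM2l.
have c0 := cabs_ge0 (B m).
rewrite invfM; have -> : y * (`|omega|^-1 * x^-1) * cabs (B m) =
  `|omega|^-1 * (y * x^-1 * cabs (B m)) by ring.
by rewrite ler_wpM2l// ler_wpM2r.
Qed.

Let cS_ang j : ang_only (cS j).
Proof. by move=> m m0; rewrite /cS /isB0 (negbTE m0). Qed.

Let cS_closed j l : dang l (cS j) = dang j (cS l).
Proof.
apply/funext => m; rewrite /dang /cS; case: ifP => _; last by rewrite !mulr0.
by ring.
Qed.

Let cS_omega m : omega%:C * cS ord0 m = if isB0 m then - B m else 0.
Proof.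
rewrite /cS; case: ifP => [/andP[_ mk]|_]; last by rewrite mulr0.
have o0 : omega%:C != 0 by rewrite -(rmorph0 (real_complex R)) (inj_eq (@complexI R)).
have k0 : (m.2 ord0)%:~R != 0 :> R[i] by rewrite intr_eq0.
by field; rewrite o0 k0.
Qed.

Let cS_real : rp -> forall j, creal (cS j).
Proof.
move=> hr j m; rewrite /cS /isB0 /= ffunE oppr_eq0; case: ifP => _; last by rewrite conjc0.
rewrite (B_real hr) conjM; congr (_ * _).
rewrite conjN conjM ffunE !mulrNz conj_int.
have -> (x y : R[i]) : conjc (x * y)^-1 = (conjc x * conjc y)^-1.
  by rewrite -conjM -fmorphV.
by rewrite conj_int conjc_real mulrN invrN mulrNN.
Qed.

Variable eta : R.
Hypotheses (eta_gt0 : 0 < eta).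
Let Gam := KB * G0.
Hypotheses (small1 : Gam <= g * rho) (small2 : Gam <= eta * rho)
  (small3 : Gam <= (t - g) * rho).

Let G0_ge0 : 0 <= G0.
Proof.
by rewrite /G0 addr_ge0 ?invr_ge0 ?mulr_ge0 ?invr_ge0// ltW.
Qed.

Let Gam_ge0 : 0 <= Gam. Proof. exact: mulr_ge0. Qed.

Let zeta_ex : exists zeta : 'I_n.+1 -> R[i],
  [/\ forall j, \sum_k Cq j k * zeta k = - beta j,
      forall k, cabs (zeta k) <= Ci * ((t * rho)^-1 * KB)
    & (forall j, conjc (- beta j) = - beta j) -> forall k, conjc (zeta k) = zeta k].
Proof.
have [_ _ _ _ hs] := hC; apply: hs => j; rewrite cabsN; exact: beta_le.
Qed.

Let beta_real : rp -> forall j, conjc (- beta j) = - beta j.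
Proof.
move=> hr j; rewrite conjN; congr (- _).
have vr : creal (vcoef j Bn).
  move=> m; rewrite /vcoef /=; case: ifP => _; last by rewrite conjc0.
  rewrite /Bn /= ffunE oppr_eq0; case: ifP => _; first by rewrite conjc0.
  exact: (B_real hr (eunit j, m.2)).
by rewrite -(ev_creal vr (bnd_vcoef j tr Bn_bnd) (zstar_dom qstar tr ts)) conjv_zstar.
Qed.

Lemma shear_step : exists Psi, near_identity rho sigma rp t' eta Psi /\
  (forall z, D t' z -> D t (Psi z)) /\
  mid_state rp (remainder h (H \o Psi)) t'
    (KA + (KB + n.+1%:R * KB) + `|omega| * (Ci * ((t * rho)^-1 * KB)) + Gam / (g * rho) * E0)
    (Gam / (g * rho) * (KA + KB) + 8 * E0 / rho ^+ 2 * Gam ^+ 2 + n.+1%:R ^+ 2 * Cb * Gam ^+ 2)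
    ((t' * rho)^-1 * KB + n.+1%:R * (Cb * Gam)).
Proof.
have [zeta [zeta_eq zeta_le zeta_real]] := zeta_ex.
pose cc j m := cS j m + csingle (0, 0) (zeta j) m.
have cc_ang j : ang_only (cc j).
  move=> m m0; rewrite /cc cS_ang// add0r /csingle; case: eqP => // mE.
  by rewrite mE eqxx in m0.
have sgl_bnd b j : bnd (t * rho) b (csingle ((0, 0) : mindex n.+1) (zeta j)) (Ci * ((t * rho)^-1 * KB)).
  apply: bnd_csingle; first exact: ltW.
  by rewrite wt.unlock /= mlen0 klen0 expr0 mul0r expR0 !mulr1.
have GE : Gam = KB / (`|omega| * delta) + Ci * ((t * rho)^-1 * KB).
  by rewrite /Gam /G0; ring.
have cc_bnd j : bnd (t * rho) (t' * sigma + delta) (cc j) Gam.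
  by rewrite GE; apply: bndD; [exact: ltW|exact: cS_bnd|exact: sgl_bnd].
have cc_closed j l : dang l (cc j) = dang j (cc l).
  apply/funext => m; have /(congr1 (fun f => f m)) := cS_closed j l.
  rewrite /dang /cc !mulrDr => ->; congr (_ + _); rewrite /csingle.
  by case: eqP => [->|_]; rewrite ?mulr0//= !ffunE !mulr0z !mulr0 !mul0r.
have cc_real : rp -> forall j, creal (cc j).
  move=> hr j m; rewrite /cc conjD (cS_real hr); congr (_ + _); rewrite /csingle.
  have -> : ((m.1, - m.2) == (0, 0)) = (m == (0, 0)).
    by case: m => i k; rewrite !xpair_eqE /= oppr_eq0.
  by case: ifP => _; [rewrite (zeta_real (beta_real hr))|rewrite conjc0].
have cc_rho j : bnd rho (t' * sigma + delta) (cc j) Gam.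
  exact: bnd_ang (cc_ang j) (cc_bnd j).
have cc_t' a j : bnd a (t' * sigma) (cc j) Gam.
  apply: bnd_ang (cc_ang j) (_ : bnd rho _ _ _).
  apply: bnd_le (cc_rho j) => //; first exact: ltW.
  by rewrite lerDl ltW.
pose Psi := shear cc; exists Psi.
have act_Psi z : dom (t' * rho) (t' * sigma) z ->
    forall j, act (Psi z) j = act z j + ev (cc j) z by move=> _ j; exact: act_shear.
have ang_Psi z : dom (t' * rho) (t' * sigma) z ->
    forall j, ang (Psi z) j = ang z j + (fun _ _ => 0) j z.
  by move=> _ j; rewrite addr0; exact: ang_shear.
have cc_rep j : frep (t' * rho) (t' * sigma) (ev (cc j)) (fun=> Gam).
  by exists (cc j); split.
have z_rep (j : 'I_n.+1) : frep (t' * rho) (t' * sigma) ((fun (_ : 'I_n.+1) (_ : point) => 0) j) (fun=> 0).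
  exact: rep0.
have tt' : t' * rho + g * rho = t * rho by rewrite /t' -mulrDl subrK.
have t't : t' <= t by rewrite /t' gerBl ltW.
have t'ts : t' * sigma <= t * sigma by rewrite ler_wpM2r// ltW.
have DPsi z : D t' z -> D t (Psi z).
  move=> hz; have := subst_dom tr' act_Psi ang_Psi cc_rep z_rep hz.
  by apply: dom_le; rewrite ?addr0// -tt' lerD2l.
split; first exact: (shear_near_identity rho_gt0 sigma_gt0 eta_gt0 delta_gt0 cc_ang
  cc_rho small2 cc_closed cc_real).
split=> //.
(* The displacement of the actions as a fraction of the radius given up. *)
pose s := Gam / (g * rho).
have gr : 0 < g * rho by exact: mulr_gt0.
have s0 : 0 <= s by rewrite divr_ge0// ltW.
have s1 : s <= 1 by rewrite ler_pdivrMr// mul1r.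
have s01 : 0 <= s <= 1 by rewrite s0.
have sG : s * (g * rho) = Gam by rewrite /s divfK// lt0r_neq0.
have gamP a : 0 < a -> a <= t' * rho -> 0 <= (fun=> Gam) a <= s * (g * rho).
  by rewrite sG lexx andbT.
have upsP : (0 : R) <= 0 <= s * 0 by rewrite mulr0 lexx.
have grw : 0 <= g * rho by exact: ltW.
have subst (c : mindex n.+1 -> R[i]) KC M : bnd (t * rho) (t * sigma) c KC ->
    (forall a, 0 < a -> a <= t' * rho -> bnd (a + Gam) (t' * sigma + 0) c (M a)) ->
    frep (t' * rho) (t' * sigma) (fun z => ev c (Psi z) - ev c z)
      (fun a => Num.min (s * KC) (M a)).
  move=> hc hM.
  apply: (rep_subst_small tr' ts' act_Psi ang_Psi cc_rep z_rep gamP upsP s01 grw (lexx 0) _ hM).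
  by rewrite tt' addr0; apply: bnd_le hc => //; exact: ltW.
have Gam_t a : 0 < a -> a <= t' * rho -> a + Gam <= t * rho.
  by move=> a0 aa; rewrite -tt' lerD.
have substc (c : mindex n.+1 -> R[i]) KC : bnd (t * rho) (t * sigma) c KC ->
    repc (t' * rho) (t' * sigma) (fun z => ev c (Psi z) - ev c z) (s * KC).
  move=> hc; apply: (repc_le (ltW tr') _ (repc_of_rep tr' (subst c KC (fun=> KC) hc _))).
    by rewrite ge_min lexx.
  move=> a a0 aa; rewrite addr0; apply: bnd_le hc => //; last exact: Gam_t.
  by rewrite addr_ge0// ltW.
have [h_deg h_bnd [Cq_sym Cq_le] h_quad _] := hC.
(* The quadratic part is set aside, since its increment contains p C c, of degree one and only
   linear in [Gam]; it is expanded exactly in [h2E]. The rest vanishes to third order in the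
   actions, so the part of its increment of degree at most one is quadratic in [Gam]. *)
pose h3 m := if mlen m.1 == 2 then 0 else h m.
have trle : t * rho <= rho by rewrite -[leRHS]mul1r ler_wpM2r// ltW.
have tsle : t * sigma <= sigma by rewrite -[leRHS]mul1r ler_wpM2r// ltW.
have h3_bnd : bnd rho sigma h3 E0.
  apply: bnd_coef_le h_bnd => [|m]; first exact: ltW.
  by rewrite /h3; case: ifP => // _; rewrite cabs0 cabs_ge0.
have h2_bnd : bnd rho sigma (degc 2 h) E0.
  apply: bnd_coef_le h_bnd => [|m]; first exact: ltW.
  by rewrite /degc; case: ifP => // _; rewrite cabs0 cabs_ge0.
have h3_bt : bnd (t * rho) (t * sigma) h3 E0 by apply: bnd_le h3_bnd => //; exact: ltW.
have h3_deg m : (mlen m.1 < 3)%N -> h3 m = 0.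
  rewrite /h3 ltnS leq_eqVlt => /orP[->//|ml].
  by rewrite h_deg//; case: ifP.
have h3M a : 0 < a -> a <= t' * rho ->
    bnd (a + Gam) (t' * sigma + 0) h3 (((a + Gam) / rho) ^+ 3 * E0).
  move=> a0 aa; apply: bnd_deg => //; first by rewrite addr_ge0// ltW.
    exact: le_trans (Gam_t a a0 aa) trle.
  by apply: bnd_le h3_bnd => //; [exact: ltW|rewrite addr0 (le_trans t'ts)].
have h3_rep := subst h3 E0 (fun a => ((a + Gam) / rho) ^+ 3 * E0) h3_bt h3M.
have [F1 [F2 [F1n F2c F12]]] : exists F1 F2,
    [/\ repn qstar (t' * rho) (t' * sigma) F1 (s * E0),
        repc (t' * rho) (t' * sigma) F2 (8 * E0 / rho ^+ 2 * Gam ^+ 2) &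
        forall z, dom (t' * rho) (t' * sigma) z -> ev h3 (Psi z) - ev h3 z = F1 z + F2 z].
  have rr : 0 < rho ^+ 2 by rewrite exprn_gt0.
  (* The small radius is [Gam] itself, hence must be positive: the majorant there is of order (2 Gam
     / rho)^3, the rescaling costs t' rho / Gam, and Gam^2 remains. For Gam = 0 the increment has
     norm zero. *)
  have [Gp|Gn] := ltP 0 Gam.
    have [F1 [F2 [a1 a2 a3]]] := rep_split_low qstar Gp small3 h3_rep.
    exists F1, F2; split=> //; first by apply: repn_le a1; [exact: ltW|rewrite ge_min lexx].
    apply: repc_le a2; first exact: ltW.
    apply: (@le_trans _ _ (t' * rho / Gam * (((Gam + Gam) / rho) ^+ 3 * E0))).
      by apply: ler_wpM2l; [rewrite divr_ge0// ltW|rewrite ge_min lexx orbT].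
    have -> : t' * rho / Gam * (((Gam + Gam) / rho) ^+ 3 * E0) =
       t' * (8 * E0 / rho ^+ 2 * Gam ^+ 2).
      by field; rewrite !lt0r_neq0.
    rewrite -[leRHS]mul1r ler_wpM2r//; last exact: le_trans t't t_le1.
    by rewrite mulr_ge0 ?exprn_ge0// divr_ge0 ?mulr_ge0// ltW.
  have G00 : Gam = 0 by apply/eqP; rewrite eq_le Gn Gam_ge0.
  have [F1 [F2 [a1 a2 a3]]] := rep_split_low qstar tr' (lexx _) h3_rep.
  exists F1, F2; split=> //; first by apply: repn_le a1; [exact: ltW|rewrite ge_min lexx].
  apply: repc_le a2; first exact: ltW.
  rewrite divff ?lt0r_neq0// mul1r G00 expr0n mulr0 ge_min /s G00 mul0r mul0r.
  by rewrite lexx.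
pose B0 m : R[i] := if isB0 m then B m else 0.
pose B1 m : R[i] := if (mlen m.1 == 1%N) && (m.2 ord0 != 0) then B m else 0.
have B1_bnd : bnd (t * rho) (t * sigma) B1 KB.
  apply: bnd_coef_le B_bnd => [|m]; first exact: ltW.
  by rewrite /B1; case: ifP => _; rewrite ?cabs0 ?cabs_ge0.
have B0_bnd : bnd (t * rho) (t * sigma) B0 KB.
  apply: bnd_coef_le B_bnd => [|m]; first exact: ltW.
  by rewrite /B0; case: ifP => _; rewrite ?cabs0 ?cabs_ge0.
have B_split m : B m = B0 m + B1 m + Bn m.
  rewrite /B0 /B1 /Bn /isB0; case: (m.2 ord0 != 0); last by rewrite !andbF !add0r.
  have m0 : (m.1 == 0) = (mlen m.1 == 0%N).
    by apply/eqP/eqP => [->|/mlen0P//]; exact: mlen0.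
  rewrite !andbT m0; case: (mlen m.1) => [|[|l]] /=; rewrite ?addr0 ?add0r//.
(* The terms p C c are sorted by their dependence on q_1: p C grad S joins the q_1-dependent part of
   [B] in [v], while p C zeta joins the admissible part in [NB] and cancels its value at q*. [QC] is
   the term quadratic in c. *)
pose v j m : R[i] := vcoef j B1 m + \sum_k Cq j k * cS k m.
pose NB m : R[i] := Bn m + linc (fun j => csingle (0, 0) (- beta j)) m.
pose QC z : R[i] := 2^-1 * \sum_j \sum_k Cq j k * ev (cc j) z * ev (cc k) z.
have nb0 j : bnd (t * rho) (t * sigma) (csingle ((0, 0) : mindex n.+1) (- beta j)) ((t * rho)^-1 * KB).
  apply: bnd_csingle; first exact: ltW.
  rewrite wt.unlock /= mlen0 klen0 expr0 mul0r expR0 !mulr1 cabsN.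
  exact: beta_le.
have csg_ang (x : R[i]) : ang_only (csingle (0, 0) x : mindex n.+1 -> R[i]).
  by move=> m m0; rewrite /csingle; case: eqP => // mE; rewrite mE eqxx in m0.
have NB_bnd : bnd (t * rho) (t * sigma) NB (KB + n.+1%:R * KB).
  apply: bndD => //; first exact: ltW.
  have := bnd_linc tr nb0; rewrite sumr_const card_ord mulrA divff ?lt0r_neq0// mul1r.
  by rewrite mulr_natl.
have NB_normal : normalc qstar NB.
  split=> [m ml mk|j].
    rewrite /NB /Bn ml mk add0r /linc big1// => j _; rewrite /shiftc /csingle.
    case: eqP => // _; case: eqP => // -[] mE.
    by rewrite mE ffunE eqxx in mk.
  have -> : vcoef j NB = fun m => vcoef j Bn m + csingle (0, 0) (- beta j) m.
    apply/funext => m; rewrite /NB /vcoef; case: ifP => [m0|m0].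
      by rewrite linc_eunit; case: m m0 => i k /= /eqP ->.
    by rewrite csg_ang ?m0// addr0.
  rewrite (evD (bnd_vcoef j tr Bn_bnd) (nb0 j) (zstar_dom qstar tr ts)).
  rewrite ev_csingle mono.unlock /= [X in X * cexp _]big1 => [|l _]; last by rewrite ffunE expr0.
  rewrite [X in 'i * X]big1 => [|l _]; last by rewrite ffunE mul0r.
  by rewrite mulr0 cexp0 !mulr1 -/(beta j) subrr.
have QC_rep : repc (t' * rho) (t' * sigma) QC (n.+1%:R ^+ 2 * Cb * Gam ^+ 2).
  have hr := repZ tr' 2^-1 (rep_sum tr' (index_enum 'I_n.+1) (fun j =>
    rep_sum tr' (index_enum 'I_n.+1) (fun k =>
    repM tr' ts' (repZ tr' (Cq j k) (cc_rep j)) (cc_rep k)))).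
  apply: repc_le (repc_of_rep tr' hr); first exact: ltW.
  rewrite cabsV cabs_nat.
  apply: (@le_trans _ _ (1 * \sum_(j < n.+1) \sum_(k < n.+1) Cb * Gam * Gam)).
    apply: ler_pM; rewrite ?invr_ge0//.
    - by do 2!(apply: sumr_ge0 => ? _); rewrite !mulr_ge0// cabs_ge0.
    - by rewrite invf_le1// ler1n.
    - apply: ler_sum => j _; apply: ler_sum => k _.
      by do 2!apply: ler_wpM2r => //; exact: Cq_le.
  rewrite mul1r !sumr_const card_ord -mulrnA -[leLHS]mulr_natl natrM.
  by rewrite le_eqVlt; apply/orP; left; apply/eqP; ring.
(* omega zeta_1, produced by the linear term omega p_1, is a constant and so already normal. The
   increments of [A] and [B] are a fraction [s] of their norms and go to the new remainder. *)
exists (fun z => ev A z + ev NB z + (omega%:C * zeta ord0) + F1 z).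
exists (fun z => (ev A (Psi z) - ev A z) + (ev B (Psi z) - ev B z) + F2 z + QC z).
exists v.
have bnd_t' (c : mindex n.+1 -> R[i]) KC :
    bnd (t * rho) (t * sigma) c KC -> bnd (t' * rho) (t' * sigma) c KC.
  by apply: bnd_le => //; [exact: ltW|rewrite ler_wpM2r// ltW].
have v_ang j : ang_only (v j).
  move=> m m0; rewrite /v vcoef_ang// add0r big1// => k _.
  by rewrite cS_ang// mulr0.
have cS_Gam j : bnd (t' * rho) (t' * sigma) (cS j) Gam.
  apply: bnd_le (cS_bnd j); first exact: ltW.
  - by rewrite ler_wpM2r// ltW.
  - by rewrite lerDl ltW.
  - by rewrite GE lerDl !mulr_ge0// invr_ge0 ltW.
have v_bnd j : bnd (t' * rho) (t' * sigma) (v j) ((t' * rho)^-1 * KB + n.+1%:R * (Cb * Gam)).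
  apply: bndD; first exact: ltW.
    exact: bnd_vcoef tr' (bnd_t' _ _ B1_bnd).
  have hs := bnd_sum (index_enum 'I_n.+1) (ltW tr') (fun k => bndZ (Cq j k) (cS_Gam k)).
  apply: bnd_le hs => //; first exact: ltW.
  apply: (@le_trans _ _ (\sum_(k < n.+1) Cb * Gam)).
    by apply: ler_sum => k _; apply: ler_wpM2r => //; exact: Cq_le.
  by rewrite sumr_const card_ord mulr_natl.
split.
- apply: repnD => //.
  apply: repnD => //; last first.
    apply: repn_le (repn_cst qstar (omega%:C * zeta ord0) tr' ts'); first exact: ltW.
    by rewrite cabsM cabs_real ler_wpM2l.
  apply: repnD => //; first by exists A; split=> //; exact: bnd_t'.
  by exists NB; split=> //; exact: bnd_t'.
- apply: repcD => //; apply: repcD => //.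
  by rewrite mulrDr; apply: repcD => //; exact: substc.
- split=> //.
  + move=> j m mk; rewrite /v /vcoef /B1 /= mk eqxx andbF if_same add0r big1// => k _.
    by rewrite /cS /isB0 mk eqxx andbF mulr0.
  + move=> hr j m; rewrite /v conjD conj_sum; congr (_ + _).
      rewrite /vcoef /B1 /=; case: ifP => _; last by rewrite conjc0.
      rewrite ffunE oppr_eq0; case: ifP => _; last by rewrite conjc0.
      exact: (B_real hr (eunit j, m.2)).
    by apply: eq_bigr => k _; rewrite conjM h_real// (cS_real hr).
move=> z hz; have hPz := DPsi z hz.
have hzt : D t z by exact: D_le t't hz.
have hzr : dom rho sigma z by apply: dom_le hzt.
have hPr : dom rho sigma (Psi z) by apply: dom_le hPz.
have HE : H (Psi z) = omega%:C * act (Psi z) ord0 + ev h (Psi z) + (ev A (Psi z) + ev B (Psi z)).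
  by rewrite -(H_eq hPz) /remainder; ring.
have hE w : dom rho sigma w -> ev h w = ev (degc 2 h) w + ev h3 w.
  move=> hw; rewrite -(evD h2_bnd h3_bnd hw); apply: eq_sum => m.
  by rewrite /degc /h3; case: ifP; rewrite ?addr0 ?add0r.
have BE : ev B z = ev B0 z + ev B1 z + ev Bn z.
  rewrite -(evD B0_bnd B1_bnd hzt).
  rewrite -(evD (bndD (ltW tr) B0_bnd B1_bnd) Bn_bnd hzt).
  by apply: eq_sum => m; rewrite B_split.
have ccE j : ev (cc j) z = ev (cS j) z + zeta j.
  have trt : t' * rho <= t * rho by rewrite ler_wpM2r// ltW.
  rewrite (evD (cS_Gam j) (bnd_le (ltW tr') trt (lexx _) (lexx _) (sgl_bnd _ j)) hz).
  rewrite ev_csingle mono.unlock /= [X in X * cexp _]big1 => [|l _]; last by rewrite ffunE expr0.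
  rewrite [X in 'i * X]big1 => [|l _]; last by rewrite ffunE mul0r.
  by rewrite mulr0 cexp0 !mulr1.
have B0E : omega%:C * ev (cS ord0) z = - ev B0 z.
  rewrite -(evZ _ (cS_Gam ord0) hz) -[RHS]mulN1r -(evZ _ B0_bnd hzt).
  apply: eq_sum => m; congr (_ * _); rewrite cS_omega /B0.
  by case: ifP; rewrite mulN1r ?oppr0.
have NBE : ev NB z = ev Bn z + \sum_j act z j * \sum_k Cq j k * zeta k.
  rewrite (evD Bn_bnd (bnd_linc tr nb0) hzt) (ev_linc tr (fun j => @csg_ang _) nb0 hzt).
  congr (_ + _); apply: eq_bigr => j _; rewrite zeta_eq; congr (_ * _).
  rewrite ev_csingle mono.unlock /= [X in X * cexp _]big1 => [|l _]; last by rewrite ffunE expr0.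
  rewrite [X in 'i * X]big1 => [|l _]; last by rewrite ffunE mul0r.
  by rewrite mulr0 cexp0 !mulr1.
have B1E : ev B1 z = \sum_j act z j * ev (vcoef j B1) z.
  rewrite -(ev_linc tr (fun j => @vcoef_ang _ _ j B1) (fun j => bnd_vcoef j tr B1_bnd) hzt).
  apply: eq_sum => m; congr (_ * _); have [m1|m1] := eqVneq (mlen m.1) 1%N.
    by rewrite linc_vcoef.
  by rewrite linc_deg// /B1 (negbTE m1).
have vE j : ev (v j) z = ev (vcoef j B1) z + \sum_k Cq j k * ev (cS k) z.
  rewrite (evD (bnd_t' _ _ (bnd_vcoef j tr B1_bnd))
    (bnd_sum (index_enum 'I_n.+1) (ltW tr') (fun k => bndZ (Cq j k) (cS_Gam k))) hz).
  congr (_ + _); rewrite (ev_sum _ (fun k => bndZ (Cq j k) (cS_Gam k)) hz).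
  by apply: eq_bigr => k _; rewrite (evZ _ (cS_Gam k) hz).
have h2E : ev (degc 2 h) (Psi z) - ev (degc 2 h) z =
    \sum_j act z j * (\sum_k Cq j k * ev (cc k) z) + QC z.
  rewrite !h_quad// /QC.
  pose p j := act z j; pose q j := ev (cc j) z.
  have E1 : \sum_j \sum_k Cq j k * act (Psi z) j * act (Psi z) k =
    \sum_j \sum_k Cq j k * p j * p k + \sum_j \sum_k Cq j k * p j * q k +
    (\sum_j \sum_k Cq j k * q j * p k + \sum_j \sum_k Cq j k * q j * q k).
    rewrite -!big_split /=; apply: eq_bigr => j _; rewrite -!big_split /=.
    by apply: eq_bigr => k _; rewrite !act_shear /p /q; ring.
  have E2 : \sum_j \sum_k Cq j k * q j * p k = \sum_j \sum_k Cq j k * p j * q k.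
    rewrite exchange_big /=; apply: eq_bigr => j _; apply: eq_bigr => k _.
    by rewrite -{1}Cq_sym mxE; ring.
  have E3 : \sum_j act z j * (\sum_k Cq j k * ev (cc k) z) = \sum_j \sum_k Cq j k * p j * q k.
    apply: eq_bigr => j _; rewrite mulr_sumr; apply: eq_bigr => k _.
    by rewrite /p /q; ring.
  rewrite E1 E2 E3; set x1 := \sum_j _; set x2 := \sum_j _; set x3 := \sum_j _.
  by field.
have sumE : \sum_j act z j * (\sum_k Cq j k * ev (cc k) z) =
    \sum_j act z j * (\sum_k Cq j k * ev (cS k) z) + \sum_j act z j * \sum_k Cq j k * zeta k.
  rewrite -big_split /=; apply: eq_bigr => j _; rewrite -mulrDr; congr (_ * _).
  by rewrite -big_split /=; apply: eq_bigr => k _; rewrite ccE mulrDr.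
have vsum : \sum_j act z j * ev (v j) z =
    ev B1 z + \sum_j act z j * (\sum_k Cq j k * ev (cS k) z).
  by rewrite B1E -big_split /=; apply: eq_bigr => j _; rewrite vE mulrDr.
rewrite vsum /remainder /= HE !hE// act_shear ccE NBE.
have -> : ev (degc 2 h) (Psi z) = ev (degc 2 h) z +
    (\sum_j act z j * (\sum_k Cq j k * ev (cS k) z)
     + \sum_j act z j * (\sum_k Cq j k * zeta k) + QC z).
  by rewrite -sumE -h2E; ring.
have -> : ev h3 (Psi z) = ev h3 z + (F1 z + F2 z) by rewrite -F12//; ring.
rewrite BE.
have B0E' : ev B0 z = - (omega%:C * ev (cS ord0) z) by rewrite B0E opprK.
rewrite B0E'.
set x1 := \sum_j _; set x2 := \sum_j _.
move: (ev A (Psi z)) (ev A z) (ev B (Psi z)) (ev B1 z) (ev Bn z) (F1 z) (F2 z)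
  (QC z) (ev (cS ord0) z) (zeta ord0) (ev h3 z) (ev (degc 2 h) z) (act z ord0) x1 x2 (omega%:C).
by move=> *; ring.
Qed.

End Step.
End ShearStep.

(** * The point transformation step: dependence on q_1 in degree one *)

Section LiftStep.
Context {R : realType} {n : nat}.
Notation point := 'rV[R[i]]_(n.+1 + n.+1).
Implicit Types (a b : R) (z : point) (m : mindex n.+1) (c d : mindex n.+1 -> R[i])
  (F G : point -> R[i]).
Variable qstar : 'rV[R]_n.
Variables (rho sigma omega E0 : R).
Hypotheses (rho_gt0 : 0 < rho) (sigma_gt0 : 0 < sigma) (omega_neq0 : omega != 0)
  (E0_ge0 : 0 <= E0).
Local Notation D := (@D R n.+1 rho sigma).
Local Notation N := (n.+1%:R : R).

Lemma rep_sub a a' b b' F (M : R -> R) : 0 < a' -> a' <= a -> b' <= b ->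
  frep a b F M -> frep a' b' F M.
Proof.
move=> a0 aa bb [c [hc hF]]; exists c; split=> [x x0 xa|z hz].
  by apply: bnd_le (hc x x0 (le_trans xa aa)) => //; exact: ltW.
by apply: hF; apply: dom_le hz.
Qed.

Variables (rp : Prop) (h : mindex n.+1 -> R[i]) (H : point -> R[i]).
Variables (FA FB : point -> R[i]) (v : 'I_n.+1 -> mindex n.+1 -> R[i]) (t g KA KB Kv : R).
Hypotheses (h_deg : forall m, (mlen m.1 < 2)%N -> h m = 0) (h_bnd : bnd rho sigma h E0).
Hypotheses (g_gt0 : 0 < g) (gt : g < t) (t_le1 : t <= 1).
Hypotheses (FA_rep : repn qstar (t * rho) (t * sigma) FA KA)
  (FB_rep : repc (t * rho) (t * sigma) FB KB)
  (v_ang : forall j, ang_only (v j)) (v_dep : forall j m, m.2 ord0 = 0 -> v j m = 0)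
  (v_bnd : forall j, bnd (t * rho) (t * sigma) (v j) Kv)
  (v_real : rp -> forall j, creal (v j)).
Hypothesis H_eq : forall z, D t z ->
  remainder omega h H z = FA z + FB z + \sum_j act z j * ev (v j) z.

Let t' := t - g.
Let t'_gt0 : 0 < t'. Proof. by rewrite subr_gt0. Qed.
Let t_gt0 : 0 < t. Proof. exact: lt_trans gt. Qed.
Let tr : 0 < t * rho. Proof. exact: mulr_gt0. Qed.
Let ts : 0 < t * sigma. Proof. exact: mulr_gt0. Qed.
Let tr' : 0 < t' * rho. Proof. exact: mulr_gt0. Qed.
Let ts' : 0 < t' * sigma. Proof. exact: mulr_gt0. Qed.
Let KA_ge0 : 0 <= KA. Proof. by case: FA_rep => c [_ /bnd_ge0]. Qed.
Let KB_ge0 : 0 <= KB. Proof. by case: FB_rep => c [/bnd_ge0]. Qed.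
Let Kv_ge0 : 0 <= Kv. Proof. exact: bnd_ge0 (v_bnd ord0). Qed.
Let delta := g * sigma.
Let delta_gt0 : 0 < delta. Proof. exact: mulr_gt0. Qed.
Let B := Kv / `|omega|.
Let om0 : 0 < `|omega|. Proof. by rewrite normr_gt0. Qed.
Let B_ge0 : 0 <= B. Proof. by rewrite divr_ge0// ltW. Qed.
Let N_gt0 : 0 < N. Proof. by rewrite ltr0n. Qed.
Let N_ge1 : 1 <= N. Proof. by rewrite ler1n. Qed.

(** Kv / |omega| bounds u. One factor 1 / (g sigma) is the Cauchy estimate for Du; the other 1 / g
    makes the displacements at most a fraction [s] of the losses g rho and g sigma. The dimension
    compensates for matrix products. *)
Definition lift_size : R := 4 * n.+1%:R * (Kv / `|omega|) / (g ^+ 2 * sigma).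
Local Notation s := lift_size.

Variable eta : R.
Hypotheses (eta_gt0 : 0 < eta) (small1 : s <= eta) (small2 : s <= 2 / 5).

Let g_le1 : g <= 1. Proof. by rewrite ltW// (lt_le_trans gt). Qed.

Let s_ge0 : 0 <= s.
Proof. by rewrite /lift_size divr_ge0 ?mulr_ge0// ?exprn_ge0// ltW. Qed.

Let BE : B = s * g / N * (g * sigma) / 4.
Proof.
have [N0 w0 g0 s0] : [/\ N != 0, `|omega| != 0, g != 0 & sigma != 0] by rewrite !lt0r_neq0.
rewrite /lift_size /B; move: N `|omega| N0 w0 => x w x0 w0.
by field; rewrite x0 w0 g0 s0.
Qed.

Let mu_dE : B / delta = s * g / N / 4.
Proof.
have [g0 s0] : g != 0 /\ sigma != 0 by rewrite !lt0r_neq0.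
rewrite BE /delta; move: (s * g / N) => x.
by field; rewrite g0 s0.
Qed.

Let muE : B / (delta / 2) = s * g / N / 2.
Proof.
have -> : B / (delta / 2) = 2 * (B / delta) by rewrite invf_div mulrCA.
by rewrite mu_dE; move: (s * g / N) => x; field.
Qed.

Let sgN : s * g / N <= s * g.
Proof.
rewrite ler_pdivrMr// -[leLHS]mulr1; apply: ler_wpM2l => //.
by apply: mulr_ge0 => //; exact: ltW.
Qed.
Let sgN0 : 0 <= s * g / N.
Proof. by apply: divr_ge0; [apply: mulr_ge0 => //; exact: ltW|exact: ltW]. Qed.
Let sg_le : s * g <= s.
Proof. by rewrite -[leRHS]mulr1; exact: ler_wpM2l. Qed.

(* Solves omega d_1 u_j = v_j; as v_j has no term with k_1 = 0, the division is
   harmless (0 / 0 = 0). *)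
Let uc j m : R[i] := v j m / ('i * omega%:C * (m.2 ord0)%:~R).

Let o0 : omega%:C != 0.
Proof. by rewrite -(rmorph0 (real_complex R)) (inj_eq (@complexI R)). Qed.

Let i0 : 'i != 0 :> R[i].
Proof. by apply/eqP => /(congr1 (@cabs R))/eqP; rewrite cabs_i cabs0 oner_eq0. Qed.

Let uc_ang j : ang_only (uc j).
Proof. by move=> m m0; rewrite /uc v_ang// mul0r. Qed.

Let uc_bnd b j : b <= t * sigma -> bnd rho b (uc j) B.
Proof.
move=> hb; apply: (@bnd_ang _ _ (t * rho) rho b B _ (uc_ang j)).
have hv := v_bnd j.
have hvb : bnd (t * rho) b (v j) Kv by apply: bnd_le (v_bnd j) => //; exact: ltW.
have oi : 0 <= `|omega|^-1 by rewrite invr_ge0 ltW.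
have -> : B = `|omega|^-1 * Kv by rewrite /B mulrC.
apply: rbound_le (rboundZ oi hvb) => // m.
rewrite mulrA; apply: ler_wpM2r; first by rewrite wt_ge0// ltW.
rewrite /uc; have [m0|m0] := eqVneq (m.2 ord0) 0.
  by rewrite v_dep// mul0r cabs0 mulr0.
rewrite (cabsM (v j m)) mulrC; apply: ler_wpM2r; first exact: cabs_ge0.
have -> : cabs ('i * omega%:C * (m.2 ord0)%:~R)^-1 =
    (`|omega| * (`|m.2 ord0|%N)%:R)^-1.
  by rewrite cabsV cabsM (cabsM 'i) cabs_i mul1r cabs_real cabs_int.
have k1 : 1 <= (`|m.2 ord0|%N)%:R :> R by rewrite ler1n absz_gt0.
rewrite invfM -[leRHS]mulr1; apply: ler_wpM2l => //.
by rewrite invf_le1//; exact: lt_le_trans k1.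
Qed.

Let uc_dang j m : omega%:C * dang ord0 (uc j) m = v j m.
Proof.
rewrite /dang /uc; have [m0|m0] := eqVneq (m.2 ord0) 0.
  by rewrite v_dep// mul0r !mulr0.
have k0 : (m.2 ord0)%:~R != 0 :> R[i] by rewrite intr_eq0.
by field; rewrite i0 o0 k0.
Qed.

Let uc_real : rp -> forall j, creal (uc j).
Proof.
move=> hr j m; rewrite /uc /= ffunE (v_real hr) conjM; congr (_ * _).
have cV (x : R[i]) : conjc x^-1 = (conjc x)^-1 by rewrite fmorphV.
rewrite cV; congr (_ ^-1); rewrite !conjM conj_i conjc_real conj_int.
by rewrite mulrNz; ring.
Qed.

Let tE : t' * sigma + delta = t * sigma.
Proof. by rewrite /t' /delta; ring. Qed.

Let uc_bd j : bnd rho (t' * sigma + delta) (uc j) B.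
Proof. by apply: uc_bnd; rewrite tE. Qed.

Let nmu : N * (B / (delta / 2)) = s * g / 2.
Proof. by rewrite muE mulrA mulrCA divff ?mulr1// lt0r_neq0. Qed.

Let nmu_half : N * (B / (delta / 2)) <= 1 / 2.
Proof.
rewrite nmu; apply: ler_pM => //; first by apply: mulr_ge0 => //; exact: ltW.
by apply: le_trans sg_le _; apply: le_trans small2 _; lra.
Qed.

Lemma lift_step : exists Psi, near_identity rho sigma rp t' eta Psi /\
  (forall z, D t' z -> D t (Psi z)) /\
  exists FA' FB', [/\ repn qstar (t' * rho) (t' * sigma) FA' (KA + s * E0),
    repc (t' * rho) (t' * sigma) FB'
      (s * KA + (KB + s * KB + s * (n.+1%:R * (t * rho * Kv))) + `|omega| * rho * s ^+ 2
       + 4 * E0 * s ^+ 2)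
    & forall z, D t' z -> remainder omega h (H \o Psi) z = FA' z + FB' z].
Proof.
pose Psi := cotangent_lift uc; exists Psi.
have Bes : B <= eta * sigma.
  rewrite BE; apply: (@le_trans _ _ (s * sigma)); last by rewrite ler_wpM2r// ltW.
  have -> : s * g / N * (g * sigma) / 4 = (s * g / N) * (sigma * (g / 4)) by ring.
  apply: ler_pM => //; first by rewrite !mulr_ge0 ?ltW.
    exact: le_trans sg_le.
  by rewrite ger_pMr// ler_pdivrMr// mul1r (le_trans g_le1)// ler1n.
have mu_eta : 2 * (N * (B / (delta / 2))) <= eta.
  by rewrite nmu mulrCA divff ?mulr1 ?pnatr_eq0//; apply: le_trans small1.
(* Origin of 2/5: B / delta <= s / 4, and the contraction of the angle map asks for 5 B / delta <=
   1/2. *)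
have B5 : 5 * (B / delta) <= 1 / 2.
  rewrite mu_dE.
  have hx (x : R) : x <= 2 / 5 -> 5 * (x / 4) <= 1 / 2 by lra.
  exact: hx (le_trans sgN (le_trans sg_le small2)).
have t't : t' <= t by rewrite /t' gerBl ltW.
split; first exact: (lift_near_identity rho_gt0 sigma_gt0 t'_gt0 (le_trans t't t_le1) eta_gt0 delta_gt0 B_ge0
  uc_ang uc_bd Bes nmu_half mu_eta B5 uc_real).
pose A1 z : 'M[R[i]]_n.+1 := lift_inv uc z - 1%:M.
have t'r : t' * rho <= rho.
  by rewrite -[leRHS]mul1r ler_wpM2r//; [exact: ltW|exact: le_trans t_le1].
have A1_rep k j : frep (t' * rho) (t' * sigma) (fun z => A1 z k j) (fun=> s * g / N).
  have hr := lift_inv_rep rho_gt0 sigma_gt0 t'_gt0 delta_gt0 B_ge0 uc_bd nmu_half k j.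
  rewrite muE mulrCA divff ?mulr1 ?pnatr_eq0// in hr.
  by apply: rep_sub hr => //; rewrite lerDl divr_ge0// ltW.
pose d (j : 'I_n.+1) z := \sum_k act z k * A1 z k j.
pose u (j : 'I_n.+1) z := ev (uc j) z.
(* The lift is linear in the actions, so their displacement is proportional to the radius and the
   second-order vanishing of [h] survives. *)
pose gam (a : R) := a * (s * g).
have act_Psi z : dom (t' * rho) (t' * sigma) z ->
    forall j, act (Psi z) j = act z j + d j z.
  move=> _ j; rewrite /Psi act_lift /d /A1.
  have -> : lift_inv uc z = 1%:M + (lift_inv uc z - 1%:M) by rewrite addrC subrK.
  rewrite mulmxDr mulmx1 mxE; congr (_ + _); rewrite mxE.
  by apply: eq_bigr => k _; rewrite [in RHS]addrC addKr.
have ang_Psi z : dom (t' * rho) (t' * sigma) z ->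
    forall j, ang (Psi z) j = ang z j + u j z by move=> _ j; exact: ang_lift.
have d_rep j : frep (t' * rho) (t' * sigma) (d j) gam.
  have hs := rep_sum tr' (index_enum 'I_n.+1) (fun k =>
    repM tr' ts' (rep_act (t' * rho) (t' * sigma) k) (A1_rep k j)).
  apply: rep_le hs => a a0 aa; rewrite sumr_const card_ord -mulr_natl /gam.
  by rewrite le_eqVlt; apply/orP; left; apply/eqP; field; rewrite lt0r_neq0.
have u_rep j : frep (t' * rho) (t' * sigma) (u j) (fun=> B).
  exists (uc j); split=> // a a0 aa; apply: bnd_ang (uc_ang j) (_ : bnd rho _ _ _).
  by apply: uc_bnd; rewrite ler_wpM2r// ltW.
have tt' : t' * rho + g * rho = t * rho by rewrite /t' -mulrDl subrK.
have gamP a : 0 < a -> a <= t' * rho -> 0 <= gam a <= s * (g * rho).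
  move=> a0 aa; have sg0 : 0 <= s * g by apply: mulr_ge0 => //; exact: ltW.
  rewrite /gam; apply/andP; split; first by apply: mulr_ge0 => //; exact: ltW.
  rewrite mulrC mulrA; apply: ler_wpM2l => //.
  exact: le_trans aa t'r.
have s_le1 : s <= 1 by apply: le_trans small2 _; lra.
have s01 : 0 <= s <= 1 by apply/andP.
have Bs : B <= s * (g * sigma).
  rewrite BE; have -> : s * g / N * (g * sigma) / 4 = (s * g / N) * (g * sigma / 4) by ring.
  have gs : 0 < g * sigma by exact: mulr_gt0.
  apply: ler_pM => //; first by apply: divr_ge0 => //; exact: ltW.
    exact: le_trans sg_le.
  by rewrite ler_pdivrMr// ler_peMr// ?ler1n// ltW.
have upsP : 0 <= B <= s * (g * sigma) by apply/andP.
have tts : t' * sigma + g * sigma = t * sigma by rewrite /t' -mulrDl subrK.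
have grw : 0 <= g * rho by rewrite mulr_ge0// ltW.
have gsw : 0 <= g * sigma by rewrite mulr_ge0// ltW.
have gam_t a : 0 < a -> a <= t' * rho -> a + gam a <= t * rho.
  move=> a0 aa; rewrite -tt'; apply: lerD => //.
  have /andP[_ ha] := gamP a a0 aa; apply: le_trans ha _.
  by rewrite -[leRHS]mul1r; apply: ler_wpM2r.
have B_t : t' * sigma + B <= t * sigma.
  rewrite -tts lerD2l; apply: le_trans Bs _.
  by rewrite -[leRHS]mul1r; apply: ler_wpM2r.
have DPsi z : D t' z -> D t (Psi z).
  move=> hz; have := subst_dom tr' act_Psi ang_Psi d_rep u_rep hz.
  by apply: dom_le => //; exact: gam_t.
split=> //.
have subst (c : mindex n.+1 -> R[i]) KC M : bnd (t * rho) (t * sigma) c KC ->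
    (forall a, 0 < a -> a <= t' * rho -> bnd (a + gam a) (t' * sigma + B) c (M a)) ->
    frep (t' * rho) (t' * sigma) (fun z => ev c (Psi z) - ev c z)
      (fun a => Num.min (s * KC) (M a)).
  move=> hc hM.
  apply: (rep_subst_small tr' ts' act_Psi ang_Psi d_rep u_rep gamP upsP s01 grw gsw _ hM).
  by rewrite tt' tts.
have a_gam a : 0 < a -> a <= t' * rho -> 0 <= a + gam a.
  move=> a0 aa; have /andP[ha _] := gamP a a0 aa.
  by apply: addr_ge0 => //; exact: ltW.
have substc (c : mindex n.+1 -> R[i]) KC : bnd (t * rho) (t * sigma) c KC ->
    repc (t' * rho) (t' * sigma) (fun z => ev c (Psi z) - ev c z) (s * KC).
  move=> hc; apply: (repc_le (ltW tr') _ (repc_of_rep tr' (subst c KC (fun=> KC) hc _))).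
    by rewrite ge_min lexx.
  by move=> a a0 aa; apply: bnd_le hc => //; [exact: a_gam|exact: gam_t].
have trle : t * rho <= rho by rewrite -[leRHS]mul1r ler_wpM2r// ltW.
have tsle : t * sigma <= sigma by rewrite -[leRHS]mul1r ler_wpM2r// ltW.
have h_bt : bnd (t * rho) (t * sigma) h E0 by apply: bnd_le h_bnd => //; exact: ltW.
have hM a : 0 < a -> a <= t' * rho ->
    bnd (a + gam a) (t' * sigma + B) h ((2 * a / rho) ^+ 2 * E0).
  move=> a0 aa.
  have ha : bnd (a + gam a) (t' * sigma + B) h (((a + gam a) / rho) ^+ 2 * E0).
    apply: bnd_deg => //; first exact: a_gam.
      exact: le_trans (gam_t a a0 aa) trle.
    by apply: bnd_le h_bnd => //; [exact: ltW|exact: le_trans B_t tsle].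
  apply: rbound_le ha => //; apply: ler_wpM2r => //.
  have g2 : gam a <= a.
    rewrite /gam -[leRHS]mulr1; apply: ler_wpM2l; first exact: ltW.
    exact: le_trans sg_le s_le1.
  have ri : 0 <= rho^-1 by rewrite invr_ge0 ltW.
  have x0 : 0 <= (a + gam a) / rho by apply: mulr_ge0 => //; exact: a_gam.
  have xy : (a + gam a) / rho <= 2 * a / rho.
    by apply: ler_wpM2r => //; rewrite (_ : 2 * a = a + a) ?lerD2l//; ring.
  by apply: lerXn2r; rewrite ?nnegrE//; exact: le_trans xy.
have h_rep := subst h E0 (fun a => (2 * a / rho) ^+ 2 * E0) h_bt hM.
have [F1 [F2 [F1n F2c F12]]] : exists F1 F2,
    [/\ repn qstar (t' * rho) (t' * sigma) F1 (s * E0),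
        repc (t' * rho) (t' * sigma) F2 (4 * E0 * s ^+ 2) &
        forall z, dom (t' * rho) (t' * sigma) z -> ev h (Psi z) - ev h z = F1 z + F2 z].
  have [sp|sn] := ltP 0 s.
    have s2 : 0 < s ^+ 2 by rewrite exprn_gt0.
    (* The majorant (2 nu / rho)^2 E0 times the rescaling cost t' rho / nu is linear in nu; nu = s^2
       t' rho makes it O(s^2). *)
    have nu0 : 0 < s ^+ 2 * (t' * rho) by exact: mulr_gt0.
    have nule : s ^+ 2 * (t' * rho) <= t' * rho.
      rewrite -[leRHS]mul1r; apply: ler_wpM2r; first exact: ltW.
      by rewrite expr_le1.
    have [F1 [F2 [a1 a2 a3]]] := rep_split_low qstar nu0 nule h_rep.
    exists F1, F2; split=> //; first by apply: repn_le a1; [exact: ltW|rewrite ge_min lexx].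
    apply: repc_le a2; first exact: ltW.
    set nu := s ^+ 2 * (t' * rho).
    apply: (@le_trans _ _ (t' * rho / nu * ((2 * nu / rho) ^+ 2 * E0))).
      by apply: ler_wpM2l; [rewrite divr_ge0// ltW|rewrite ge_min lexx orbT].
    have -> : t' * rho / nu * ((2 * nu / rho) ^+ 2 * E0) = t' ^+ 2 * (4 * E0 * s ^+ 2).
      by rewrite /nu; field; rewrite !lt0r_neq0.
    rewrite -[leRHS]mul1r; apply: ler_wpM2r.
      by apply: mulr_ge0; [exact: mulr_ge0|exact: ltW].
    by rewrite expr_le1//; [exact: le_trans t't t_le1|exact: ltW].
  have s0 : s = 0 by apply/eqP; rewrite eq_le sn s_ge0.
  have [F1 [F2 [a1 a2 a3]]] := rep_split_low qstar tr' (lexx _) h_rep.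
  exists F1, F2; split=> //; first by apply: repn_le a1; [exact: ltW|rewrite ge_min lexx].
  apply: repc_le a2; first exact: ltW.
  by rewrite divff ?lt0r_neq0// mul1r s0 expr0n mulr0 mul0r ge_min lexx.
have M_rep k l : frep (t' * rho) (t' * sigma) (fun z => lift_mx uc z k l) (fun=> s * g / N).
  have hd a : 0 < a -> a <= t' * rho -> bnd a (t' * sigma) (dang l (uc k)) (B / delta).
    move=> a0 aa; apply: bnd_dang => //; first exact: ltW.
    by apply: bnd_le (uc_bd k) => //; [exact: ltW|exact: le_trans t'r].
  have BE4 : B / delta <= s * g / N.
    by rewrite mu_dE ler_pdivrMr// ler_peMr// ler1n.
  exists (dang l (uc k)); split=> [a a0 aa|z hz]; last by rewrite mxE.
  by apply: rbound_le (hd a a0 aa).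
(* With M = Du, A1 = - M - M A1. The first term changes omega p_1 by - omega sum p_k d_1 u_k = - sum
   p_k v_k, which cancels the term to be removed; the second gives - [Q2], quadratic in u. *)
pose Q2 z := omega%:C * \sum_k act z k * \sum_l lift_mx uc z k l * A1 z l ord0.
have Q2_rep : repc (t' * rho) (t' * sigma) Q2 (`|omega| * rho * s ^+ 2).
  have hr := repZ tr' omega%:C (rep_sum tr' (index_enum 'I_n.+1) (fun k =>
    repM tr' ts' (rep_act (t' * rho) (t' * sigma) k)
      (rep_sum tr' (index_enum 'I_n.+1) (fun l =>
         repM tr' ts' (M_rep k l) (A1_rep l ord0))))).
  apply: repc_le (repc_of_rep tr' hr); first exact: ltW.
  have natE (x : R) : x *+ n.+1 = N * x by rewrite mulr_natl.
  rewrite cabs_real sumr_const card_ord sumr_const card_ord.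
  rewrite (natE (t' * rho * _)) (natE (s * g / N * _)).
  have -> : `|omega| * (N * (t' * rho * (N * (s * g / N * (s * g / N))))) =
      `|omega| * (rho * s ^+ 2) * (t' * g ^+ 2).
    have N0 : N != 0 by rewrite lt0r_neq0.
    by move: s N N0 => x y y0; field.
  have t'1 : t' <= 1 by exact: le_trans t't t_le1.
  have g2 : g ^+ 2 <= 1 by rewrite expr_le1// ltW.
  have tg : t' * g ^+ 2 <= 1.
    by rewrite -[leRHS]mulr1; apply: ler_pM => //; [exact: ltW|rewrite exprn_ge0// ltW].
  rewrite -[leRHS]mulr1 -[in leRHS](mulrA `|omega|); apply: ler_wpM2l => //.
  by apply: mulr_ge0; [exact: ltW|apply: mulr_ge0; [exact: ltW|exact: exprn_ge0]].
case: FA_rep => cA [cA_n cA_b cA_E]; case: FB_rep => cB [cB_b cB_E].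
have bnd_t' (c : mindex n.+1 -> R[i]) KC :
    bnd (t * rho) (t * sigma) c KC -> bnd (t' * rho) (t' * sigma) c KC.
  by apply: bnd_le => //; [exact: ltW|rewrite ler_wpM2r// ltW|rewrite ler_wpM2r// ltW].
have lv_b : bnd (t * rho) (t * sigma) (linc v) (N * (t * rho * Kv)).
  by rewrite mulr_natl; have := bnd_linc tr v_bnd; rewrite sumr_const card_ord.
exists (fun z => ev cA z + F1 z).
exists (fun z => (ev cA (Psi z) - ev cA z) + (ev cB z + (ev cB (Psi z) - ev cB z)
  + (ev (linc v) (Psi z) - ev (linc v) z)) + - 1 * Q2 z + F2 z).
split.
- by apply: repnD => //; exists cA; split=> //; exact: bnd_t'.
- apply: repcD => //; apply: repcD => //; last first.
    apply: repc_le (repc_of_rep tr' (repZ tr' (- 1) (rep_of_repc tr' Q2_rep))).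
      exact: ltW.
    by rewrite cabsN cabs1 mul1r.
  apply: repcD => //; first exact: substc.
  apply: repcD => //; last exact: substc.
  apply: repcD => //; last exact: substc.
  by exists cB; split=> //; exact: bnd_t'.
move=> z hz; have hPz := DPsi z hz.
have hzt : D t z by exact: D_le t't hz.
have HE : H (Psi z) = omega%:C * act (Psi z) ord0 + ev h (Psi z) +
    (ev cA (Psi z) + ev cB (Psi z) + ev (linc v) (Psi z)).
  rewrite (ev_linc tr v_ang v_bnd hPz) -cA_E// -cB_E// -(H_eq hPz) /remainder; ring.
have vE k : omega%:C * lift_mx uc z k ord0 = ev (v k) z.
  have hd : bnd (t' * rho) (t' * sigma) (dang ord0 (uc k)) (B / delta).
    apply: bnd_dang => //; first exact: ltW.
    by apply: bnd_le (uc_bd k) => //; exact: ltW.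
  rewrite mxE -(evZ omega%:C hd hz); apply: eq_sum => m; congr (_ * _).
  exact: uc_dang.
have A1E k : A1 z k ord0 = - (lift_mx uc z k ord0 + \sum_l lift_mx uc z k l * A1 z l ord0).
  have hu : 1%:M + lift_mx uc z \in unitmx.
    apply: (lift_unit rho_gt0 sigma_gt0 t'_gt0 delta_gt0 B_ge0 uc_ang uc_bd nmu_half).
    by move=> j; apply: lt_le_trans (D_strip hz j) _; rewrite lerDl divr_ge0// ltW.
  have hm : A1 z = - (lift_mx uc z + lift_mx uc z *m A1 z).
    have e1 : (1%:M + lift_mx uc z) *m (1%:M + A1 z) = 1%:M.
      have -> : 1%:M + A1 z = lift_inv uc z by rewrite /A1 addrC subrK.
      by rewrite /lift_inv mulmxV.
    move: e1; rewrite mulmxDl mul1mx mulmxDr mulmx1 -addrA => /eqP.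
    rewrite -subr_eq0 addrAC subrr add0r => e1.
    by apply/eqP; rewrite -addr_eq0.
  by rewrite {1}hm !mxE.
have dE : omega%:C * (act (Psi z) ord0 - act z ord0) = - ev (linc v) z - Q2 z.
  rewrite (ev_linc tr v_ang v_bnd hzt) act_Psi// addrC addKr /d /Q2.
  rewrite !mulr_sumr -sumrN -sumrB; apply: eq_bigr => k _.
  by rewrite A1E -vE; ring.
have hE : ev h (Psi z) = ev h z + (F1 z + F2 z) by rewrite -F12//; ring.
rewrite /remainder /= HE hE.
have -> : omega%:C * act (Psi z) ord0 = omega%:C * act z ord0 + (- ev (linc v) z - Q2 z).
  by rewrite -dE; ring.
ring.
Qed.

End LiftStep.

Section StateOfReps.
Context {R : realType} {n : nat}.
Notation point := 'rV[R[i]]_(n.+1 + n.+1).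

(** Under [rp] both parts are replaced by their averages with the reflected series. [FA] and [FB]
    may change, but their sum does not, because [F] itself commutes with conjugation. *)
Lemma state_of_reps (qstar : 'rV[R]_n) (rho sigma : R) (rp : Prop) (F FA FB : point -> R[i])
    (t KA KB : R) : 0 < rho -> 0 < sigma -> 0 < t ->
  repn qstar (t * rho) (t * sigma) FA KA -> repc (t * rho) (t * sigma) FB KB ->
  (forall z, D rho sigma t z -> F z = FA z + FB z) ->
  (rp -> forall z, D rho sigma t z -> F (conjv z) = conjc (F z)) ->
  state qstar rho sigma rp F t KA KB.
Proof.
move=> r0 s0 t0 [A [A_n A_b A_E]] [B [B_b B_E]] FE Fr.
have tr : 0 < t * rho by exact: mulr_gt0.
have ts : 0 < t * sigma by exact: mulr_gt0.
have [hr|nr] := pselect rp; last first.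
  by exists A, B; split=> // z hz; rewrite FE// A_E// B_E.
exists (creal_part A), (creal_part B); split.
- have hs := bnd_cstar A_b.
  have hn := normalcD tr ts A_b hs A_n (normalc_cstar tr ts A_b A_n).
  exact: normalcZ tr ts (bndD (ltW tr) A_b hs) hn.
- by apply: bnd_creal_part => //; exact: ltW.
- by apply: bnd_creal_part => //; exact: ltW.
- move=> z hz; have hcz := dom_conjv hz.
  rewrite (ev_creal_part (ltW tr) A_b hz) (ev_creal_part (ltW tr) B_b hz).
  rewrite -mulrDr addrACA -A_E// -B_E// -FE// -conjD -A_E// -B_E// -FE//.
  by rewrite Fr// conjcK; field.
- by move=> _; split; exact: creal_part_creal.
Qed.

End StateOfReps.

Ltac nonneg := repeat first
  [ assumption | apply: ltW; assumption | apply: ler0n | apply: ler01 | apply: normr_ge0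
  | apply: exprn_ge0 | rewrite invr_ge0 | apply: mulr_ge0 | apply: addr_ge0 ].

(** * Uniform constants and induction on the stages *)

Section Iteration.
Context {R : realType} {n : nat}.
Notation point := 'rV[R[i]]_(n.+1 + n.+1).
Variable qstar : 'rV[R]_n.
Variables (rho sigma omega E0 Cb Ci : R).
Hypotheses (rho_gt0 : 0 < rho) (sigma_gt0 : 0 < sigma) (omega_neq0 : omega != 0)
  (E0_ge0 : 0 <= E0) (Cb_ge0 : 0 <= Cb) (Ci_ge0 : 0 <= Ci).
Local Notation D := (@D R n.+1 rho sigma).
Local Notation N := (n.+1%:R : R).
Local Notation state := (state qstar rho sigma).
Local Notation remainder := (remainder omega).

Definition real_symmetric (F : point -> R[i]) (t : R) :=
  forall z, D t z -> F (conjv z) = conjc (F z).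

Lemma remainder_real (h : mindex n.+1 -> R[i]) (H : point -> R[i]) (t : R) :
  0 < t -> t <= 1 -> bnd rho sigma h E0 -> creal h ->
  real_symmetric H t -> real_symmetric (remainder h H) t.
Proof.
move=> t0 t1 hb hr hH z hz; rewrite /remainder hH// !conjD !conjN conjM conjc_real act_conjv.
congr (_ - _); apply: (ev_creal hr hb).
by apply: dom_le hz; rewrite -[leRHS]mul1r ler_wpM2r// ltW.
Qed.

Lemma near_identity_dom (rp : Prop) (t g : R) Psi z : 0 < t ->
  near_identity rho sigma rp t g Psi -> D t z -> D (t + g) (Psi z).
Proof. by move=> t0 [_ h _ _] hz; exact: h. Qed.

Lemma real_symmetric_comp (rp : Prop) (H : point -> R[i]) (t t' g : R) Psi :
  t' <= t -> rp -> near_identity rho sigma rp t' g Psi -> (forall z, D t' z -> D t (Psi z)) ->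
  real_symmetric H t -> real_symmetric (H \o Psi) t'.
Proof. by move=> tt hr [_ _ _ hP] hD hH z hz /=; rewrite hP// hH//; exact: hD. Qed.

(** The constants precede [eps], [kap], [h], [Cq] and [H]: the Hamiltonian varies with eps, so the
    threshold has to be uniform. The shear and the lift each consume [g]. *)
Lemma full_step (t g K : R) : 0 < g -> 2 * g < t -> t <= 1 -> 0 <= K ->
  exists2 e0 : R, 0 < e0 & exists2 K' : R, 0 <= K' &
  forall (eps kap : R) (rp : Prop) h Cq (H : point -> R[i]),
    0 <= kap -> kap <= eps -> eps < e0 ->
    unperturbed rho sigma E0 Cb Ci h Cq ->
    (rp -> (forall j k, conjc (Cq j k) = Cq j k) /\ creal h /\ real_symmetric H t) ->
    state rp (remainder h H) t (K * eps) (K * kap) ->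
    exists Psi, near_identity rho sigma rp (t - 2 * g) (2 * g) Psi /\
      state rp (remainder h (H \o Psi)) (t - 2 * g) (K' * eps) (K' * (kap * eps)).
Proof.
move=> g0 gt t1 K0.
have om0 : 0 < `|omega| by rewrite normr_gt0.
have gt1 : g < t by apply: lt_trans gt; rewrite mulr_natl mulr2n ltrDl.
have tg0 : 0 < t - g by rewrite subr_gt0.
have gtg : g < t - g by rewrite ltrBrDr -mulr2n -[ltLHS]mulr_natl.
have t0 : 0 < t by exact: lt_trans gt1.
have tg_le : t - g <= t by rewrite gerBl ltW.
have tgg : t - g - g = t - 2 * g by ring.
have tgg0 : 0 < t - g - g by rewrite subr_gt0.
pose G0 := shear_gain rho sigma omega Ci t g.
have G00 : 0 <= G0.
  by rewrite /G0 /shear_gain; nonneg.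
pose GK := K * G0.
have GK0 : 0 <= GK by exact: mulr_ge0.
pose w := GK / (g * rho).
have w0 : 0 <= w by rewrite divr_ge0// ltW// mulr_gt0.
pose a1 := K + (K + (K + N * K) + `|omega| * (Ci * ((t * rho)^-1 * K)) + w * E0).
pose b1 := w * (K + K) + 8 * E0 / rho ^+ 2 * GK ^+ 2 + N ^+ 2 * Cb * GK ^+ 2.
pose v1 := ((t - g) * rho)^-1 * K + N * (Cb * GK).
pose s1 := 4 * N * (v1 / `|omega|) / (g ^+ 2 * sigma).
have i1 : 0 <= (t * rho)^-1 by rewrite invr_ge0 ltW// mulr_gt0.
have i2 : 0 <= ((t - g) * rho)^-1 by rewrite invr_ge0 ltW// mulr_gt0.
have a10 : 0 <= a1.
  by rewrite /a1; nonneg.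
have r20 : 0 <= 8 * E0 / rho ^+ 2 by nonneg.
have b10 : 0 <= b1.
  by rewrite /b1; nonneg.
have v10 : 0 <= v1 by rewrite /v1; nonneg.
have s10 : 0 <= s1.
  by rewrite /s1; nonneg.
pose a2 := a1 + s1 * E0.
pose b2 := s1 * a1 + (b1 + s1 * b1 + s1 * (N * ((t - g) * rho * v1))) +
  `|omega| * rho * s1 ^+ 2 + 4 * E0 * s1 ^+ 2.
have a20 : 0 <= a2 by rewrite /a2; nonneg.
have b20 : 0 <= b2 by rewrite /b2; nonneg.
(* Every smallness condition of the two maps reads x kap <= b, and X dominates each quotient x / b;
   the leading 1 yields kap <= 1. *)
pose X := 1 + (w + GK / ((t - g) * rho) + s1 / g + s1 / (2 / 5)).
have z1 : 0 <= GK / ((t - g) * rho) by nonneg.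
have z2 : 0 <= s1 / g by rewrite divr_ge0// ltW.
have z3 : 0 <= s1 / (2 / 5) by rewrite divr_ge0// divr_ge0.
have X1 : 1 <= X by rewrite lerDl !addr_ge0.
have X0 : 0 < X by exact: lt_le_trans X1.
exists X^-1; first by rewrite invr_gt0.
exists (a2 + b2); first exact: addr_ge0.
move=> eps kap rp h Cq H k0 ke eX hC hr [A [B [A_n A_b B_b FE AB_r]]].
have e0 : 0 <= eps by exact: le_trans ke.
have kX : kap * X <= 1.
  by rewrite -ler_pdivlMr// mul1r ltW// (le_lt_trans ke).
have small (x b : R) : 0 <= x -> 0 < b -> x / b <= X -> x * kap <= b.
  move=> x0 b0 xb; rewrite -[leRHS]mul1r -ler_pdivrMr// mulrAC mulrC.
  by apply: le_trans kX; apply: ler_wpM2l.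
have kap1 : kap <= 1.
  by apply: le_trans kX; rewrite -[leLHS]mulr1; apply: ler_wpM2l.
have GE : K * kap * shear_gain rho sigma omega Ci t g = GK * kap.
  by rewrite /GK /G0; ring.
have lin (x1 x2 x3 x4 : R) : 0 <= x1 -> 0 <= x2 -> 0 <= x3 -> 0 <= x4 ->
    [/\ x1 <= 1 + (x1 + x2 + x3 + x4), x2 <= 1 + (x1 + x2 + x3 + x4),
        x3 <= 1 + (x1 + x2 + x3 + x4) & x4 <= 1 + (x1 + x2 + x3 + x4)].
  by move=> *; split; lra.
have [l1 l2 l3 l4] := lin _ _ _ _ w0 z1 z2 z3.
have sm1 : GK * kap <= g * rho by apply: small => //; exact: mulr_gt0.
have sm2 : GK * kap <= (t - g) * rho by apply: small => //; exact: mulr_gt0.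
have sm3 : s1 * kap <= g by exact: small.
have sm4 : s1 * kap <= 2 / 5 by apply: small => //; exact: divr_gt0.
have hCr : rp -> forall j k, conjc (Cq j k) = Cq j k by move=> /hr [].
have Br : rp -> creal B by move=> /AB_r [].
have := @shear_step R n qstar rho sigma omega E0 Cb Ci rho_gt0 sigma_gt0 omega_neq0 E0_ge0
  Ci_ge0 rp h Cq H A B t g (K * eps) (K * kap) hC hCr g0 gt1 t1 A_n A_b B_b FE Br
  g g0.
rewrite GE => /(_ sm1 sm1 sm2) [Psi1 [ni1 [D1 [FA [FB [v [FA_r FB_r [v_a v_d v_b v_r] F1E]]]]]]].
have [h_deg h_bnd _ _ _] := hC.
have kk : kap * kap <= kap * eps by exact: ler_wpM2l.
have FA_r1 : repn qstar ((t - g) * rho) ((t - g) * sigma) FA (a1 * eps).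
  apply: repn_le FA_r; first by rewrite ltW// mulr_gt0.
  have -> : K * eps + (K * kap + N * (K * kap)) + `|omega| * (Ci * ((t * rho)^-1 * (K * kap)))
    + GK * kap / (g * rho) * E0 = K * eps + (K + N * K + `|omega| * (Ci * ((t * rho)^-1 * K)) + w * E0) * kap.
    by rewrite /w; ring.
  set y := _ + w * E0; have y0 : 0 <= y by rewrite /y; nonneg.
  have -> : a1 = K + (K + y) by rewrite /a1 /y; ring.
  move: (y) y0 => {}y y0; rewrite (mulrDl K) lerD2l; apply: (@le_trans _ _ (y * eps)); first exact: ler_wpM2l.
  by apply: ler_wpM2r => //; rewrite lerDr.
have FB_r1 : repc ((t - g) * rho) ((t - g) * sigma) FB (b1 * (kap * eps)).
  apply: repc_le FB_r; first by rewrite ltW// mulr_gt0.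
  have -> : GK * kap / (g * rho) * (K * eps + K * kap) + 8 * E0 / rho ^+ 2 * (GK * kap) ^+ 2 +
    N ^+ 2 * Cb * (GK * kap) ^+ 2 = w * K * (kap * eps) + w * K * (kap * kap) +
    8 * E0 / rho ^+ 2 * GK ^+ 2 * (kap * kap) + N ^+ 2 * Cb * GK ^+ 2 * (kap * kap).
    by rewrite /w !exprMn [kap ^+ 2]expr2; ring.
  have -> : b1 * (kap * eps) = w * K * (kap * eps) + w * K * (kap * eps) +
    8 * E0 / rho ^+ 2 * GK ^+ 2 * (kap * eps) + N ^+ 2 * Cb * GK ^+ 2 * (kap * eps).
    by rewrite /b1; ring.
  have p1 : 0 <= w * K by exact: mulr_ge0.
  have p2 : 0 <= 8 * E0 / rho ^+ 2 * GK ^+ 2 by apply: mulr_ge0 => //; exact: exprn_ge0.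
  have p3 : 0 <= N ^+ 2 * Cb * GK ^+ 2.
    by apply: mulr_ge0; [apply: mulr_ge0 => //; exact: exprn_ge0|exact: exprn_ge0].
  by apply: lerD; [apply: lerD; [rewrite lerD2l|]|]; exact: ler_wpM2l.
have v_b1 j : bnd ((t - g) * rho) ((t - g) * sigma) (v j) (v1 * kap).
  have -> : v1 * kap = ((t - g) * rho)^-1 * (K * kap) + N * (Cb * (GK * kap)).
    by rewrite /v1; ring.
  exact: v_b.
have sE : lift_size (n:=n) sigma omega g (v1 * kap) = s1 * kap.
  by rewrite /lift_size /s1; ring.
have := @lift_step R n qstar rho sigma omega E0 rho_gt0 sigma_gt0 omega_neq0 E0_ge0 rp h
  (H \o Psi1) FA FB v (t - g) g (a1 * eps) (b1 * (kap * eps)) (v1 * kap) h_deg h_bnd g0 gtg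
  (le_trans tg_le t1) FA_r1 FB_r1 v_a v_d v_b1 v_r F1E g g0.
rewrite sE => /(_ sm3 sm4) [Psi2 [ni2 [D2 [FA' [FB' [FA'_r FB'_r F2E]]]]]].
exists (Psi1 \o Psi2).
have ni : near_identity rho sigma rp (t - g - g) (g + g) (Psi1 \o Psi2).
  by apply: near_identity_comp ni1 ni2 => //; [exact: ltW|exact: ltW|rewrite subrK].
split; first by rewrite -tgg mulr_natl mulr2n.
rewrite -tgg; apply: (state_of_reps rho_gt0 sigma_gt0 tgg0 _ _ F2E).
- apply: repn_le FA'_r; first by rewrite ltW// mulr_gt0.
  have -> : (a2 + b2) * eps = a1 * eps + (s1 * E0 * eps + b2 * eps) by rewrite /a2; ring.
  rewrite lerD2l; apply: (@le_trans _ _ (s1 * E0 * eps)).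
    have -> : s1 * kap * E0 = s1 * E0 * kap by ring.
    by apply: ler_wpM2l => //; exact: mulr_ge0.
  by rewrite lerDl mulr_ge0.
- apply: repc_le FB'_r; first by rewrite ltW// mulr_gt0.
  apply: (@le_trans _ _ (b2 * (kap * eps))); last first.
    by apply: ler_wpM2r; [exact: mulr_ge0|rewrite lerDr].
  have kke : kap * (kap * eps) <= kap * eps.
    by rewrite -[leRHS]mul1r; apply: ler_wpM2r => //; exact: mulr_ge0.
  have -> : s1 * kap * (a1 * eps) + (b1 * (kap * eps) + s1 * kap * (b1 * (kap * eps)) +
      s1 * kap * (N * ((t - g) * rho * (v1 * kap)))) + `|omega| * rho * (s1 * kap) ^+ 2 +
      4 * E0 * (s1 * kap) ^+ 2 =
    s1 * a1 * (kap * eps) + (b1 * (kap * eps) + s1 * b1 * (kap * (kap * eps)) +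
      s1 * (N * ((t - g) * rho * v1)) * (kap * kap)) + `|omega| * rho * s1 ^+ 2 * (kap * kap) +
      4 * E0 * s1 ^+ 2 * (kap * kap).
    by rewrite !exprMn [kap ^+ 2]expr2; ring.
  have -> : b2 * (kap * eps) = s1 * a1 * (kap * eps) + (b1 * (kap * eps) +
      s1 * b1 * (kap * eps) + s1 * (N * ((t - g) * rho * v1)) * (kap * eps)) +
      `|omega| * rho * s1 ^+ 2 * (kap * eps) + 4 * E0 * s1 ^+ 2 * (kap * eps).
    by rewrite /b2; ring.
  apply: lerD; last by apply: ler_wpM2l => //; nonneg.
  apply: lerD; last by apply: ler_wpM2l => //; nonneg.
  rewrite lerD2l; apply: lerD; last by apply: ler_wpM2l => //; nonneg.
  by rewrite lerD2l; apply: ler_wpM2l => //; exact: mulr_ge0.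
- move=> hrp; have [_ [hcr hH]] := hr hrp.
  apply: remainder_real => //.
    by apply: le_trans t1; apply: le_trans tg_le; rewrite gerBl ltW.
  apply: (real_symmetric_comp _ hrp ni _ hH).
    by apply: le_trans tg_le; rewrite gerBl ltW.
  by move=> z hz /=; apply: D1; exact: D2.
Qed.

(** The stages are run with kap = eps, eps^2, ... in turn; r + 1 of them bring the remainder from
    order 1 to order r + 2, at the cost of r + 1 losses of 2 g. *)
Lemma iterated_step (r : nat) (g : R) : 0 < g -> forall t K : R,
  r.+1%:R * (2 * g) < t -> t <= 1 -> 0 <= K ->
  exists2 e0 : R, 0 < e0 & exists2 K' : R, 0 <= K' &
  forall (eps : R) (rp : Prop) h Cq (H : point -> R[i]),
    0 <= eps -> eps < e0 -> unperturbed rho sigma E0 Cb Ci h Cq ->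
    (rp -> (forall j k, conjc (Cq j k) = Cq j k) /\ creal h /\ real_symmetric H t) ->
    state rp (remainder h H) t (K * eps) (K * eps) ->
    exists Psi, near_identity rho sigma rp (t - r.+1%:R * (2 * g)) (r.+1%:R * (2 * g)) Psi /\
      state rp (remainder h (H \o Psi)) (t - r.+1%:R * (2 * g)) (K' * eps) (K' * eps ^+ r.+2).
Proof.
move=> g0; elim: r => [|r IH] t K gt t1 K0.
  rewrite mul1r in gt *; have [e0 e00 [K' K'0 hs]] := full_step g0 gt t1 K0.
  exists e0 => //; exists K' => // eps rp h Cq H p0 pe hC hr hst.
  by rewrite expr2; exact: (hs eps eps rp h Cq H p0 (lexx _) pe hC hr hst).
have rS : r.+2%:R * (2 * g) = r.+1%:R * (2 * g) + 2 * g.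
  by rewrite -[r.+2%:R]natr1 mulrDl mul1r.
have g20 : 0 < 2 * g by rewrite mulr_gt0.
have r10 : 0 < r.+1%:R * (2 * g) by rewrite mulr_gt0.
have gt' : r.+1%:R * (2 * g) < t by apply: lt_trans gt; rewrite rS ltrDl.
have [e1 e10 [K1 K10 h1]] := IH t K gt' t1 K0.
set t' := t - r.+1%:R * (2 * g) in h1 *.
have t'0 : 0 < t' by rewrite subr_gt0.
have gt'' : 2 * g < t' by rewrite ltrBrDr addrC -rS.
have t't : t' <= t by rewrite gerBl ltW.
have [e2 e20 [K2 K20 h2]] := full_step g0 gt'' (le_trans t't t1) K10.
(* eps < 1 ensures eps^(r+2) <= eps, the condition kap <= eps of the next stage. *)
exists (Num.min (Num.min e1 e2) 1); first by rewrite !lt_min e10 e20 ltr01.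
exists K2 => // eps rp h Cq H p0; rewrite !lt_min => /andP[/andP[pe1 pe2] pe3] hC hr hst.
have [Psi1 [ni1 st1]] := h1 eps rp h Cq H p0 pe1 hC hr hst.
have ke : eps ^+ r.+2 <= eps by rewrite exprS ler_piMr// exprn_ile1// ltW.
have k0 : 0 <= eps ^+ r.+2 by exact: exprn_ge0.
have D1 z : D t' z -> D t (Psi1 z).
  by move=> hz; have := near_identity_dom t'0 ni1 hz; rewrite /t' subrK.
have hr1 : rp -> (forall j k, conjc (Cq j k) = Cq j k) /\ creal h /\
    real_symmetric (H \o Psi1) t'.
  move=> hrp; have [a [b c]] := hr hrp; split=> //; split=> //.
  exact: (real_symmetric_comp t't hrp ni1 D1 c).
have [Psi2 [ni2 st2]] := h2 eps (eps ^+ r.+2) rp h Cq (H \o Psi1) k0 ke pe2 hC hr1 st1.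
exists (Psi1 \o Psi2).
have tE : t - r.+2%:R * (2 * g) = t' - 2 * g by rewrite rS /t'; ring.
rewrite tE rS; split.
  apply: near_identity_comp ni1 ni2 => //; [|exact: ltW|exact: ltW|by rewrite subrK].
  by rewrite subr_gt0.
by rewrite [eps ^+ _]exprSr.
Qed.

End Iteration.

(** * The initial Hamiltonian *)

Section Hessian.
Context {R : realType} {n : nat}.
Notation point := 'rV[R[i]]_(n + n).

(** On the line the function is exactly quadratic, so the difference quotient misses b by h c
    only. *)
Lemma derive_quadratic (F : point -> R[i]) (a v : point) (b c : R[i]) :
  (forall h : R[i], F (h *: v + a) = F a + h * b + h ^+ 2 * c) -> 'D_v F a = b.
Proof.
move=> hF; rewrite /derive; apply: cvg_lim; first exact: norm_hausdorff.
apply: (cvg_cabsP _ b).2 => e e0.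
have c0 : 0 < cabs c + 1 by rewrite ltr_wpDl ?cabs_ge0.
apply: (@filterS _ _ (nbhs_filter (0 : R[i])) _ _ _
  (near_dist (0 : R[i]^o) (divr_gt0 e0 c0))) => h hh h0 /=.
have -> : b - h^-1 *: (F (h *: v + a) - F a) = - (h * c).
  rewrite hF /GRing.scale /=; have : h != 0 by exact: h0.
  by move=> hn; field.
rewrite cabsN cabsM.
have hle : cabs h <= e / (cabs c + 1).
  by move: hh; rewrite sub0r normrN cabsE lecR.
apply: (@le_trans _ _ (e / (cabs c + 1) * (cabs c + 1))).
  by apply: ler_pM => //; rewrite ?cabs_ge0// lerDl.
by rewrite divfK// lt0r_neq0.
Qed.

Lemma eunit_eq (j k : 'I_n) : (eunit j == eunit k) = (j == k).
Proof. exact: inj_eq (@eunit_inj n) _ _. Qed.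

(** Euler's relation for degree two on exponents: for each k in the support of i exactly one j
    satisfies i = e_j + e_k, so the sum is the degree. *)
Lemma deg2_count (i : {ffun 'I_n -> nat}) : mlen i = 2 ->
  (\sum_k \sum_j (i == (eunit j + eunit k)%R) * i k = 2)%N.
Proof.
move=> i2; rewrite -[RHS]i2 /mlen; apply: eq_bigr => k _.
have [ik|ik] := eqVneq (i k) 0%N; first by rewrite big1// => j _; rewrite ik muln0.
pose i' := [ffun l => (i l - (l == k))%N] : {ffun 'I_n -> nat}.
have iE : i = (i' + eunit k)%R.
  apply/ffunP => l; rewrite !ffunE; case: eqP => [->|_]; last by rewrite subn0 [RHS]addn0.
  by rewrite [RHS]subnK// lt0n.
have [j0 jE] : exists j, i' = eunit j.
  apply: mlen1P; move: i2; rewrite iE mlenD mlen_eunit addn1 => -[]; done.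
rewrite (bigD1 j0)//= {1}iE jE eqxx mul1n big1 ?addn0// => j jj.
rewrite iE jE; case: eqP => [/ffunP h|_]; last by rewrite mul0n.
case/eqP: jj; apply/esym/eqP; rewrite -eunit_eq; apply/eqP/ffunP => l.
by have := h l; rewrite !ffunE => /eqP; rewrite eqn_add2r => /eqP.
Qed.

(** The Hessian read off the coefficients: the factor is 2 on the diagonal, where p_j^2 is
    differentiated twice, and 1 elsewhere. *)
Definition hess (c : mindex n -> R[i]) (j k : 'I_n) : R[i] :=
  (1 + (j == k))%:R * c (eunit j + eunit k, 0).

Lemma hess_sym c j k : hess c j k = hess c k j.
Proof. by rewrite /hess eq_sym addrC. Qed.

Lemma quadratic_has_sum (c : mindex n -> R[i]) (z : point) :
  (forall m, mlen m.1 != 2 -> c m = 0) -> (forall m, m.2 != 0 -> c m = 0) ->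
  has_sum (fun m => c m * mono m z)
    (2^-1 * \sum_j \sum_k hess c j k * act z j * act z k).
Proof.
move=> c_deg c_free.
have hjk j k : has_sum (fun m : mindex n => if m == (eunit j + eunit k, 0)
    then (m.1 k)%:R * c m * mono m z else 0) (hess c j k * act z j * act z k).
  pose m0 : mindex n := (eunit j + eunit k, 0).
  pose x m : R[i] := if m == m0 then (m.1 k)%:R * c m * mono m z else 0.
  have xE : x m0 = hess c j k * act z j * act z k.
    have mE : mono m0 z = act z j * act z k.
      by rewrite -!mono_act -monoD /madd /m0 /= addr0.
    rewrite /x eqxx mE mulrA; congr (_ * _ * _ * _).
    by rewrite /m0 /= !ffunE eqxx eq_sym addrC.
  by rewrite -xE; apply: has_sum_fset1 => m; rewrite /x => /negbTE ->.
have hs := has_sumZ (c := 2^-1) (has_sum_big (r := index_enum _) (fun j =>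
  has_sum_big (r := index_enum _) (fun k => hjk j k))).
apply: eq_has_sum hs => m /=.
have [m2|m2] := eqVneq m.2 0; last first.
  rewrite c_free// mul0r big1 ?mulr0// => j _; rewrite big1// => k _.
  by case: eqP => // mE; rewrite mE eqxx in m2.
have [ml|ml] := eqVneq (mlen m.1) 2%N; last first.
  rewrite c_deg// mul0r big1 ?mulr0// => j _; rewrite big1// => k _.
  by rewrite mulr0 mul0r if_same.
rewrite exchange_big /=.
have -> : \sum_k \sum_j (if m == (eunit j + eunit k, 0) then (m.1 k)%:R * c m * mono m z else 0) =
   (\sum_k \sum_j (m.1 == (eunit j + eunit k)%R) * m.1 k)%N%:R * (c m * mono m z).
  rewrite natr_sum mulr_suml; apply: eq_bigr => k _.
  rewrite natr_sum mulr_suml; apply: eq_bigr => j _.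
  have -> : (m == (eunit j + eunit k, 0)) = (m.1 == (eunit j + eunit k)%R).
    by case: m {ml} m2 => i l /= ->; rewrite xpair_eqE eqxx andbT.
  by case: ifP => _; rewrite ?mul1n ?mul0n ?mul0r// mulrA.
by rewrite deg2_count// mulKf// pnatr_eq0.
Qed.

Lemma act_delta (h : R[i]) (j k : 'I_n) (z : point) :
  act (h *: delta_mx 0 (lshift n j) + z) k = act z k + h * (j == k)%:R.
Proof.
rewrite !actE !mxE eqxx addrC /=; congr (_ + _ * _%:R).
by rewrite (inj_eq (@lshift_inj n n)) eq_sym.
Qed.

Lemma action_hessianE (g : ft_coef R n) (j k : 'I_n) : homog 2 g -> angle_free g ->
  action_hessian g j k = hess (fun m => g m.1 m.2) j k.
Proof.
move=> g_deg g_free; set C := hess _.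
have Cs j' k' : C j' k' = C k' j' by exact: hess_sym.
have gE : ft_eval g = fun z => 2^-1 * \sum_j \sum_k C j k * act z j * act z k.
  apply/funext => z; rewrite ft_evalE; apply: has_sum_sum; apply: quadratic_has_sum => m h.
    exact: g_deg.
  exact: g_free.
have D1 z l : 'D_(delta_mx 0 (lshift n l)) (ft_eval g) z = \sum_j C l j * act z j.
  apply: (@derive_quadratic _ z _ _ (2^-1 * C l l)) => h; rewrite gE.
  pose d (j' : 'I_n) : R[i] := (l == j')%:R.
  have dS (x : 'I_n -> R[i]) : \sum_j' x j' * d j' = x l.
    rewrite (bigD1 l)//= /d eqxx mulr1 big1 ?addr0// => j'; rewrite eq_sym => /negbTE ->.
    by rewrite mulr0.
  have E1 : \sum_j \sum_k C j k * act (h *: delta_mx 0 (lshift n l) + z) j *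
      act (h *: delta_mx 0 (lshift n l) + z) k =
    \sum_j \sum_k C j k * act z j * act z k + h * \sum_j (\sum_k C j k * act z k) * d j
    + (h * \sum_j \sum_k C j k * act z j * d k + h ^+ 2 * \sum_j (\sum_k C j k * d k) * d j).
    rewrite !mulr_sumr -!big_split /=; apply: eq_bigr => j' _.
    rewrite !mulr_suml !mulr_sumr -!big_split /=; apply: eq_bigr => k' _.
    by rewrite !act_delta /d; ring.
  rewrite E1 !dS.
  have -> : \sum_j \sum_k C j k * act z j * d k = \sum_j C l j * act z j.
    by apply: eq_bigr => j' _; rewrite dS Cs.
  by field.
rewrite /action_hessian; apply: (@derive_quadratic _ 0 _ _ 0) => h.
rewrite !D1; pose d (j' : 'I_n) : R[i] := (j == j')%:R.
have -> : \sum_l C k l * act (h *: delta_mx 0 (lshift n j) + 0) l =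
    \sum_l C k l * act 0 l + h * \sum_l C k l * d l.
  rewrite mulr_sumr -big_split /=; apply: eq_bigr => l _.
  by rewrite act_delta /d; ring.
rewrite mulr0 addr0; congr (_ + _ * _).
rewrite (bigD1 j)//= /d eqxx mulr1 big1 ?addr0 1?Cs// => j'; rewrite eq_sym => /negbTE ->.
by rewrite mulr0.
Qed.

End Hessian.

(** * Splitting the given expansion and solving with the Hessian *)

Section InitialState.
Context {R : realType} {n : nat}.
Notation point := 'rV[R[i]]_(n.+1 + n.+1).
Local Notation N := (n.+1%:R : R).

Lemma bnd_ft_norm (p l : nat) (rho sigma B : R) (g : ft_coef R p) : homog l g ->
  (ft_norm l rho sigma g <= B%:E)%E -> bnd rho sigma (fun m => g m.1 m.2) B.
Proof.
move=> g_deg gB J; rewrite -lee_fin; apply: le_trans gB.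
pose J' := [seq m <- enum_fset J | mlen m.1 == l].
have J'_uniq : uniq J' by rewrite filter_uniq// fset_uniq.
rewrite /ft_norm; apply: esum_ge; exists [set` J'].
  split; first exact: finite_seq.
  by move=> m /=; rewrite mem_filter => /andP[/eqP].
rewrite -fsbig_seq// big_filter sumEFin lee_fin.
rewrite (bigID (fun m : mindex p => mlen m.1 == l)) /= [X in _ + X]big1 ?addr0.
  rewrite le_eqVlt; apply/orP; left; apply/eqP.
  by apply: eq_bigr => m /eqP ml; rewrite wt.unlock /= ml mulrA.
by move=> m ml; rewrite g_deg// cabs0 mul0r.
Qed.

Variables (rho sigma omega mm E : R) (f : nat -> nat -> ft_coef R n.+1) (H : point -> R[i]) (eps : R).
Hypotheses (rho_gt0 : 0 < rho) (sigma_gt0 : 0 < sigma) (mm_gt0 : 0 < mm) (E_gt0 : 0 < E)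
  (eps_ge0 : 0 <= eps) (eps_le : eps <= 2^-1).
Hypotheses (f_terms : expansion_terms f) (H_exp : has_expansion omega f (dom rho sigma) H).
Hypotheses (C_real : forall i j, action_hessian (f 2%N 0%N) i j \is Num.real)
  (C_nondeg : forall v : 'I_n.+1 -> R,
       (mm * \sum_i `|v i|)%:C <=
       \sum_i `|\sum_j action_hessian (f 2%N 0%N) i j * (v j)%:C|)
  (f_bound : forall l s, present l s ->
       (ft_norm l rho sigma (f l s) <= (E / 2 ^+ (2 * l) * eps ^+ s)%:E)%E).

(** The sum over l of E / 2^(2l), a geometric series of ratio 1/4. *)
Definition degree_bound : R := E * (1 - 4^-1)^-1.
Local Notation E0 := degree_bound.

Let q4 : 0 <= (4^-1 : R) < 1.
Proof. by rewrite invr_ge0 ler0n /= invf_lt1// ltr1n. Qed.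

Let geo4 : rbound (fun l : nat => E * (4^-1 : R) ^+ l) E0.
Proof. by have /andP[h1 h2] := q4; apply: rboundZ; [exact: ltW|exact: geometric_bound]. Qed.

Let E0_ge0 : 0 <= E0. Proof. by have := geo4 fset0; rewrite big_seq_fset0. Qed.

Let f_bnd l s : present l s ->
  bnd rho sigma (fun m => f l s m.1 m.2) (E * 4^-1 ^+ l * eps ^+ s).
Proof.
move=> ls; have [hd _] := f_terms; have := bnd_ft_norm (hd l s ls) (f_bound ls).
by rewrite exprM -natrX exprVn.
Qed.

Let bnd0 b : 0 <= b -> bnd rho sigma (fun _ : mindex n.+1 => 0 : R[i]) b.
Proof.
move=> b0; apply: rbound_le b0 (rbound0 (x := fun=> 0) _) => // m.
by rewrite cabs0 mul0r.
Qed.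

Let hfam (ls : nat * nat) (m : mindex n.+1) : R[i] :=
  if (ls.2 == 0%N) && (1 < ls.1)%N then f ls.1 ls.2 m.1 m.2 else 0.
Let Gfam (ls : nat * nat) (m : mindex n.+1) : R[i] :=
  if (0 < ls.2)%N then f ls.1 ls.2 m.1 m.2 else 0.

Let hB (ls : nat * nat) : R := E * 4^-1 ^+ ls.1 * (ls.2 == 0%N)%:R.
(** For eps <= 1/2 and s >= 1, eps^s <= 2 eps 2^-s; the sum over s is at most 4 eps, so the whole
    perturbation is O(eps). *)
Let GB (ls : nat * nat) : R := E * 4^-1 ^+ ls.1 * (2 * eps * 2^-1 ^+ ls.2).

Let E4_ge0 l : 0 <= E * (4^-1 : R) ^+ l.
Proof. by rewrite mulr_ge0 ?exprn_ge0 ?invr_ge0// ltW. Qed.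

Let hfam_bnd ls : bnd rho sigma (hfam ls) (hB ls).
Proof.
case: ls => l s; rewrite /hfam /hB /=; case: eqP => [->|_] /=; last first.
  by rewrite mulr0; exact: bnd0.
have [l1|l1] := boolP (1 < l)%N; last by apply: bnd0; rewrite mulr_ge0.
by have := @f_bnd l 0%N; rewrite /present l1 expr0; exact.
Qed.

Let Gfam_bnd ls : bnd rho sigma (Gfam ls) (GB ls).
Proof.
case: ls => l s; rewrite /Gfam /GB /=; have [s0|s0] := boolP (0 < s)%N; last first.
  by apply: bnd0; nonneg.
have ps : present l s by rewrite /present s0.
apply: rbound_le (f_bnd ps) => //; apply: ler_wpM2l => //.
case: s s0 {ps} => // s _; rewrite !exprS mulrACA divff ?pnatr_eq0// mul1r.
by apply: ler_wpM2l => //; apply: lerXn2r; rewrite ?nnegrE// invr_ge0.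
Qed.

Let hB_sum : rbound hB E0.
Proof.
apply: (rbound_pair (N := fun l => E * 4^-1 ^+ l)) => //.
  by move=> ls; rewrite /hB mulr_ge0.
move=> l J /=; rewrite /hB /= -mulr_sumr -[leRHS]mulr1; apply: ler_wpM2l => //.
have h0 : rbound (fun s : nat => (s == 0%N)%:R : R) 1.
  apply: rbound_nat => // k; case: k => [|k]; first by rewrite big_nil.
  rewrite big_nat_recl// big1 ?addr0// => i _; by rewrite eqxx.
exact: h0.
Qed.

Let GB_sum : rbound GB (E0 * (4 * eps)).
Proof.
have [h1 h2] : 0 <= (2^-1 : R) /\ (2^-1 : R) < 1.
  by rewrite invr_ge0 ler0n invf_lt1// ltr1n.
have e2 : 0 <= 2 * eps by rewrite mulr_ge0.
apply: (rbound_pair (N := fun l => E * 4^-1 ^+ l * (4 * eps))).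
- by move=> ls; rewrite /GB; nonneg.
- move=> l; rewrite /GB /=; apply: rboundZ => //.
  have -> : 4 * eps = 2 * eps * (1 - 2^-1)^-1 by field.
  by apply: rboundZ => //; exact: geometric_bound.
move=> J; rewrite -mulr_suml; apply: ler_wpM2r; last exact: geo4.
by rewrite mulr_ge0.
Qed.

Definition integrable_part m : R[i] := sum (hfam^~ m).
Definition perturbation m : R[i] := sum (Gfam^~ m).
Local Notation h := integrable_part.

Lemma integrable_partE m :
  h m = if (1 < mlen m.1)%N then f (mlen m.1) 0%N m.1 m.2 else 0.
Proof.
apply: has_sum_sum.
have -> : (if (1 < mlen m.1)%N then f (mlen m.1) 0%N m.1 m.2 else 0) =
  hfam (mlen m.1, 0%N) m by [].
apply: has_sum_fset1 => -[l s] /=; rewrite xpair_eqE /hfam /=.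
case: (eqVneq s 0%N) => [->|_] //=.
rewrite andbT eq_sym => lm; case: ifP => // l1.
by have [hd _] := f_terms; apply: hd => //; rewrite /present l1.
Qed.

Lemma integrable_part_bnd : bnd rho sigma h E0.
Proof. exact: bnd_family rho_gt0 hfam_bnd hB_sum. Qed.

Lemma perturbation_bnd : bnd rho sigma perturbation (E0 * (4 * eps)).
Proof. exact: bnd_family rho_gt0 Gfam_bnd GB_sum. Qed.

Lemma remainder_perturbation z : dom rho sigma z ->
  remainder omega h H z = ev perturbation z.
Proof.
move=> hz; have h1 := ev_family rho_gt0 hfam_bnd hB_sum hz.
have h2 := ev_family rho_gt0 Gfam_bnd GB_sum hz.
have h12 : has_sum (fun ls => ev (hfam ls) z + ev (Gfam ls) z)
    (H z - omega%:C * act z ord0).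
  apply: eq_has_sum (H_exp hz) => -[l s] /=; rewrite /present /hfam /Gfam /=.
  have ev0 : ev (fun _ : mindex n.+1 => 0 : R[i]) z = 0 by exact: ev_eq0.
  case: s => [|s] /=; last by rewrite ev0 add0r ft_evalE.
  by case: ifP => _; rewrite ev0 addr0// ft_evalE.
have := has_sum_unique h12 (has_sumD h1 h2).
by rewrite /remainder => ->; rewrite addrC addKr.
Qed.

Let sum_creal (Y : nat * nat -> mindex n.+1 -> R[i]) (M : nat * nat -> R) B :
  (forall ls, bnd rho sigma (Y ls) (M ls)) -> rbound M B -> (forall ls, creal (Y ls)) ->
  creal (fun m => sum (Y^~ m)).
Proof.
move=> hY hM Yr m.
have hs : has_sum (Y^~ m) (sum (Y^~ m)).
  have w0 : 0 < wt rho sigma m by exact: wt_gt0.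
  apply: (@absum_has_sum _ _ _ ((wt rho sigma m)^-1 * B)).
  have wi : 0 <= (wt rho sigma m)^-1 by rewrite invr_ge0 ltW.
  apply: rbound_le (rboundZ wi hM) => // ls.
  rewrite mulrC ler_pdivlMr//; exact: rbound1 (hY ls).
apply: has_sum_sum; apply: eq_has_sum (has_sum_conj hs) => ls.
by rewrite Yr.
Qed.

Lemma integrable_part_creal : real_terms f -> creal h.
Proof.
move=> fr; apply: sum_creal hfam_bnd hB_sum _ => -[l s] m; rewrite /hfam /=.
case: ifP => [/andP[/eqP s0 l1]|_]; last by rewrite conjc0.
by apply: fr; rewrite /present l1 orbT.
Qed.

Lemma perturbation_creal : real_terms f -> creal perturbation.
Proof.
move=> fr; apply: sum_creal Gfam_bnd GB_sum _ => -[l s] m; rewrite /Gfam /=.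
case: ifP => [s0|_]; last by rewrite conjc0.
by apply: fr; rewrite /present s0.
Qed.

Definition hessian_mx : 'M[R[i]]_n.+1 := \matrix_(i, j) action_hessian (f 2%N 0%N) i j.
Local Notation Cq := hessian_mx.

Let Cq_hess j k : Cq j k = hess (fun m => f 2%N 0%N m.1 m.2) j k.
Proof. by have [h1 h2] := f_terms; rewrite mxE action_hessianE//; [exact: h1|exact: h2]. Qed.

(** [C_nondeg] tests real vectors only, so the system is solved over [R], separately for the real
    and imaginary parts of complex data. *)
Let CR : 'M[R]_n.+1 := \matrix_(i, j) complex.Re (Cq i j).

Let CRE i j : Cq i j = (CR i j)%:C.
Proof. by rewrite [CR _ _]mxE [Cq i j]mxE RRe_real. Qed.

Let Cq_sym : Cq^T = Cq.
Proof. by apply/matrixP => i j; rewrite mxE !Cq_hess hess_sym. Qed.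

Let CR_sym i j : CR i j = CR j i.
Proof. by rewrite [CR i j]mxE [CR j i]mxE -[in RHS]Cq_sym [in RHS]mxE. Qed.

Let CR_nondeg (v : 'I_n.+1 -> R) :
  mm * \sum_i `|v i| <= \sum_i `|\sum_j CR i j * v j|.
Proof.
rewrite -lecR; apply: le_trans (C_nondeg v) _; rewrite le_eqVlt; apply/orP; left; apply/eqP.
rewrite rmorph_sum; apply: eq_bigr => i _.
have -> : \sum_j action_hessian (f 2%N 0%N) i j * (v j)%:C = (\sum_j CR i j * v j)%:C.
  rewrite rmorph_sum; apply: eq_bigr => j _.
  have -> : action_hessian (f 2%N 0%N) i j = (CR i j)%:C by rewrite -CRE [RHS]mxE.
  by rewrite -rmorphM.
by rewrite cabsE cabs_real.
Qed.

Let CR_unit : CR \in unitmx.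
Proof.
rewrite unitmxE unitfE; apply/negP => /det0P[v v0 vC].
have := CR_nondeg (fun i => v 0 i).
rewrite [X in _ <= X]big1 => [|i _]; last first.
  apply/eqP; rewrite normr_eq0; move/rowP: vC => /(_ i); rewrite [LHS]mxE [RHS]mxE => vi.
  by apply/eqP; rewrite -[RHS]vi; apply: eq_bigr => j _; rewrite mulrC CR_sym.
rewrite pmulr_rle0// => hs; case/eqP: v0; apply/rowP => i; rewrite mxE.
apply/eqP; rewrite -normr_le0; apply: le_trans hs.
by rewrite (bigD1 i)//= lerDl sumr_ge0.
Qed.

(** The bound is m |y_k| <= m sum |y_i| <= sum |b_j| <= (n + 1) x. The last clause, applied to
    imaginary parts, keeps zeta real when beta is. *)
Let solve_real (b : 'I_n.+1 -> R) (x : R) : (forall j, `|b j| <= x) ->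
  exists y : 'I_n.+1 -> R, [/\ forall j, \sum_k CR j k * y k = b j,
    forall k, `|y k| <= mm^-1 * (N * x) & (forall j, b j = 0) -> forall k, y k = 0].
Proof.
move=> bx; pose y := invmx CR *m (\col_j b j).
have yE j : \sum_k CR j k * y k 0 = b j.
  have := congr1 (fun M : 'cV[R]_n.+1 => M j 0) (mulKVmx CR_unit (\col_j b j)).
  by rewrite !mxE.
exists (fun k => y k 0); split=> //.
  move=> k; rewrite -ler_pdivrMl ?invr_gt0// invrK.
  apply: (@le_trans _ _ (mm * \sum_i `|y i 0|)).
    by rewrite ler_wpM2l ?(ltW mm_gt0)// (bigD1 k)//= lerDl sumr_ge0.
  apply: le_trans (CR_nondeg _) _.
  apply: (@le_trans _ _ (\sum_(i < n.+1) x)); first by apply: ler_sum => i _; rewrite yE.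
  by rewrite sumr_const card_ord mulr_natl.
move=> b0 k; have -> : y = 0; last by rewrite mxE.
rewrite /y; have -> : \col_j b j = 0 by apply/colP => j; rewrite !mxE b0.
by rewrite mulmx0.
Qed.

(** Here the 2 is the diagonal factor of [hess], and rho^-2 undoes the weight of degree two. In the
    next constant the 2 accounts for real and imaginary parts. *)
Definition hessian_bound : R := 2 * (rho ^+ 2)^-1 * E0.
Definition hessian_inverse_bound : R := 2 * (mm^-1 * n.+1%:R).

Lemma unperturbed_integrable_part :
  unperturbed rho sigma E0 hessian_bound hessian_inverse_bound h Cq.
Proof.
have hl m : (mlen m.1 < 2)%N -> h m = 0 by rewrite integrable_partE ltnNge => /negbTE ->.
have degE : degc 2 h = fun m => f 2%N 0%N m.1 m.2.
  apply/funext => m; rewrite /degc integrable_partE; case: eqP => [->//|/eqP ml].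
  by have [h1 _] := f_terms; rewrite h1.
split=> //.
- exact: integrable_part_bnd.
- split; first exact: Cq_sym.
  move=> j k; rewrite Cq_hess /hess cabsM cabs_nat /hessian_bound -mulrA.
  apply: ler_pM; rewrite ?cabs_ge0//.
    by rewrite ler_nat; case: eqP.
  have := rbound1 (eunit j + eunit k, 0) integrable_part_bnd.
  rewrite wt.unlock /= klen0 mul0r expR0 mulr1 integrable_partE /= mlenD !mlen_eunit /=.
  by rewrite mulrC ler_pdivlMl ?exprn_gt0// mulrC.
- move=> z hz; rewrite degE; apply: has_sum_sum.
  have -> : \sum_j \sum_k Cq j k * act z j * act z k =
      \sum_j \sum_k hess (fun m => f 2%N 0%N m.1 m.2) j k * act z j * act z k.
    by apply: eq_bigr => j _; apply: eq_bigr => k _; rewrite Cq_hess.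
  have [h1 h2] := f_terms.
  by apply: quadratic_has_sum => m hm; [apply: h1|apply: h2].
move=> beta x hx.
have [xr [xr_eq xr_le xr0]] := @solve_real (fun j => complex.Re (beta j)) x
  (fun j => le_trans (cabs_Re _) (hx j)).
have [yr [yr_eq yr_le yr0]] := @solve_real (fun j => complex.Im (beta j)) x
  (fun j => le_trans (cabs_Im _) (hx j)).
exists (fun k => (xr k)%:C + 'i%C * (yr k)%:C); split.
- move=> j; rewrite [RHS]complexE -xr_eq -yr_eq !rmorph_sum mulr_sumr -big_split /=.
  by apply: eq_bigr => k _; rewrite CRE !rmorphM; ring.
- move=> k; apply: le_trans (cabsD _ _) _; rewrite cabsM cabs_i mul1r !cabs_real.
  have -> : hessian_inverse_bound * x = mm^-1 * (N * x) + mm^-1 * (N * x).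
    by rewrite /hessian_inverse_bound; ring.
  exact: lerD.
move=> hb k; rewrite yr0 ?mulr0 ?addr0 ?conjc_real// => j.
have := congr1 (@complex.Im R) (hb j); case: (beta j) => a b /=; lra.
Qed.

Lemma hessian_mx_real j k : conjc (Cq j k) = Cq j k.
Proof. by rewrite CRE conjc_real. Qed.

Lemma H_real_symmetric : real_terms f -> real_symmetric rho sigma H 1.
Proof.
move=> fr z; rewrite /D !mul1r => hz; have hcz := dom_conjv hz.
have HE w : dom rho sigma w -> H w = omega%:C * act w ord0 + ev h w + ev perturbation w.
  by move=> hw; rewrite -(remainder_perturbation hw) /remainder; ring.
rewrite !HE// !conjD conjM conjc_real act_conjv.
rewrite (ev_creal (integrable_part_creal fr) integrable_part_bnd hz).
by rewrite (ev_creal (perturbation_creal fr) perturbation_bnd hz).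
Qed.

Lemma initial_state (qstar : 'rV[R]_n) (t : R) : 0 < t -> t <= 1 ->
  state qstar rho sigma (real_terms f) (remainder omega h H) t (4 * E0 * eps) (4 * E0 * eps).
Proof.
move=> t0 t1; have tr : 0 <= t * rho by rewrite mulr_ge0// ltW.
have tr1 : t * rho <= rho by rewrite -[leRHS]mul1r ler_wpM2r// ltW.
have ts1 : t * sigma <= sigma by rewrite -[leRHS]mul1r ler_wpM2r// ltW.
(* Nothing is normalised yet: the whole perturbation is remainder, with kappa = eps. *)
exists (fun=> 0), perturbation; split.
- by apply: normalc_deg.
- apply: rbound_le (rbound0 (x := fun=> 0) _) => // [m|]; first by rewrite cabs0 mul0r.
  by nonneg.
- have -> : 4 * E0 * eps = E0 * (4 * eps) by ring.
  exact: bnd_le perturbation_bnd.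
- move=> z hz; rewrite ev_eq0// add0r; apply: remainder_perturbation.
  exact: dom_le hz.
- by move=> fr; split; [move=> m; rewrite conjc0|exact: perturbation_creal].
Qed.

End InitialState.

(** * Sorting the final series by degree and order *)

Section DegreeExpansion.
Context {R : realType} {n : nat}.
Notation point := 'rV[R[i]]_(n + n).
Implicit Types (c : mindex n -> R[i]) (z : point).

Lemma rbound_single (I : choiceType) (x : I -> R) i0 : 0 <= x i0 ->
  (forall i, i != i0 -> x i = 0) -> rbound x (x i0).
Proof.
move=> x0 xi J; have [iJ|iJ] := boolP (i0 \in J).
  rewrite (big_fsetD1 i0)//= big_seq big1 ?addr0// => i.
  by rewrite !inE => /andP[/xi].
by rewrite big_seq big1// => i iI; apply: xi; apply: contraNneq iJ => <-.
Qed.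

(** Files a whole series under the single order [s0], sorted by degree. Adding three of these, for
    [h], A and B, gives the final expansion. *)
Lemma degree_expansion (a b B : R) c z (s0 : nat) : bnd a b c B -> dom a b z ->
  has_sum (fun ls : nat * nat => if ls.2 == s0 then ev (degc ls.1 c) z else 0) (ev c z).
Proof.
move=> hc hz.
pose y (mls : mindex n * (nat * nat)) : R[i] :=
  if mls.2 == (mlen mls.1.1, s0) then c mls.1 * mono mls.1 z else 0.
have y_sum : absum y B.
  apply: (rbound_pair (N := fun m => cabs (c m) * wt a b m)) => // [mls|m].
    exact: cabs_ge0.
  have yE : cabs (y (m, (mlen m.1, s0))) = cabs (c m) * cabs (mono m z).
    by rewrite /y eqxx /= (cabsM (c m)).
  have := @rbound_single _ (fun ls => cabs (y (m, ls))) (mlen m.1, s0) (cabs_ge0 _).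
  move=> h; apply: (rbound_le (fun _ => lexx _) _ (h _)) => [|i /negbTE hi].
    by rewrite yE; apply: ler_wpM2l; [exact: cabs_ge0|exact: cabs_mono].
  by rewrite /y /= hi cabs0.
have yE : sum y = ev c z.
  apply: has_sum_unique (has_sum_fubini y_sum) _.
  apply: eq_has_sum (has_ev hc hz) => m; apply/esym/has_sum_sum.
  have <- : y (m, (mlen m.1, s0)) = c m * mono m z by rewrite /y /= eqxx.
  by apply: (has_sum_fset1 (x := fun ls => y (m, ls))) => i /negbTE hi; rewrite /y /= hi.
rewrite -yE; apply: eq_has_sum (has_sum_fubini_swap y_sum) => -[l s] /=.
case: (eqVneq s s0) => [->|ss].
  apply: eq_sum => m; rewrite /y /degc /= xpair_eqE eqxx andbT eq_sym.
  by case: ifP => // _; rewrite mul0r.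
apply: has_sum_sum; have := @has_sum_fin _ _ (fun m => y (m, (l, s))) fset0.
rewrite big_seq_fset0; apply => m _.
by rewrite /y /= xpair_eqE (negbTE ss) andbF.
Qed.

Lemma ft_norm_le (l : nat) (a b B : R) (g : ft_coef R n) : 0 <= a ->
  bnd a b (fun m => g m.1 m.2) B -> (ft_norm l a b g <= B%:E)%E.
Proof.
move=> a0 hg; rewrite /ft_norm; apply: ge_ereal_sup => _ [X [Xfin Xl] <-].
rewrite fsbig_finite//= sumEFin lee_fin.
apply: le_trans (rbound_uniq hg (fset_uniq (fset_set X))).
rewrite le_eqVlt; apply/orP; left; apply/eqP; apply: eq_big_seq => m.
by rewrite in_fset_set// inE => /Xl /= ml; rewrite wt.unlock /= ml mulrA.
Qed.

End DegreeExpansion.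

Section NormalFormTerms.
Context {R : realType} {n : nat}.
Notation point := 'rV[R[i]]_(n.+1 + n.+1).

(** The part of degree one is sum p_j v_j with v_j independent of q_1 and of the actions, so at any
    point with q = q* each v_j has its value at [zstar], which is 0. *)
Lemma normalc_vanishes (qstar : 'rV[R]_n) (a b B : R) (c : mindex n.+1 -> R[i]) (z : point) :
  0 < a -> bnd a b c B -> normalc qstar c -> dom a b z ->
  (forall j, ang z (lift ord0 j) = (qstar 0 j)%:C) -> ev (degc 1 c) z = 0.
Proof.
move=> a0 hc [c_low c_star] hz hq.
rewrite (_ : ev (degc 1 c) z = \sum_j act z j * ev (vcoef j c) z).
  rewrite big1// => j _; rewrite (_ : ev (vcoef j c) z = 0) ?mulr0//.
  rewrite -(c_star j); apply: eq_sum => m.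
  have [m1|m1] := eqVneq m.1 0; last by rewrite vcoef_ang// !mul0r.
  have [m2|m2] := eqVneq (m.2 ord0) 0; last first.
    by rewrite /vcoef m1 eqxx c_low ?mul0r//= mlen_eunit.
  congr (_ * _); rewrite mono.unlock /= m1; congr (_ * cexp ('i * _)).
    by rewrite !big1// => l _; rewrite ffunE expr0.
  apply: eq_bigr => l _; case: (unliftP ord0 l) => [l' ->|->]; last first.
    by rewrite m2 !mul0r.
  by rewrite hq ang_row_mx mxE liftK.
rewrite -(ev_linc a0 (fun j => @vcoef_ang _ _ j c) (fun j => bnd_vcoef j a0 hc) hz).
apply: eq_sum => m; congr (_ * _); rewrite /degc; have [m1|m1] := eqVneq (mlen m.1) 1%N.
  by rewrite linc_vcoef.
by rewrite linc_deg.
Qed.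

(* The integrable part at order 0, the normalised part [A] at order 1 and the
   whole rest [B] at order [r.+1], each sorted by degree in the actions. *)
Definition normal_terms (r : nat) (f0 : nat -> ft_coef R n.+1) (A B : mindex n.+1 -> R[i])
    (l s : nat) : ft_coef R n.+1 := fun i k =>
  if s == 0%N then f0 l i k else
  if mlen i != l then 0 else
  if s == 1%N then A (i, k) else if s == r.+1 then B (i, k) else 0.

End NormalFormTerms.

Theorem proposition1p1 (R : realType) (n : nat)
    (rho sigma omega eps0 m E : R)
    (H : R -> 'rV[R[i]]_(n.+1 + n.+1) -> R[i])
    (f : R -> nat -> nat -> ft_coef R n.+1)
    (rho_gt0 : 0 < rho) (sigma_gt0 : 0 < sigma) (omega_neq0 : omega != 0)
    (eps0_gt0 : 0 < eps0) (m_gt0 : 0 < m) (E_gt0 : 0 < E)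
    (H_analytic : forall eps : R, 0 <= eps < eps0 ->
       analytic_on (dom rho sigma) (H eps))
    (f_terms : forall eps : R, 0 <= eps < eps0 -> expansion_terms (f eps))
    (H_expansion : forall eps : R, 0 <= eps < eps0 ->
       has_expansion omega (f eps) (dom rho sigma) (H eps))
    (C_real : forall eps : R, 0 <= eps < eps0 -> forall i j,
       action_hessian (f eps 2%N 0%N) i j \is Num.real)
    (C_nondegenerate : forall eps : R, 0 <= eps < eps0 -> forall v : 'I_n.+1 -> R,
       (m * \sum_i `|v i|)%:C <=
       \sum_i `|\sum_j action_hessian (f eps 2%N 0%N) i j * (v j)%:C|)
    (f_bound : forall eps : R, 0 <= eps < eps0 -> forall l s, present l s ->
       (ft_norm l rho sigma (f eps l s) <= (E / 2 ^+ (2 * l) * eps ^+ s)%:E)%E)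
    (qstar : 'rV[R]_n) (r : nat) (r_gt0 : (0 < r)%N) :
  exists2 epsr : R, 0 < epsr &
  exists K : nat -> nat -> R,
  forall eps : R, 0 <= eps < epsr ->
  exists (Phi : 'rV[R[i]]_(n.+1 + n.+1) -> 'rV[R[i]]_(n.+1 + n.+1))
         (fr : nat -> nat -> ft_coef R n.+1),
    [/\ canonical_transformation (dom (rho / 2) (sigma / 2)) Phi,
        covers (dom (rho / 2) (sigma / 2)) (dom (rho / 4) (sigma / 4)) Phi /\
        Phi @` dom (rho / 2) (sigma / 2)
          `<=` dom (3 / 4 * rho) (3 / 4 * sigma),
        [/\ expansion_terms fr,
            forall l s, present l s ->
              (ft_norm l (rho / 2) (sigma / 2) (fr l s)
                 <= (K l s * eps ^+ s)%:E)%E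
          & has_expansion omega fr (dom (rho / 2) (sigma / 2)) (H eps \o Phi)],
        normal_form r (dom (rho / 2) (sigma / 2)) qstar fr
      & real_terms (f eps) ->
          real_terms fr /\
          forall z, dom (rho / 2) (sigma / 2) z ->
            real_point z -> real_point (Phi z)].

Proof.
pose E0 := degree_bound E.
have E0_ge0 : 0 <= E0.
  rewrite /E0 /degree_bound mulr_ge0 ?ltW// invr_gt0 subr_gt0 invf_lt1//.
  by rewrite ltr1n.
pose Cb := hessian_bound rho E.
have Cb_ge0 : 0 <= Cb by rewrite /Cb /hessian_bound -/E0; nonneg.
pose Ci := @hessian_inverse_bound R n m.
have Ci_ge0 : 0 <= Ci by rewrite /Ci /hessian_inverse_bound; nonneg.
case: r r_gt0 => // r _.
(* r + 1 stages, each losing 2 g, lose 1/4 in all. *)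
pose g : R := (8 * r.+1%:R)^-1.
have r0 : r.+1%:R != 0 :> R by rewrite pnatr_eq0.
have g0 : 0 < g by rewrite invr_gt0 mulr_gt0.
have rg : r.+1%:R * (2 * g) = 4^-1 :> R.
  by rewrite /g; move: (r.+1%:R) r0 => x x0; field.
have t0 : (4^-1 : R) < 3 / 4 by lra.
have t1 : (3 / 4 : R) <= 1 by lra.
have t34 : (0 : R) < 3 / 4 by lra.
have K0 : 0 <= 4 * E0 by rewrite mulr_ge0.
have rgt : r.+1%:R * (2 * g) < 3 / 4 by rewrite rg.
have [e1 e10 [K1 K10 step]] := iterated_step qstar rho_gt0 sigma_gt0 omega_neq0
  E0_ge0 Cb_ge0 Ci_ge0 g0 rgt t1 K0.
(* Starting from 3/4, the loss 1/4 leaves a map on the domain 1/2; its displacement of at most 1/4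
   sends that domain into 3/4 and lets its image cover 1/4. *)
have tE : 3 / 4 - 4^-1 = 2^-1 :> R by lra.
rewrite rg tE in step.
have D2 : D rho sigma 2^-1 = dom (rho / 2) (sigma / 2) :> set 'rV[R[i]]_(n.+1 + n.+1).
  by rewrite /D ![2^-1 * _]mulrC.
have D4 : D rho sigma 4^-1 = dom (rho / 4) (sigma / 4) :> set 'rV[R[i]]_(n.+1 + n.+1).
  by rewrite /D ![4^-1 * _]mulrC.
exists (Num.min (Num.min e1 eps0) 2^-1).
  by rewrite !lt_min e10 eps0_gt0 invr_gt0 ltr0n.
(* Order 0 keeps the given bound, as [h] never changes; every other order shares the constant of the
   last stage. *)
exists (fun l s => if s == 0%N then E / 2 ^+ (2 * l) else K1) => eps /andP[eps_ge0].
rewrite !lt_min => /andP[/andP[eps1 eps2] eps3].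
have heps : 0 <= eps < eps0 by rewrite eps_ge0.
have ft := f_terms eps heps; have fb := f_bound eps heps; have fe := H_expansion eps heps.
have Cr := C_real eps heps; have Cn := C_nondegenerate eps heps; have eh := ltW eps3.
pose h := integrable_part (f eps).
have hU := unperturbed_integrable_part rho_gt0 m_gt0 E_gt0 ft Cr Cn fb.
have hst := initial_state rho_gt0 sigma_gt0 E_gt0 eps_ge0 eh ft fe fb qstar t34 t1.
have hreal : real_terms (f eps) ->
    (forall j k, conjc (hessian_mx (f eps) j k) = hessian_mx (f eps) j k) /\
    creal h /\ real_symmetric rho sigma (H eps) (3 / 4).
  move=> fr; split; first exact: hessian_mx_real Cr.
  split; first exact: integrable_part_creal rho_gt0 E_gt0 ft fb fr.
  have hs := H_real_symmetric rho_gt0 E_gt0 eps_ge0 eh ft fe fb fr.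
  by move=> z hz; apply: hs; exact: D_le hz.
have [Psi [[Psi_can Psi_in Psi_cov Psi_real] [A [B [A_n A_b B_b AB_E AB_r]]]]] :=
  step eps _ _ _ (H eps) eps_ge0 eps1 hU hreal hst.
have h2 : (2^-1 : R) * rho = rho / 2 by rewrite mulrC.
have s2 : (2^-1 : R) * sigma = sigma / 2 by rewrite mulrC.
rewrite h2 s2 in A_b B_b.
have rho2 : 0 < rho / 2 by exact: divr_gt0.
have [h_low h_b _ _ _] := hU.
have half_le (x : R) : 0 < x -> x / 2 <= x by move=> x0; rewrite ger_pMr//; lra.
have h_b2 : bnd (rho / 2) (sigma / 2) h E0.
  by apply: bnd_le h_b; [exact: ltW|exact: half_le|exact: half_le|].
have hE mi : h mi = if (1 < mlen mi.1)%N then f eps (mlen mi.1) 0%N mi.1 mi.2 else 0.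
  exact: integrable_partE.
pose fr := normal_terms r.+1 (fun l => f eps l 0%N) A B.
have frE1 l : (fun mi : mindex n.+1 => fr l 1%N mi.1 mi.2) = degc l A.
  apply/funext => -[i k]; rewrite /fr /normal_terms /degc /=.
  by case: (mlen i == l).
have frE2 l : (fun mi : mindex n.+1 => fr l r.+2 mi.1 mi.2) = degc l B.
  apply/funext => -[i k]; rewrite /fr /normal_terms /degc /= eqxx.
  by case: (mlen i == l).
have fr0 l s : s != 0%N -> s != 1%N -> s != r.+2 -> fr l s = fun _ _ => 0.
  move=> s0 s1 sr; apply/funext => i; apply/funext => k.
  by rewrite /fr /normal_terms (negbTE s0) (negbTE s1) (negbTE sr) if_same.
have degc_bnd l c KC : bnd (rho / 2) (sigma / 2) c KC ->
    bnd (rho / 2) (sigma / 2) (degc l c) KC.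
  apply: bnd_coef_le; first exact: ltW.
  by move=> mi; rewrite /degc; case: ifP => // _; rewrite cabs0 cabs_ge0.
have eps_small : eps <= 1 by lra.
exists Psi, fr; split.
- by rewrite -D2.
- split.
    have h4 : (4^-1 : R) + 4^-1 = 2^-1 by lra.
    rewrite -D2 -D4 -h4; apply: Psi_cov; first by rewrite invr_gt0.
    by rewrite h4.
  have h34 : (2^-1 : R) + 4^-1 = 3 / 4 by lra.
  move=> _ [z hz <-]; rewrite -D2 in hz.
  by have := Psi_in 2^-1 z; rewrite h34; apply.
- split.
  + split=> [l [|s] ls i k il|l l1 i k k0].
    * by rewrite /fr /normal_terms /=; have [h1 _] := ft; exact: h1.
    * by rewrite /fr /normal_terms /= il.
    by rewrite /fr /normal_terms /=; have [_ h2'] := ft; exact: h2'.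
  + move=> l s ls; have [s0|s0] := eqVneq s 0%N.
      rewrite s0 in ls *; rewrite /= expr0 mulr1; apply: ft_norm_le; first exact: ltW.
      have [h1 _] := ft; have := bnd_ft_norm (h1 l 0%N ls) (fb l 0%N ls).
      rewrite expr0 mulr1 => hb; by apply: bnd_le hb; [exact: ltW|exact: half_le|exact: half_le|].
    have [s1|s1] := eqVneq s 1%N.
      rewrite s1 expr1; apply: ft_norm_le; first exact: ltW.
      by rewrite frE1; exact: degc_bnd.
    have [sr|sr] := eqVneq s r.+2.
      rewrite sr; apply: ft_norm_le; first exact: ltW.
      by rewrite frE2; exact: degc_bnd.
    apply: ft_norm_le; first exact: ltW.
    rewrite fr0//; apply: rbound_le (rbound0 (x := fun=> 0) _) => // [mi|].
      by rewrite cabs0 mul0r.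
    by apply: mulr_ge0 => //; exact: exprn_ge0.
  move=> z hz; rewrite -D2 in hz.
  have -> : (H eps \o Psi) z - omega%:C * act z ord0 = ev h z + ev A z + ev B z.
    by rewrite -addrA -(AB_E z hz) /remainder; ring.
  rewrite D2 in hz.
  apply: eq_has_sum (has_sumD (has_sumD (degree_expansion 0 h_b2 hz)
    (degree_expansion 1 A_b hz)) (degree_expansion r.+2 B_b hz)) => -[l s] /=.
  case: s => [|[|s]] /=; rewrite ?addr0 ?add0r /present /=.
  + case: ifP => l1.
      rewrite ft_evalE; apply: eq_sum => mi; congr (_ * _).
      rewrite /fr /normal_terms /degc hE /=; case: eqP => [->|/eqP ml]; first by rewrite l1.
      by have [h1 _] := ft; rewrite h1.
    apply: ev_eq0 => mi; rewrite /degc hE; case: eqP => // ->.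
    by rewrite l1.
  + by rewrite ft_evalE frE1.
  case: eqP => [->|sr]; first by rewrite ft_evalE frE2.
  by rewrite ft_evalE ev_eq0// => mi; rewrite fr0//; exact/eqP.
- have [A_low A_star] := A_n.
  split=> [s /andP[s0 sr]|z hz hq].
    have [s1|s1] := eqVneq s 1%N.
      by rewrite s1; split=> i k k0; rewrite /fr /normal_terms /=; case: eqP => //= il;
        apply: A_low; rewrite //= il.
    have sn : s != r.+2 by rewrite neq_ltn ltnS sr.
    by rewrite !fr0// -lt0n.
  (* Among the orders to be summed only order 1 is nonzero, so the cancellation required is that of
     A. *)
  rewrite big_nat_recl// big1_seq ?addr0 => [|s].
    rewrite ft_evalE frE1.
    exact: (normalc_vanishes rho2 A_b A_n hz hq).
  rewrite mem_index_iota => /andP[_ /andP[s0 sr]].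
  have s1 : s.+1 != 1%N by rewrite eqSS -lt0n.
  have s2' : s.+1 != r.+2 by rewrite eqSS neq_ltn sr.
  by rewrite ft_evalE ev_eq0// => mi; rewrite fr0.
move=> frr; have [Ar Br] := AB_r frr; split.
  move=> l s ls i k; rewrite /fr /normal_terms.
  case: eqP => [s0|_].
    by rewrite s0 in ls; exact: (frr l 0%N ls i k).
  case: ifP => _; first by rewrite conjc0.
  case: ifP => _; first exact: (Ar (i, k)).
  case: ifP => _; first exact: (Br (i, k)).
  by rewrite conjc0.
(* Real points are the fixed points of conjugation, with which [Psi] commutes. *)
move=> z hz /real_point_conjv zr; apply/real_point_conjv.
by rewrite -D2 in hz; rewrite -Psi_real ?zr.
Qed.
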